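(* The flag space $F(1,2)=U(3)/(U(1)\times U(1)\times U(1))$ carries exactly one homogeneous strictly nearly Kähler metric up to scaling, and it is $3$-symmetric; and its only homogeneous Kähler metrics are $g_{\lambda,\mu}$, $g'_{\lambda,\mu}$ and $g''_{\lambda,\mu}$, $\lambda,\mu\in\,]0,+\infty[$. When $\lambda=\mu$ the latter correspond, up to scaling, to the natural Kähler metric of the twistor space of $\mathbb CP(2)$, the fibration over $\mathbb CP(2)$ being realized from $F(1,2)$ in three different ways.
   Context: Homogeneous means $U(3)$-invariant. A metric $g$ is nearly Kähler if there is an almost complex structure $J$ with $g(JX,JY)=g(X,Y)$ such that $(\nabla_XJ)Y=-(\nabla_YJ)X$ for all $X,Y$ ($\nabla$ the Levi-Civita connection); it is Kähler if $\nabla J=0$ for such a $J$, and strictly nearly Kähler if $\nabla J\neq0$. (For homogeneous structures $J$ is taken $U(3)$-invariant.) A $3$-symmetric space is a Riemannian manifold with global isometries $\theta_m$, $m\in M$, such that $\theta_m^3=\mathrm{Id}$ and $m$ is an isolated fixed point of $\theta_m$. For $a,b,c\in\mathbb C$ let $\langle a,b,c\rangle=\begin{pmatrix}0&a&b\\-\overline a&0&c\\-\overline b&-\overline c&0\end{pmatrix}$. The set $\mathfrak k$ of these matrices is an $Ad(U(1)^3)$-invariant complement in $\mathfrak u(3)$ of the diagonal subalgebra, identified with the tangent space of $F(1,2)$ at the base point. Put $\mathfrak l=\{\langle a,0,0\rangle\}$, $\mathfrak m=\{\langle0,b,0\rangle\}$, $\mathfrak n=\{\langle0,0,c\rangle\}$,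 $\langle X|Y\rangle=-\frac12\mathrm{Re}(\mathrm{tr}(XY))$. The invariant metric with coefficients $(r,s,t)$, $r,s,t>0$, is associated with the inner product equal to $r\langle\cdot|\cdot\rangle$ on $\mathfrak l$, $s\langle\cdot|\cdot\rangle$ on $\mathfrak m$, $t\langle\cdot|\cdot\rangle$ on $\mathfrak n$, these being mutually orthogonal. Then $g_{\lambda,\mu}$ is the metric with $s=\lambda$, $t=\mu$, $r=\lambda+\mu$; $g'_{\lambda,\mu}$ the one with $t=\lambda$, $r=\mu$, $s=\lambda+\mu$; $g''_{\lambda,\mu}$ the one with $r=\lambda$, $s=\mu$, $t=\lambda+\mu$. The three fibrations $F(1,2)\to\mathbb CP(2)$ send a flag $(l,p)$ in $\mathbb C^3$ to one of the three mutually orthogonal lines $l$, $l^\perp\cap p$, $p^\perp$; each is the twistor fibration of $\mathbb CP(2)$ with its standard metric $g_0$. The twistor metrics are $\pi^*g_0+\tau\,ds^2$, $\tau>0$, with $ds^2$ the standard metric of the fibre $\mathbb CP(1)$, and the natural Kähler metric is the member of this family that is Kähler. *)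

(* Defs.v *)
From HB Require Import structures.
From mathcomp Require Import all_boot all_order all_algebra spectral.
From mathcomp Require Import all_classical all_reals all_analysis.
From mathcomp Require Import complex.

Set Implicit Arguments.
Unset Strict Implicit.
Unset Printing Implicit Defensive.

Import Order.TTheory GRing.Theory Num.Theory.
Import numFieldNormedType.Exports.

Local Open Scope classical_set_scope.
Local Open Scope ring_scope.
Local Open Scope sesquilinear_scope.

(* A closed embedded submanifold M of a finite-dimensional real vector space V
   is handled through its underlying set.  Functions, vector fields and tensors
   on M are total functions on V whose values outside M are irrelevant; all the
   notions below look only at points of M and at tangent vectors of M. *)

Section Calculus.
Context {R : realType}.

(* C^k maps between finite-dimensional spaces, by iterated directional
   derivatives of (Frechet) differentiable maps. *)
Fixpoint Ck {V W : normedModType R} (k : nat) (f : V -> W) : Prop :=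
  if k is k'.+1 then
    (forall x, differentiable f x) /\ (forall v, Ck k' ('D_v f))
  else continuous f.

Definition smooth {V W : normedModType R} (f : V -> W) : Prop :=
  forall k, Ck k f.

(* On a closed submanifold the smooth functions are exactly the restrictions of
   smooth functions on the ambient space. *)
Definition smooth_on {V W : normedModType R} (M : set V) (f : V -> W) : Prop :=
  exists2 F : V -> W, smooth F & forall x, M x -> F x = f x.

Definition tangent {V : normedModType R} (M : set V) (x v : V) : Prop :=
  exists c : R -> V,
    [/\ c 0 = x, \forall t \near 0, M (c t), derivable c 0 1 & 'D_1 c 0 = v].

(* The derivative at x of a smooth map on M in the direction of a tangent
   vector v, computed on a smooth extension; it does not depend on the
   extension. *)
Definition diff_on {V W : normedModType R} (M : set V) (f : V -> W)
    (x v : V) : W :=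
  'D_v (xget f [set F : V -> W | smooth F /\ forall y, M y -> F y = f y]) x.

End Calculus.

Section Riemannian.
Context {R : realType} {V : normedModType R}.
Variable M : set V.

Definition vector_field (X : V -> V) : Prop :=
  smooth_on M X /\ forall x, M x -> tangent M x (X x).

Definition lie_bracket (X Y : V -> V) (x : V) : V :=
  diff_on M Y x (X x) - diff_on M X x (Y x).

Definition tensor2 := V -> V -> V -> R.

Definition eq_tensor2 (g h : tensor2) : Prop :=
  forall x v w, M x -> tangent M x v -> tangent M x w -> g x v w = h x v w.

Record riemannian_metric (g : tensor2) : Prop := {
  metric_linear : forall x (a : R) u v w, M x ->
    tangent M x u -> tangent M x v -> tangent M x w ->
    g x (a *: u + v) w = a * g x u w + g x v w;
  metric_sym : forall x v w, M x -> tangent M x v -> tangent M x w ->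
    g x v w = g x w v;
  metric_pos : forall x v, M x -> tangent M x v -> v != 0 -> 0 < g x v v;
  metric_smooth : forall X Y, vector_field X -> vector_field Y ->
    smooth_on M (fun x => g x (X x) (Y x)) }.

(* D X Y stands for the covariant derivative of Y along X. *)
Record affine_connection (D : (V -> V) -> (V -> V) -> V -> V) : Prop := {
  conn_field : forall X Y, vector_field X -> vector_field Y ->
    vector_field (D X Y);
  conn_ext : forall X X' Y Y', vector_field X -> vector_field X' ->
    vector_field Y -> vector_field Y' ->
    (forall x, M x -> X x = X' x) -> (forall x, M x -> Y x = Y' x) ->
    forall x, M x -> D X Y x = D X' Y' x;
  conn_linear_l : forall (f : V -> R) X X' Y, smooth_on M f ->
    vector_field X -> vector_field X' -> vector_field Y ->
    forall x, M x ->
      D (fun y => f y *: X y + X' y) Y x = f x *: D X Y x + D X' Y x;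
  conn_add_r : forall X Y Y', vector_field X ->
    vector_field Y -> vector_field Y' ->
    forall x, M x -> D X (fun y => Y y + Y' y) x = D X Y x + D X Y' x;
  conn_leibniz : forall (f : V -> R) X Y, smooth_on M f ->
    vector_field X -> vector_field Y ->
    forall x, M x ->
      D X (fun y => f y *: Y y) x
      = diff_on M f x (X x) *: Y x + f x *: D X Y x }.

Record levi_civita (g : tensor2) (D : (V -> V) -> (V -> V) -> V -> V) :
    Prop := {
  lc_connection : affine_connection D;
  lc_metric : forall X Y Z,
    vector_field X -> vector_field Y -> vector_field Z ->
    forall x, M x ->
      diff_on M (fun y => g y (Y y) (Z y)) x (X x)
      = g x (D X Y x) (Z x) + g x (Y x) (D X Z x);
  lc_torsion_free : forall X Y, vector_field X -> vector_field Y ->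
    forall x, M x -> D X Y x - D Y X x = lie_bracket X Y x }.

Record almost_complex (J : V -> V -> V) : Prop := {
  acs_tangent : forall x v, M x -> tangent M x v -> tangent M x (J x v);
  acs_linear : forall x (a : R) v w, M x -> tangent M x v -> tangent M x w ->
    J x (a *: v + w) = a *: J x v + J x w;
  acs_square : forall x v, M x -> tangent M x v -> J x (J x v) = - v;
  acs_smooth : forall X, vector_field X -> vector_field (fun x => J x (X x)) }.

Definition compatible (g : tensor2) (J : V -> V -> V) : Prop :=
  forall x v w, M x -> tangent M x v -> tangent M x w ->
    g x (J x v) (J x w) = g x v w.

(* (nabla_X J) Y *)
Definition nablaJ (D : (V -> V) -> (V -> V) -> V -> V) (J : V -> V -> V)
    (X Y : V -> V) (x : V) : V :=
  D X (fun y => J y (Y y)) x - J x (D X Y x).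

Definition nearly_parallel (D : (V -> V) -> (V -> V) -> V -> V)
    (J : V -> V -> V) : Prop :=
  forall X Y, vector_field X -> vector_field Y ->
    forall x, M x -> nablaJ D J X Y x = - nablaJ D J Y X x.

Definition parallel (D : (V -> V) -> (V -> V) -> V -> V)
    (J : V -> V -> V) : Prop :=
  forall X Y, vector_field X -> vector_field Y ->
    forall x, M x -> nablaJ D J X Y x = 0.

Definition diffeomorphism (h : V -> V) : Prop :=
  exists k : V -> V,
    [/\ smooth_on M h, smooth_on M k,
        forall x, M x -> M (h x) /\ M (k x) &
        forall x, M x -> k (h x) = x /\ h (k x) = x].

Definition preserves_metric (h : V -> V) (g : tensor2) : Prop :=
  forall x v w, M x -> tangent M x v -> tangent M x w ->
    g (h x) (diff_on M h x v) (diff_on M h x w) = g x v w.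

Definition preserves_acs (h : V -> V) (J : V -> V -> V) : Prop :=
  forall x v, M x -> tangent M x v ->
    J (h x) (diff_on M h x v) = diff_on M h x (J x v).

Definition isometry (g : tensor2) (h : V -> V) : Prop :=
  diffeomorphism h /\ preserves_metric h g.

(* A surjective submersion onto B; flags being compact, such a map from them is
   a locally trivial fibration. *)
Definition fibration {W : normedModType R} (B : set W) (p : V -> W) : Prop :=
  [/\ smooth_on M p, p @` M = B &
      forall x w, M x -> tangent B (p x) w ->
        exists2 v, tangent M x v & diff_on M p x v = w].

Definition three_symmetric (g : tensor2) : Prop :=
  exists theta : V -> V -> V, forall m, M m ->
    [/\ isometry g (theta m),
        forall x, M x -> theta m (theta m (theta m x)) = x,
        theta m m = m &
        \forall x \near m, M x -> theta m x = x -> x = m].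

End Riemannian.

Section Flags.
Context {R : realType}.
Local Notation C := (complex R).

(* Complex 3 x 3 matrices as a real normed space: (real part, imaginary part) *)
Definition cmx : normedModType R := ('M[R]_3 * 'M[R]_3)%type.

Definition to_mx (A : cmx) : 'M[C]_3 :=
  \matrix_(i, j) Complex (A.1 i j) (A.2 i j).

Definition of_mx (A : 'M[C]_3) : cmx :=
  (map_mx (@complex.Re R) A, map_mx (@complex.Im R) A).

Definition orth_projector (k : nat) (P : 'M[C]_3) : Prop :=
  [/\ P ^t* = P, P *m P = P & \rank P = k].

(* A subspace of C^3 is represented by the orthogonal projector onto it. *)
Definition CP2 : set cmx := [set P | orth_projector 1 (to_mx P)].

Definition flag_space : normedModType R := (cmx * cmx)%type.

(* F(1,2): flags (l, p), with l a line contained in the plane p *)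
Definition flags : set flag_space :=
  [set x | [/\ orth_projector 1 (to_mx x.1), orth_projector 2 (to_mx x.2) &
            to_mx x.2 *m to_mx x.1 = to_mx x.1]].

Definition flag_tensor : Type := @tensor2 R flag_space.

(* The natural action of U(3): (u l, u p) *)
Definition act (u : 'M[C]_3) (x : flag_space) : flag_space :=
  (of_mx (u *m to_mx x.1 *m u ^t*), of_mx (u *m to_mx x.2 *m u ^t*)).

(* The base point is (C e_1, C e_1 + C e_2); its stabilizer in U(3) is the
   diagonal subgroup U(1)^3. *)
Definition base_flag : flag_space :=
  (of_mx (delta_mx 0 0), of_mx (delta_mx 0 0 + delta_mx 1 1)).

Definition invariant_metric (g : flag_tensor) : Prop :=
  forall u : 'M[C]_3, u \is unitarymx -> preserves_metric flags (act u) g.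

Definition invariant_acs (J : flag_space -> flag_space -> flag_space) : Prop :=
  forall u : 'M[C]_3, u \is unitarymx -> preserves_acs flags (act u) J.

Definition homogeneous_metric (g : flag_tensor) : Prop :=
  riemannian_metric flags g /\ invariant_metric g.

Definition homogeneous_kahler (g : flag_tensor) : Prop :=
  homogeneous_metric g /\
  exists J D, [/\ almost_complex flags J, invariant_acs J,
    compatible flags g J, levi_civita flags g D & parallel flags D J].

Definition homogeneous_strict_nearly_kahler (g : flag_tensor) : Prop :=
  homogeneous_metric g /\
  exists J D, [/\ almost_complex flags J, invariant_acs J,
    compatible flags g J, levi_civita flags g D &
    nearly_parallel flags D J /\ ~ parallel flags D J].

(* The matrix < a, b, c > *)
Definition kmx (a b c : C) : 'M[C]_3 :=
  \matrix_(i, j) nth 0 (nth [::] [:: [:: 0; a; b];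
                                     [:: - a^*; 0; c];
                                     [:: - b^*; - c^*; 0]] i) j.

Definition kspace : set 'M[C]_3 :=
  [set X | exists a b c, X = kmx a b c].

Definition trace_form (X Y : 'M[C]_3) : R :=
  - (2^-1 * complex.Re (\tr (X *m Y))).

Definition kinner (r s t : R) (X Y : 'M[C]_3) : R :=
  r * trace_form (kmx (X 0 1) 0 0) (kmx (Y 0 1) 0 0)
  + s * trace_form (kmx 0 (X 0 2%:R) 0) (kmx 0 (Y 0 2%:R) 0)
  + t * trace_form (kmx 0 0 (X 1 2%:R)) (kmx 0 0 (Y 1 2%:R)).

(* The velocity at time 0 of exp (tau X) acting on the base point; on kspace
   this is the identification with the tangent space at the base point. *)
Definition base_tangent (X : 'M[C]_3) : flag_space :=
  (of_mx (X *m to_mx base_flag.1 - to_mx base_flag.1 *m X),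
   of_mx (X *m to_mx base_flag.2 - to_mx base_flag.2 *m X)).

Definition frame (x : flag_space) : 'M[C]_3 :=
  xget 1%:M [set u : 'M[C]_3 | u \is unitarymx /\ act u base_flag = x].

Definition to_k (x v : flag_space) : 'M[C]_3 :=
  xget 0 [set X | kspace X /\ diff_on flags (act (frame x)) base_flag
                                 (base_tangent X) = v].

(* The invariant metric with coefficients (r, s, t): the inner product on the
   tangent space at the base point is transported to x by an element of U(3)
   mapping the base point to x.  Changing this element changes kspace
   coordinates by Ad(U(1)^3), which preserves kinner r s t. *)
Definition coeff_metric (r s t : R) : flag_tensor := fun x v w =>
  kinner r s t (to_k x v) (to_k x w).

Definition g1 (la mu : R) : flag_tensor := coeff_metric (la + mu) la mu.

Definition g2 (la mu : R) : flag_tensor := coeff_metric mu (la + mu) la.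

Definition g3 (la mu : R) : flag_tensor := coeff_metric la mu (la + mu).

(* The three mutually orthogonal lines l, l^perp /\ p, p^perp of a flag *)
Definition flag_line (i : 'I_3) (x : flag_space) : cmx :=
  match val i with
  | 0 => x.1
  | 1 => x.2 - x.1
  | _ => of_mx 1%:M - x.2
  end.

(* The Fubini-Study metric, of holomorphic sectional curvature 4, on lines seen
   as projectors; restricted to the lines of a plane it is the standard metric
   of CP(1).  It is given by the same formula at all points. *)
Definition fubini_study (P Q : cmx) : R :=
  2^-1 * complex.Re (\tr (to_mx P *m to_mx Q)).

Definition vertical (i : 'I_3) (x v : flag_space) : Prop :=
  tangent flags x v /\ diff_on flags (flag_line i) x v = 0.

(* The horizontal space of the i-th fibration.  The vertical spaces have only
   one U(3)-invariant complement (at the base point the isotropy U(1)^3 acts on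
   the spaces of the < a, 0, 0 >, < 0, b, 0 >, < 0, 0, c > by inequivalent
   irreducible representations), so it is the orthogonal of the vertical space
   for any invariant metric, here the one induced by the ambient space;
   being invariant, the horizontal distribution that the Levi-Civita connection
   of CP(2) defines on the twistor space is this one. *)
Definition horizontal (i : 'I_3) (x v : flag_space) : Prop :=
  tangent flags x v /\
  forall w, vertical i x w ->
    complex.Re (\tr (to_mx v.1 *m to_mx w.1) + \tr (to_mx v.2 *m to_mx w.2))
    = 0.

Definition vertical_part (i : 'I_3) (x v : flag_space) : flag_space :=
  xget 0 [set w | vertical i x w /\ horizontal i x (v - w)].

(* The fibre over a line L is the CP(1) of lines in the plane L^perp; it is
   parametrized by either of the other two lines of the flag.  These are
   orthogonal complements of each other in L^perp, so they give the same
   metric on the fibre. *)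
Definition fibre_metric (i : 'I_3) : flag_tensor := fun x v w =>
  fubini_study
    (diff_on flags (flag_line (ordS i)) x (vertical_part i x v))
    (diff_on flags (flag_line (ordS i)) x (vertical_part i x w)).

Definition twistor_metric (i : 'I_3) (tau : R) : flag_tensor := fun x v w =>
  fubini_study (diff_on flags (flag_line i) x v)
               (diff_on flags (flag_line i) x w)
  + tau * fibre_metric i x v w.

(* tau is the parameter of the natural Kahler metric of the i-th fibration *)
Definition natural_kahler (i : 'I_3) (tau : R) : Prop :=
  0 < tau /\ homogeneous_kahler (twistor_metric i tau).

Definition scale_metric (c : R) (g : flag_tensor) :
    flag_tensor :=
  fun x v w => c * g x v w.

(* g is the natural Kahler metric of the i-th fibration, up to scaling *)
Definition is_natural_kahler_up_to_scaling (i : 'I_3) (g : flag_tensor) : Prop :=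
  exists tau c : R,
    [/\ unique (natural_kahler i) tau, 0 < c &
        eq_tensor2 flags g (scale_metric c (twistor_metric i tau))].

End Flags.

Arguments flag_tensor R : clear implicits.

(* Main.v *)
(* A flag is a triple of mutually orthogonal rank 1 projectors P_0, P_1, P_2
   summing to 1, and its tangent vectors are the triples [A, P_i] with A
   skew-Hermitian.  In a unitary frame adapted to the flag only the
   off-diagonal entries A_ab matter.  The isotropy group U(1)^3 acts on A_01,
   A_02, A_12 by inequivalent characters, so an invariant metric is
   \sum_(a < b) c_ab |A_ab|^2 with c_ab > 0, and an invariant almost complex structure
   multiplies A_ab by e_ab = i or -i, with e_ba = - e_ab.  Such a metric
   extends to a constant bilinear form on the space of triples of matrices,
   so its Levi-Civita connection is the ambient derivative followed by the
   orthogonal projection to the tangent space; its coefficients are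
   lam_abk = (c_ab + c_bk - c_ak) / (2 c_ab).  Comparing it with the canonical
   connection, for which J is parallel, J is parallel iff lam_abk (e_kb -
   e_ab) = 0 for distinct a, b, k, and nearly parallel iff lam_abk (e_kb -
   e_ab) = lam_bak (e_ak - e_ab).  When e_01, e_12, e_20 are equal, J is
   never parallel, and it is nearly parallel iff c_01 = c_02 = c_12;
   otherwise either condition says that one of the three c is the sum of the
   two others.  The twistor metrics have coefficients 1, 1 and tau, with tau
   on the vertical entry, so that they are Kahler iff tau = 2. *)
From HB Require Import structures.
From mathcomp Require Import all_boot all_order all_algebra spectral.
From mathcomp Require Import all_classical all_reals all_analysis.
From mathcomp Require Import complex ring lra.
Require Import Defs.

Set Implicit Arguments.
Unset Strict Implicit.
Unset Printing Implicit Defensive.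

Import Order.TTheory GRing.Theory Num.Theory.
Import numFieldNormedType.Exports.

Local Open Scope classical_set_scope.
Local Open Scope ring_scope.
Local Open Scope sesquilinear_scope.

(** * Smooth maps on submanifolds *)

(** Fields, metrics and connections are known on the flags only, while derivatives are those of
    smooth ambient extensions. So each object gets a formula ([hat], [fund], [blk], [proj_hat]) that
    is polynomial on the whole ambient space. A tangent vector v at x is [fund X x] with X =
    [hat x v] skew-Hermitian and off-diagonal in adapted frames. By the Jacobi identity the
    derivative along v of a field [H, P_i] is [D_v H - [X, H], P_i] + [X, [H, P_i]]. The first term
    is the canonical connection; it contains all derivatives of the field and drops out of nabla J.
    The second is algebraic in X and H, and its orthogonal projection produces the coefficients
    lam_abk. An arbitrary Levi-Civita connection agrees with the constructed one on the flags by
    uniqueness, so the conditions pass to any D and J of the statement. The curves demanded by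
    [tangent] come from the Cayley transform: it is rational, and boundedness of unitary matrices
    suffices to differentiate it at 0. *)

Section SmoothMaps.
Context {R : realType}.
Implicit Types T U V W : normedModType R.

Lemma smooth_differentiable V W (f : V -> W) x : smooth f -> differentiable f x.
Proof. by move=> /(_ 1%N) [df _]; apply: df. Qed.

Lemma smooth_derivable V W (f : V -> W) x v : smooth f -> derivable f x v.
Proof. by move=> sf; apply/diff_derivable/smooth_differentiable. Qed.

Lemma smooth_derive V W (f : V -> W) v : smooth f -> smooth ('D_v f).
Proof. by move=> sf k; have [_] := sf k.+1; apply. Qed.

Lemma smooth_deriveE V W (f : V -> W) x v : smooth f -> 'D_v f x = 'd f x v.
Proof. by move=> sf; rewrite deriveE //; apply: smooth_differentiable. Qed.

Lemma smooth_cst V W (w : W) : smooth (fun _ : V => w).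
Proof.
move=> k; elim: k w => [|k IH] w /=; first by move=> x; apply: cst_continuous.
split=> [x|v]; first exact: differentiable_cst.
rewrite (_ : 'D_v _ = fun=> 0); first exact: IH.
by apply/funext => x; rewrite derive_cst.
Qed.

Lemma CkD V W k (f g : V -> W) :
  Ck k f -> Ck k g -> Ck k (fun x => f x + g x).
Proof.
elim: k f g => [|k IH] f g /=.
  by move=> cf cg x; apply: continuousD; [apply: cf|apply: cg].
move=> [df cf] [diagf cg]; split=> [x|v]; first exact: differentiableD.
rewrite (_ : 'D_v _ = fun x => 'D_v f x + 'D_v g x); first exact: IH.
by apply/funext => x; rewrite deriveD //; apply: diff_derivable.
Qed.

Lemma smoothD V W (f g : V -> W) :
  smooth f -> smooth g -> smooth (fun x => f x + g x).
Proof. by move=> sf sg k; apply: CkD. Qed.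

Lemma Ck_cst V W k (w : W) : Ck k (fun _ : V => w).
Proof. exact: smooth_cst. Qed.

Lemma Ck_sum V W k (I : Type) (s : seq I) (f : I -> V -> W) :
  (forall i, Ck k (f i)) -> Ck k (fun x => \sum_(i <- s) f i x).
Proof.
move=> sf; elim: s => [|i s IH].
  rewrite (_ : (fun _ => _) = fun=> 0); first exact: Ck_cst.
  by apply/funext => x; rewrite big_nil.
rewrite (_ : (fun _ => _) = fun x => f i x + \sum_(j <- s) f j x).
  exact: CkD.
by apply/funext => x; rewrite big_cons.
Qed.

Lemma smooth_sum V W (I : Type) (s : seq I) (f : I -> V -> W) :
  (forall i, smooth (f i)) -> smooth (fun x => \sum_(i <- s) f i x).
Proof. by move=> sf k; apply: Ck_sum => i; apply: sf. Qed.

Lemma derive_linear V W (f : {linear V -> W}) x v :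
  continuous f -> 'D_v f x = f v.
Proof.
by move=> cf; rewrite deriveE ?diff_lin//; apply: linear_differentiable.
Qed.

Lemma smooth_linear V W (f : {linear V -> W}) : continuous f -> smooth f.
Proof.
move=> cf [|k] //=; split=> [x|v]; first exact: linear_differentiable.
rewrite (_ : 'D_v _ = fun=> f v); first exact: smooth_cst.
by apply/funext => x; rewrite derive_linear.
Qed.

Lemma differentiable_bilinear V U (U' : normedModType R) W (b : {bilinear U -> U' -> W}) f g (x : V) :
  continuous (fun p => b p.1 p.2) -> differentiable f x -> differentiable g x ->
  differentiable (fun x => b (f x) (g x)) x.
Proof.
move=> cb df diagf.
apply: (@differentiable_comp _ _ _ _ (fun x => (f x, g x))
          (fun p => b p.1 p.2)).
  exact: differentiable_pair.
exact: differentiable_bilin.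
Qed.

Lemma derive_bilinear V U (U' : normedModType R) W (b : {bilinear U -> U' -> W}) f g (x v : V) :
  continuous (fun p => b p.1 p.2) -> differentiable f x -> differentiable g x ->
  'D_v (fun x => b (f x) (g x)) x = b ('D_v f x) (g x) + b (f x) ('D_v g x).
Proof.
move=> cb df diagf.
rewrite deriveE; last exact: differentiable_bilinear.
rewrite (@diff_comp _ _ _ _ (fun x => (f x, g x)) (fun p => b p.1 p.2)); last 2 first.
- exact: differentiable_pair.
- exact: differentiable_bilin.
by rewrite diff_bilin// diff_pair //= !deriveE // addrC.
Qed.

Lemma smooth_bilinear V U (U' : normedModType R) W (b : {bilinear U -> U' -> W}) (f : V -> U) g :
  continuous (fun p => b p.1 p.2) -> smooth f -> smooth g ->
  smooth (fun x => b (f x) (g x)).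
Proof.
move=> cb sf sg k; elim: k f g sf sg => [|k IH] f g sf sg /=.
  move=> x; apply: differentiable_continuous.
  by apply: differentiable_bilinear => //; apply: smooth_differentiable.
split=> [x|v].
  by apply: differentiable_bilinear => //; apply: smooth_differentiable.
rewrite (_ : 'D_v _ = fun x => b ('D_v f x) (g x) + b (f x) ('D_v g x)).
  by apply: CkD; apply: IH => //; apply: smooth_derive.
by apply/funext => x; rewrite derive_bilinear //; apply: smooth_differentiable.
Qed.

(** Finite dimension is given by a finite family with continuous coordinate functionals: expanding
    in it makes every linear or bilinear map out of such spaces continuous, hence smooth. *)
Definition findim V := exists (I : finType) (e : I -> V) (l : I -> V -> R),
  [/\ forall i, continuous (l i), forall i, scalar (l i) &
      forall x, x = \sum_i l i x *: e i].

Definition bilin U V W (b : U -> V -> W) :=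
  (forall v, linear (b ^~ v)) /\ (forall u, linear (b u)).

Lemma findim_linear_continuous V W (f : V -> W) :
  findim V -> linear f -> continuous f.
Proof.
move=> [I [e [l [cl ll idE]]]] lf.
pose fl : {linear V -> W} := HB.pack f (GRing.isLinear.Build _ _ _ _ f lf).
rewrite (_ : f = fun x => \sum_i l i x *: f (e i)); last first.
  apply/funext => x; rewrite -[f]/(fl : V -> W) {1}(idE x) linear_sum.
  by apply: eq_bigr => i _; rewrite linearZ.
apply: (@Ck_sum _ _ 0 _ _ (fun i x => l i x *: f (e i))) => i x /=.
by apply: continuousZr_tmp; apply: cl.
Qed.

Lemma findim_bilinear_continuous U V W (b : U -> V -> W) :
  findim U -> findim V -> bilin b -> continuous (fun p : U * V => b p.1 p.2).
Proof.
move=> [I [e [l [cl ll idE]]]] fV [lb rb].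
pose bl v : {linear U -> W} :=
  HB.pack (b ^~ v) (GRing.isLinear.Build _ _ _ _ (b ^~ v) (lb v)).
rewrite (_ : (fun _ => _) = fun p => \sum_i l i p.1 *: b (e i) p.2); last first.
  apply/funext => -[x y] /=; rewrite -[b x y]/(bl y x) {1}(idE x) linear_sum.
  by apply: eq_bigr => i _; rewrite linearZ.
apply: (@Ck_sum (U * V)%type _ 0 _ _ (fun i p => l i p.1 *: b (e i) p.2)) => i p /=.
apply: continuousZ.
  by apply: (@continuous_comp _ _ _ fst (l i)); [exact: cvg_fst|exact: cl].
apply: (@continuous_comp _ _ _ snd (b (e i))); first exact: cvg_snd.
exact: (findim_linear_continuous fV (rb (e i))).
Qed.

Lemma smooth_lin V W (f : V -> W) : findim V -> linear f -> smooth f.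
Proof.
move=> fV lf.
pose fl : {linear V -> W} := HB.pack f (GRing.isLinear.Build _ _ _ _ f lf).
exact/(@smooth_linear _ _ fl)/findim_linear_continuous.
Qed.

Lemma derive_lin V W (f : V -> W) x v : findim V -> linear f -> 'D_v f x = f v.
Proof.
move=> fV lf.
pose fl : {linear V -> W} := HB.pack f (GRing.isLinear.Build _ _ _ _ f lf).
exact/(@derive_linear _ _ fl)/findim_linear_continuous.
Qed.

Section Bilin.
Context {U V W : normedModType R} {b : U -> V -> W}.
Hypotheses (fU : findim U) (fV : findim V) (bb : bilin b).
Let bl : {bilinear U -> V -> W} :=
  HB.pack b (@bilinear_isBilinear.Build _ _ _ _ *:%R *:%R b bb).

Lemma smooth_bilin (T : normedModType R) (f : T -> U) (g : T -> V) :
  smooth f -> smooth g -> smooth (fun x => b (f x) (g x)).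
Proof.
exact/(@smooth_bilinear _ _ _ _ bl)/findim_bilinear_continuous.
Qed.

Lemma differentiable_bilin_comp (T : normedModType R) (f : T -> U) (g : T -> V) x :
  differentiable f x -> differentiable g x ->
  differentiable (fun x => b (f x) (g x)) x.
Proof.
exact/(@differentiable_bilinear _ _ _ _ bl)/findim_bilinear_continuous.
Qed.

Lemma derive_bilin (T : normedModType R) (f : T -> U) (g : T -> V) x v :
  differentiable f x -> differentiable g x ->
  'D_v (fun x => b (f x) (g x)) x = b ('D_v f x) (g x) + b (f x) ('D_v g x).
Proof.
exact/(@derive_bilinear _ _ _ _ bl)/findim_bilinear_continuous.
Qed.
End Bilin.

Lemma smooth_comp_lin T V W (f : V -> W) (g : T -> V) :
  findim V -> linear f -> smooth g -> smooth (fun x => f (g x)).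
Proof.
move=> fV lf sg k; elim: k g sg => [|k IH] g sg /=.
  move=> x; apply: continuous_comp; first exact: (sg 0).
  exact: findim_linear_continuous.
have df y : differentiable f y by exact/smooth_differentiable/smooth_lin.
have diagf y : differentiable g y by exact: smooth_differentiable.
split=> [x|v]; first exact: differentiable_comp.
rewrite (_ : 'D_v _ = fun x => f ('D_v g x)); first exact/IH/smooth_derive.
apply/funext => x; rewrite deriveE; last exact: differentiable_comp.
by rewrite diff_comp //= -!deriveE // derive_lin.
Qed.

Lemma derive_comp_lin T V W (f : V -> W) (g : T -> V) x v :
  findim V -> linear f -> differentiable g x ->
  'D_v (fun x => f (g x)) x = f ('D_v g x).
Proof.
move=> fV lf diagf.
have df y : differentiable f y by exact/smooth_differentiable/smooth_lin.
rewrite deriveE; last exact: differentiable_comp.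
by rewrite diff_comp //= -!deriveE // derive_lin.
Qed.

Lemma bilin_scale V : bilin (fun (a : R) (v : V) => a *: v).
Proof.
split=> [v a x y|a k x y] /=; first by rewrite scalerDl scalerA.
by rewrite scalerDr !scalerA mulrC.
Qed.

Lemma findimR : findim R.
Proof.
exists unit, (fun=> 1), (fun=> id); split=> //.
  by move=> _ x; apply: cvg_id.
by move=> x; rewrite big_const card_unit /= addr0 /GRing.scale /= mulr1.
Qed.

Lemma smooth_scale T V (f : T -> R) (g : T -> V) :
  findim V -> smooth f -> smooth g -> smooth (fun x => f x *: g x).
Proof. by move=> fV; exact: (smooth_bilin findimR fV (bilin_scale V)). Qed.

Lemma derive_scale T V (f : T -> R) (g : T -> V) x v :
  findim V -> differentiable f x -> differentiable g x ->
  'D_v (fun x => f x *: g x) x = 'D_v f x *: g x + f x *: 'D_v g x.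
Proof. by move=> fV; exact: (derive_bilin findimR fV (bilin_scale V)). Qed.

Lemma findim_prod U V : findim U -> findim V -> findim (U * V)%type.
Proof.
move=> [I [e [l [cl ll idE]]]] [J [e' [l' [cl' ll' idE']]]].
exists (I + J)%type,
  (fun k => match k with inl i => (e i, 0) | inr j => (0, e' j) end),
  (fun k p => match k with inl i => l i p.1 | inr j => l' j p.2 end).
split.
- case=> i p.
    by apply: (@continuous_comp _ _ _ fst (l i)); [exact: cvg_fst|exact: cl].
  by apply: (@continuous_comp _ _ _ snd (l' i)); [exact: cvg_snd|exact: cl'].
- by case=> i a x y /=; [rewrite ll|rewrite ll'].
move=> [x y]; rewrite big_sumType /=.
pose f1 u : U * V := (u, 0); pose f2 v : U * V := (0, v).
rewrite (_ : (x, y) = f1 x + f2 y); last by rewrite /f1 /f2 /=; congr pair; rewrite ?addr0 ?add0r.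
have f1D : {morph f1 : a b / a + b} by move=> a b; rewrite /f1; congr pair; rewrite /= addr0.
have f2D : {morph f2 : a b / a + b} by move=> a b; rewrite /f2; congr pair; rewrite /= addr0.
rewrite {1}(idE x) {1}(idE' y) (big_morph f1 f1D (erefl _)) (big_morph f2 f2D (erefl _)).
by congr (_ + _); apply: eq_bigr => i _; congr pair; rewrite scaler0.
Qed.

Lemma findim_mx m n : findim 'M[R]_(m, n).
Proof.
exists ('I_m * 'I_n)%type, (fun p => delta_mx p.1 p.2), (fun p (A : 'M[R]_(m, n)) => A p.1 p.2).
split.
- by move=> p; exact: coord_continuous.
- by move=> p a A B /=; rewrite !mxE.
move=> A; rewrite [LHS]matrix_sum_delta pair_bigA /=.
by apply: eq_bigr.
Qed.

(** Expanding [X x] in coordinates replaces the moving direction by finitely many fixed ones, which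
    are the ones that [Ck] controls. *)
Lemma smooth_dderive V W (X : V -> V) (F : V -> W) :
  findim V -> findim W -> smooth X -> smooth F ->
  smooth (fun x => 'D_(X x) F x).
Proof.
move=> [I [e [l [cl ll idE]]]] fW sX sF.
have fV : findim V by exists I, e, l.
rewrite (_ : (fun _ => _) = fun x => \sum_i l i (X x) *: 'D_(e i) F x).
  apply: smooth_sum => i.
  have sl : smooth (fun x => l i (X x)) := smooth_comp_lin fV (ll i) sX.
  exact: smooth_scale fW sl (smooth_derive _ sF).
apply/funext => x; rewrite smooth_deriveE // {1}(idE (X x)) linear_sum.
by apply: eq_bigr => i _; rewrite linearZ smooth_deriveE.
Qed.

End SmoothMaps.

(** * Derivatives along tangent vectors of a submanifold *)

Section Tangent.
Context {R : realType} {V : normedModType R} (M : set V).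

Lemma tangent_mem x v : tangent M x v -> M x.
Proof. by move=> [c [<- Mc _ _]]; apply: nbhs_singleton Mc. Qed.

(** Along a curve c representing v, both sides are derivatives of F \o c and G \o c, which agree
    near 0. This makes [diff_on] independent of the extension, and allows equations that hold on the
    flags only to be differentiated. *)
Lemma derive_eq_on (W : normedModType R) (F G : V -> W) x v :
  differentiable F x -> differentiable G x -> (forall y, M y -> F y = G y) ->
  tangent M x v -> 'D_v F x = 'D_v G x.
Proof.
move=> dF dG FG [c [c0 Mc dc vc]].
have dc' : differentiable c 0 by apply/derivable1_diffP.
have key (H : V -> W) : differentiable H x -> 'D_v H x = 'D_1 (H \o c) 0.
  rewrite -c0 => dH; rewrite deriveE // [RHS]deriveE; last exact: differentiable_comp.
  by rewrite [in RHS]diff_comp //= -vc (deriveE _ dc').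
rewrite !key //; apply: near_eq_derive.
by apply: filterS Mc => t /= Mct; rewrite FG.
Qed.

Lemma diff_onE (W : normedModType R) (f F : V -> W) x v :
  smooth F -> (forall y, M y -> F y = f y) -> tangent M x v ->
  diff_on M f x v = 'D_v F x.
Proof.
move=> sF Ff tv; rewrite /diff_on; case: xgetP => [G _ [sG Gf]|/(_ F)[]//].
apply: derive_eq_on tv => //; try exact: smooth_differentiable.
by move=> y My; rewrite Gf// Ff.
Qed.

Lemma smooth_on_ext (W : normedModType R) (f g : V -> W) :
  (forall y, M y -> f y = g y) -> smooth_on M f -> smooth_on M g.
Proof. by move=> fg [F sF Ff]; exists F => // x Mx; rewrite Ff// fg. Qed.

Lemma diff_on_ext (W : normedModType R) (f g : V -> W) x v :
  (forall y, M y -> f y = g y) -> smooth_on M f -> tangent M x v ->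
  diff_on M f x v = diff_on M g x v.
Proof.
move=> fg [F sF Ff] tv.
rewrite (diff_onE sF Ff tv) (diff_onE sF _ tv) // => y My.
by rewrite Ff// fg.
Qed.
End Tangent.

(** * Commutators and blocks of 3 x 3 matrices *)

Lemma ord3P (P : 'I_3 -> Prop) : P 0 -> P 1 -> P 2%:R -> forall i, P i.
Proof.
move=> P0 P1 P2 [[|[|[|//]]] Hi].
- by rewrite (_ : Ordinal Hi = 0) //; apply: val_inj.
- by rewrite (_ : Ordinal Hi = 1) //; apply: val_inj.
- by rewrite (_ : Ordinal Hi = 2%:R) //; apply: val_inj.
Qed.

Section Adjoint.
Context {C : numClosedFieldType}.

Lemma adjM m n p (A : 'M[C]_(m, n)) (B : 'M[C]_(n, p)) :
  (A *m B)^t* = B^t* *m A^t*.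
Proof. by rewrite trmx_mul map_mxM. Qed.

Lemma adjD m n (A B : 'M[C]_(m, n)) : (A + B)^t* = A^t* + B^t*.
Proof. by rewrite linearD map_mxD. Qed.

Lemma adjN m n (A : 'M[C]_(m, n)) : (- A)^t* = - A^t*.
Proof. by rewrite linearN map_mxN. Qed.

Lemma adjB m n (A B : 'M[C]_(m, n)) : (A - B)^t* = A^t* - B^t*.
Proof. by rewrite adjD adjN. Qed.

Lemma adjZ m n a (A : 'M[C]_(m, n)) : (a *: A)^t* = a^* *: A^t*.
Proof. by rewrite linearZ map_mxZ. Qed.

Lemma adj1 n : (1%:M : 'M[C]_n)^t* = 1%:M.
Proof. by rewrite trmx1 map_mx1. Qed.

Lemma adj_delta m n i j : (delta_mx i j : 'M[C]_(m, n))^t* = delta_mx j i.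
Proof. by rewrite trmx_delta map_delta_mx. Qed.

Lemma adj_sum m n (I : Type) (s : seq I) (F : I -> 'M[C]_(m, n)) :
  (\sum_(i <- s) F i)^t* = \sum_(i <- s) (F i)^t*.
Proof.
apply: (big_morph (fun A : 'M[C]_(m, n) => A^t*)); first exact: adjD.
by rewrite linear0 map_mx0.
Qed.

Lemma unitarymxVP n (u : 'M[C]_n) : u \is unitarymx -> u^t* *m u = 1%:M.
Proof. by move=> uu; apply: mulmx1C; apply/unitarymxP. Qed.

End Adjoint.

Lemma addmxE (V : nmodType) m n (A B : 'M[V]_(m, n)) i j :
  (A + B) i j = A i j + B i j.
Proof. exact: mxE. Qed.

Lemma oppmxE (V : zmodType) m n (A : 'M[V]_(m, n)) i j : (- A) i j = - A i j.
Proof. exact: mxE. Qed.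

Lemma scalemxE (K : nzRingType) m n a (A : 'M[K]_(m, n)) i j :
  (a *: A) i j = a * A i j.
Proof. exact: mxE. Qed.

HB.lock Definition comm (C : numClosedFieldType) (A B : 'M[C]_3) : 'M[C]_3 :=
  A *m B - B *m A.

(** In a frame adapted to the projectors P this multiplies the entry (a, b) by [f a b] (see
    [co_blk]). Almost complex structures and vertical parts are such maps, and orthogonal
    projections are sums of them. *)
HB.lock Definition blk (C : numClosedFieldType) (P : 'I_3 -> 'M[C]_3)
    (f : 'I_3 -> 'I_3 -> C) (M : 'M[C]_3) : 'M[C]_3 :=
  \sum_a \sum_b f a b *: (P a *m M *m P b).

(** The matrix of M in the unitary frame u, where the projectors of the flag become diagonal matrix
    units. *)
HB.lock Definition co (C : numClosedFieldType) (u M : 'M[C]_3) : 'M[C]_3 :=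
  u^t* *m M *m u.

Section Algebra.
Context {C : numClosedFieldType}.
Implicit Types (A B X Y M u : 'M[C]_3) (f g c : 'I_3 -> 'I_3 -> C).

Lemma commE A B : comm A B = A *m B - B *m A.
Proof. by rewrite comm.unlock. Qed.

Lemma commDl A B X : comm (A + B) X = comm A X + comm B X.
Proof. by rewrite !commE mulmxDl mulmxDr opprD addrACA. Qed.

Lemma commDr X A B : comm X (A + B) = comm X A + comm X B.
Proof. by rewrite !commE mulmxDl mulmxDr opprD addrACA. Qed.

Lemma commNl X A : comm (- X) A = - comm X A.
Proof. by rewrite !commE mulmxN mulNmx opprD. Qed.

Lemma commNr X A : comm X (- A) = - comm X A.
Proof. by rewrite !commE mulmxN mulNmx opprD. Qed.

Lemma commBl A B X : comm (A - B) X = comm A X - comm B X.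
Proof. by rewrite commDl commNl. Qed.

Lemma commBr X A B : comm X (A - B) = comm X A - comm X B.
Proof. by rewrite commDr commNr. Qed.

Lemma comm1r X : comm X 1%:M = 0.
Proof. by rewrite !commE mulmx1 mul1mx subrr. Qed.

Lemma commM X A B : comm X (A *m B) = comm X A *m B + A *m comm X B.
Proof. by rewrite !commE mulmxBl mulmxBr !mulmxA addrA subrK. Qed.

Lemma commZr X a A : comm X (a *: A) = a *: comm X A.
Proof. by rewrite !commE -scalemxAr -scalemxAl -scalerBr. Qed.

Lemma comm_sum X (I : Type) (s : seq I) (F : I -> 'M[C]_3) :
  comm X (\sum_(i <- s) F i) = \sum_(i <- s) comm X (F i).
Proof.
apply: (big_morph (comm X)); first exact: commDr.
by rewrite commE mulmx0 mul0mx subrr.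
Qed.

Lemma commC A B : comm A B = - comm B A.
Proof. by rewrite !commE opprB. Qed.

Lemma jacobi X Y A : comm X (comm Y A) = comm (comm X Y) A + comm Y (comm X A).
Proof.
rewrite {1}(commE Y A) commBr !commM (commE (comm X Y)) (commE Y (comm X A)).
by rewrite [comm X A *m Y + _]addrC opprD addrACA.
Qed.

Lemma adj_comm A B : (comm A B)^t* = comm (B^t*) (A^t*).
Proof. by rewrite !commE adjB !adjM. Qed.

Lemma blkE P f M : blk P f M = \sum_a \sum_b f a b *: (P a *m M *m P b).
Proof. by rewrite blk.unlock. Qed.

(** Obtained by solving \sum_ij c_ij tr (U_i [Y, P_j]) = 2 \sum_ab c_ab Z_ab Y_ba for Z: each U_i
    contributes (c_ia - c_ib) (U_i)_ab in front of Y_ba. At a = b the numerator vanishes, so Z has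
    no diagonal. *)
Definition proj_hat_coef c (i a b : 'I_3) : C := (c a i - c b i) / (2%:R * c a b).

(* [proj_hat P c U] is the block off-diagonal matrix whose brackets with the
   [P i] form the projection of [U] to the tangent space at [P] that is
   orthogonal for the metric with coefficients [c]. *)
Definition proj_hat P c (U : 'I_3 -> 'M[C]_3) := \sum_i blk P (proj_hat_coef c i) (U i).

Lemma coE u M : co u M = u^t* *m M *m u.
Proof. by rewrite co.unlock. Qed.

Section Frame.
Variables (u : 'M[C]_3) (uu : u \is unitarymx).
Let uV := unitarymxVP uu.
Let uK : u *m u^t* = 1%:M. Proof. exact/unitarymxP. Qed.
Let P i := u *m delta_mx i i *m u^t*.

Lemma coD A B : co u (A + B) = co u A + co u B.
Proof. by rewrite !coE mulmxDr mulmxDl. Qed.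

Lemma coN A : co u (- A) = - co u A.
Proof. by rewrite !coE mulmxN mulNmx. Qed.

Lemma coB A B : co u (A - B) = co u A - co u B.
Proof. by rewrite coD coN. Qed.

Lemma coZ a A : co u (a *: A) = a *: co u A.
Proof. by rewrite !coE -scalemxAr -scalemxAl. Qed.

Lemma coM A B : co u (A *m B) = co u A *m co u B.
Proof. by rewrite !coE -!mulmxA (mulmxA u) uK mul1mx. Qed.

Lemma co_comm A B : co u (comm A B) = comm (co u A) (co u B).
Proof. by rewrite !commE coB !coM. Qed.

Lemma co_sum (I : Type) (s : seq I) (F : I -> 'M[C]_3) :
  co u (\sum_(i <- s) F i) = \sum_(i <- s) co u (F i).
Proof.
apply: (big_morph (co u)); first exact: coD.
by rewrite !coE mulmx0 mul0mx.
Qed.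

Lemma co_adj A : co u (A^t*) = (co u A)^t*.
Proof. by rewrite !coE !adjM trmxCK mulmxA. Qed.

Lemma coK A : u *m co u A *m u^t* = A.
Proof. by rewrite !coE !mulmxA uK mul1mx -mulmxA uK mulmx1. Qed.

Lemma coVK A : co u (u *m A *m u^t*) = A.
Proof. by rewrite !coE !mulmxA uV mul1mx -mulmxA uV mulmx1. Qed.

Lemma co_inj : injective (co u).
Proof. exact: (can_inj (g := fun M => u *m M *m u^t*)) coK. Qed.

Lemma co_tr A : \tr (co u A) = \tr A.
Proof. by rewrite !coE mxtrace_mulC mulmxA uK mul1mx. Qed.

Lemma co_proj i : co u (P i) = delta_mx i i.
Proof. exact: coVK. Qed.

Lemma co_corner i j M :
  co u (P i *m M *m P j) = delta_mx i i *m co u M *m delta_mx j j.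
Proof. by rewrite (coM _ (P j)) (coM (P i)) !co_proj. Qed.

Lemma mul_delta_deltaE i j M a b :
  (delta_mx i i *m M *m delta_mx j j : 'M[C]_3) a b = (M a b) *+ ((a == i) && (b == j)).
Proof.
rewrite mxE (bigD1 j) //= [X in _ + X]big1 ?addr0 => [|k kj]; last first.
  by rewrite [X in _ * X]mxE (negbTE kj) mulr0.
rewrite mxE (bigD1 i) //= [X in _ + X]big1 ?addr0 => [|k ki]; last first.
  by rewrite mxE (negbTE ki) andbF mul0r.
rewrite !mxE !eqxx andbT /=.
by case: eqP => [->|] /=; case: eqP => [->|] /=; rewrite ?mulr1n ?mulr0n ?mul1r ?mulr1 ?mul0r ?mulr0.
Qed.

Lemma co_blk f M a b : co u (blk P f M) a b = f a b * co u M a b.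
Proof.
rewrite !blkE co_sum summxE (bigD1 a) //= [X in _ + X]big1 ?addr0 => [|i ia]; last first.
  rewrite co_sum summxE big1 // => j _.
  by rewrite coZ co_corner mxE mul_delta_deltaE eq_sym (negbTE ia) mulr0.
rewrite co_sum summxE (bigD1 b) //= [X in _ + X]big1 ?addr0 => [|i ib]; last first.
  by rewrite coZ co_corner mxE mul_delta_deltaE [b == i]eq_sym (negbTE ib) andbF mulr0.
by rewrite coZ co_corner mxE mul_delta_deltaE !eqxx.
Qed.

Lemma co_proj_hat c U a b :
  co u (proj_hat P c U) a b = \sum_i proj_hat_coef c i a b * co u (U i) a b.
Proof. by rewrite /proj_hat co_sum summxE; apply: eq_bigr => i _; rewrite co_blk. Qed.

Lemma mul_mx_deltaE i M a b : (M *m delta_mx i i : 'M[C]_3) a b = M a b *+ (b == i).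
Proof.
have := mul_delta_deltaE a i M a b; rewrite eqxx /= => <-.
rewrite -mulmxA [RHS]mxE (bigD1 a) //= [X in _ + X]big1 ?addr0 => [|k ka].
  by rewrite [delta_mx _ _ _ _]mxE !eqxx mul1r.
by rewrite [delta_mx _ _ _ _]mxE (negbTE ka) andbF mul0r.
Qed.

Lemma mul_delta_mxE i M a b : (delta_mx i i *m M : 'M[C]_3) a b = M a b *+ (a == i).
Proof.
rewrite mxE (bigD1 i) //= [X in _ + X]big1 ?addr0 => [|k ki].
  by rewrite !mxE eqxx andbT; case: eqP => [->|]; rewrite ?mul1r ?mul0r.
by rewrite mxE (negbTE ki) andbF mul0r.
Qed.

Lemma mul_mx_delta_mxE i A M a b :
  (A *m delta_mx i i *m M : 'M[C]_3) a b = A a i * M i b.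
Proof.
rewrite mxE (bigD1 i) //= [X in _ + X]big1 ?addr0 => [|k ki].
  by rewrite mul_mx_deltaE eqxx mulr1n.
by rewrite mul_mx_deltaE (negbTE ki) mul0r.
Qed.

Lemma co_comm_proj X i a b :
  co u (comm X (P i)) a b = co u X a b * ((b == i)%:R - (a == i)%:R).
Proof.
rewrite co_comm co_proj commE addmxE oppmxE mul_mx_deltaE mul_delta_mxE.
by rewrite mulrBr !mulr_natr.
Qed.

Lemma sum_delta (F : 'I_3 -> C) (a : 'I_3) : \sum_i F i * (a == i)%:R = F a.
Proof.
rewrite (bigD1 a) //= [X in _ + X]big1 ?addr0 => [|i ia]; first by rewrite eqxx mulr1.
by rewrite eq_sym (negbTE ia) mulr0.
Qed.

Definition admissible c :=
  [/\ forall a, c a a = 0, forall a b, c a b = c b a &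
      forall a b, a != b -> c a b != 0].

Section Coefficients.
Variables (c : 'I_3 -> 'I_3 -> C) (hc : admissible c).

(** Only i = a and i = b contribute, with total weight (c_ab + c_ba) / (2 c_ab) = 1; so a tangent
    triple gives back its matrix, up to the diagonal. *)
Lemma co_proj_hat_comm X a b :
  co u (proj_hat P c (fun i => comm X (P i))) a b = co u X a b *+ (a != b).
Proof.
have [c0 cC cN] := hc; rewrite co_proj_hat.
under eq_bigr do rewrite co_comm_proj mulrBr mulrBr !mulrA.
rewrite sumrB !sum_delta /proj_hat_coef; have [->|ab] := eqVneq a b; first by rewrite subrr.
by rewrite !c0 (cC b a) mulr1n; field; apply: cN.
Qed.

Definition conn_coef (a b k : 'I_3) : C := (c a b + c b k - c a k) / (2%:R * c a b).

(** In the frame, [x, [y, E_ii]]_ab contains (x y)_ab for i = b and (y x)_ab for i = a, with weights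
    1/2 and -1/2, minus x_ai y_ib + y_ai x_ib with weight (c_ai - c_bi) / (2 c_ab). Collecting the
    coefficient of x_ak y_kb gives [conn_coef c a b k]; that of y_ak x_kb is its mirror image. *)
Lemma co_proj_hat_comm_comm X Y a b : a != b ->
  co u (proj_hat P c (fun i => comm X (comm Y (P i)))) a b =
  \sum_k (conn_coef a b k * (co u X a k * co u Y k b)
         - conn_coef b a k * (co u Y a k * co u X k b)).
Proof.
move=> ab; have [c0 cC cN] := hc; rewrite co_proj_hat.
have E (x y : 'M[C]_3) i : comm x (comm y (delta_mx i i)) a b =
    (x *m y) a b * (b == i)%:R + (y *m x) a b * (a == i)%:R
    - (x a i * y i b + y a i * x i b).
  rewrite !commE mulmxBr mulmxBl !mulmxA.
  rewrite !(addmxE, oppmxE) mul_mx_deltaE -[_ *m y *m x]mulmxA mul_delta_mxE.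
  by rewrite !mul_mx_delta_mxE !mulr_natr; ring.
under eq_bigr do rewrite !co_comm co_proj E mulrBr mulrDr !mulrA.
rewrite sumrB big_split /= !sum_delta.
have mE (x y : 'M[C]_3) : (x *m y) a b = \sum_k x a k * y k b by rewrite mxE.
move: (co u X) (co u Y) => x y; rewrite !mE.
rewrite !mulr_sumr -big_split -sumrB /=; apply: eq_bigr => k _.
have cab : c a b != 0 := cN _ _ ab.
by rewrite /proj_hat_coef /conn_coef !c0 (cC b a); field.
Qed.
Lemma trace_comm_proj A Y j :
  \tr (A *m comm Y (P j)) =
  \sum_a \sum_b co u A a b * co u Y b a * ((a == j)%:R - (b == j)%:R).
Proof.
rewrite -co_tr coM /mxtrace; apply: eq_bigr => a _.
by rewrite mxE; apply: eq_bigr => b _; rewrite co_comm_proj mulrA.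
Qed.

(** The pairing of an arbitrary triple U with a tangent one sees [proj_hat P c U] only; this is what
    makes [proj_hat] an orthogonal projection. *)
Lemma trace_proj_hat U Y :
  \sum_i \sum_j c i j * \tr (U i *m comm Y (P j)) =
  \sum_a \sum_b 2%:R * c a b * co u (proj_hat P c U) a b * co u Y b a.
Proof.
have [c0 cC cN] := hc.
have E i : \sum_j c i j * \tr (U i *m comm Y (P j)) =
    \sum_a \sum_b (c i a - c i b) * (co u (U i) a b * co u Y b a).
  under eq_bigr do rewrite trace_comm_proj mulr_sumr.
  rewrite exchange_big /=; apply: eq_bigr => a _.
  under eq_bigr do rewrite mulr_sumr.
  rewrite exchange_big /=; apply: eq_bigr => b _.
  have F j : c i j * (co u (U i) a b * co u Y b a * ((a == j)%:R - (b == j)%:R)) =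
    (co u (U i) a b * co u Y b a) * (c i j * (a == j)%:R - c i j * (b == j)%:R) by ring.
  by under eq_bigr do rewrite F; rewrite -mulr_sumr sumrB !sum_delta mulrC.
under eq_bigr do rewrite E.
rewrite exchange_big /=; apply: eq_bigr => a _.
rewrite exchange_big /=; apply: eq_bigr => b _.
rewrite co_proj_hat mulr_sumr mulr_suml; apply: eq_bigr => i _.
rewrite /proj_hat_coef (cC a i) (cC b i); have [->|ab] := eqVneq a b.
  by rewrite subrr !mul0r mulr0 mul0r.
by have cab := cN _ _ ab; field.
Qed.

(** [proj_hat_coef] is real and changes sign when a and b are exchanged, which turns Hermitian
    components into a skew-Hermitian matrix. *)
Lemma proj_hat_adj U : (forall a b, (c a b)^* = c a b) ->
  (forall i, (U i)^t* = U i) -> (proj_hat P c U)^t* = - proj_hat P c U.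
Proof.
move=> cR Ua; have [c0 cC cN] := hc; apply: co_inj.
rewrite co_adj coN; apply/matrixP => a b.
have tE M : (M^t*) a b = (M b a)^* by rewrite !mxE.
rewrite oppmxE tE !co_proj_hat.
rewrite rmorph_sum -sumrN; apply: eq_bigr => i _.
rewrite rmorphM -mulNr; congr (_ * _).
  by rewrite /proj_hat_coef rmorphM fmorphV rmorphM rmorphB /= !cR conjC_nat (cC b a) -mulNr opprB.
by rewrite /= -tE -co_adj Ua.
Qed.

End Coefficients.
End Frame.

Lemma cjM u A B : u \is unitarymx ->
  u *m A *m u^t* *m (u *m B *m u^t*) = u *m (A *m B) *m u^t*.
Proof. by move=> uu; rewrite -!mulmxA (mulmxA (u^t*) u) unitarymxVP // mul1mx. Qed.

Lemma cj_tr u A : u \is unitarymx -> \tr (u *m A *m u^t*) = \tr A.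
Proof. by move=> uu; rewrite mxtrace_mulC mulmxA unitarymxVP // mul1mx. Qed.

Lemma cj_comm u A B : u \is unitarymx ->
  comm (u *m A *m u^t*) (u *m B *m u^t*) = u *m comm A B *m u^t*.
Proof. by move=> uu; rewrite !commE !cjM // mulmxBr mulmxBl. Qed.

Lemma cj_adj u A : (u *m A *m u^t*)^t* = u *m A^t* *m u^t*.
Proof. by rewrite !adjM trmxCK mulmxA. Qed.

Lemma cj_proj_mul u (i j : 'I_3) : u \is unitarymx ->
  u *m delta_mx i i *m u^t* *m (u *m delta_mx j j *m u^t*) =
  (i == j)%:R *: (u *m delta_mx i i *m u^t*).
Proof.
move=> uu; rewrite cjM // mul_delta_mx_cond; have [->|_] := eqVneq i j.
  by rewrite mulr1n scale1r.
by rewrite mulr0n scale0r mulmx0 mul0mx.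
Qed.

Lemma cj_proj_adj u (i : 'I_3) :
  (u *m delta_mx i i *m u^t*)^t* = u *m delta_mx i i *m u^t*.
Proof. by rewrite cj_adj adj_delta. Qed.

Lemma cj_cj u u' A : u *m (u' *m A *m u'^t*) *m u^t* = (u *m u') *m A *m (u *m u')^t*.
Proof. by rewrite adjM !mulmxA. Qed.

Lemma cj1 A : 1%:M *m A *m (1%:M)^t* = A.
Proof. by rewrite adj1 mul1mx mulmx1. Qed.

Lemma cj_projector_mul (B A : 'M[C]_3) u : u \is unitarymx -> B *m A = A ->
  u *m B *m u^t* *m (u *m A *m u^t*) = u *m A *m u^t*.
Proof. by move=> uu BA; rewrite cjM // BA. Qed.

Lemma cj_is_linear u a A B :
  u *m (a *: A + B) *m u^t* = a *: (u *m A *m u^t*) + u *m B *m u^t*.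
Proof. by rewrite mulmxDr mulmxDl -scalemxAr -scalemxAl. Qed.

Lemma commZl a X A : comm (a *: X) A = a *: comm X A.
Proof. by rewrite !commE -scalemxAl -scalemxAr -scalerBr. Qed.
Lemma blkD P f A B : blk P f (A + B) = blk P f A + blk P f B.
Proof.
rewrite !blkE -big_split; apply: eq_bigr => a _; rewrite -big_split.
by apply: eq_bigr => b _; rewrite mulmxDr mulmxDl scalerDr.
Qed.

Lemma blkZ P f z A : blk P f (z *: A) = z *: blk P f A.
Proof.
rewrite !blkE scaler_sumr; apply: eq_bigr => a _; rewrite scaler_sumr.
by apply: eq_bigr => b _; rewrite -scalemxAr -scalemxAl !scalerA mulrC.
Qed.

Lemma adj_blk P f A : (forall i, (P i)^t* = P i) -> (forall a b, (f b a)^* = f a b) ->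
  A^t* = - A -> (blk P f A)^t* = - blk P f A.
Proof.
move=> Pa fa As; rewrite !blkE adj_sum; under eq_bigr do rewrite adj_sum.
rewrite exchange_big -sumrN; apply: eq_bigr => a _.
rewrite -sumrN; apply: eq_bigr => b _.
by rewrite adjZ fa !adjM !Pa As mulNmx mulmxN scalerN mulmxA.
Qed.

Lemma proj_hatD P c (U V : 'I_3 -> 'M[C]_3) :
  proj_hat P c (fun i => U i + V i) = proj_hat P c U + proj_hat P c V.
Proof.
by rewrite /proj_hat -big_split; apply: eq_bigr => i _; rewrite blkD.
Qed.

Lemma proj_hatZ P c z (U : 'I_3 -> 'M[C]_3) :
  proj_hat P c (fun i => z *: U i) = z *: proj_hat P c U.
Proof.
by rewrite /proj_hat scaler_sumr; apply: eq_bigr => i _; rewrite blkZ.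
Qed.

(* The canonical connection commutes with the invariant endomorphisms
   [blk P f], so only its difference with the Levi-Civita connection contributes
   to the derivative of an almost complex structure. *)
Lemma blk_derivation P f X A D :
  \sum_a \sum_b f a b *: (comm X (P a) *m A *m P b + P a *m D *m P b
                         + P a *m A *m comm X (P b))
  - comm X (blk P f A) = blk P f (D - comm X A).
Proof.
rewrite !blkE comm_sum -sumrB; apply: eq_bigr => a _.
rewrite comm_sum -sumrB; apply: eq_bigr => b _.
rewrite commZr -scalerBr !commM [P a *m (D - _)]mulmxBr.
rewrite [(P a *m D - _) *m _]mulmxBl mulmxDl; congr (_ *: _).
by apply/matrixP => i j; rewrite !(addmxE, oppmxE); ring.
Qed.

Section TangentAlgebra.
Variables P V : 'I_3 -> 'M[C]_3.
Hypothesis Pmul : forall i j, P i *m P j = (i == j)%:R *: P i.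
Hypothesis Psum : \sum_i P i = 1%:M.
Hypothesis Vsum : \sum_i V i = 0.
Hypothesis PV : forall i j, V i *m P j + P i *m V j = (i == j)%:R *: V i.

Definition hatm (P V : 'I_3 -> 'M[C]_3) := \sum_i V i *m P i.

(** [PV] is the derivative of P_i P_j = delta_ij P_i. It gives P_j V_i P_i = delta_ij V_i P_i - V_j
    P_i; summing over i with \sum_i P_i = 1 leaves P_j H = V_j P_j - V_j for H = [hatm P V], while H
    P_j = V_j P_j. *)
Lemma comm_hatm j : comm (hatm P V) (P j) = V j.
Proof.
have E1 : hatm P V *m P j = V j *m P j.
  rewrite /hatm mulmx_suml (bigD1 j) //= [X in _ + X]big1 ?addr0; last first.
    by move=> i ij; rewrite -mulmxA Pmul (negbTE ij) scale0r mulmx0.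
  by rewrite -mulmxA Pmul eqxx scale1r.
rewrite commE E1 /hatm mulmx_sumr.
have E i : P j *m (V i *m P i) = (j == i)%:R *: (V i *m P i) - V j *m P i.
  have /eqP := PV j i; rewrite addrC eq_sym -subr_eq eq_sym => /eqP PE.
  rewrite mulmxA PE mulmxBl -scalemxAl -mulmxA Pmul eqxx scale1r.
  by have [->|] := eqVneq j i; rewrite // !scale0r.
under eq_bigr do rewrite E.
rewrite sumrB -mulmx_sumr Psum mulmx1.
rewrite (bigD1 j) //= eqxx scale1r big1 => [|i ij].
  by rewrite addr0 opprB addrC subrK.
by rewrite eq_sym (negbTE ij) scale0r.
Qed.

Hypothesis Padj : forall i, (P i)^t* = P i.
Hypothesis Vadj : forall i, (V i)^t* = V i.

(** H = [hatm P V] plus its adjoint is \sum_i (V_i P_i + P_i V_i) = \sum_i V_i = 0, by the case i =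
    j of [PV]. *)
Lemma adj_hatm : (hatm P V)^t* = - hatm P V.
Proof.
rewrite /hatm adj_sum; under eq_bigr do rewrite adjM Padj Vadj.
apply/eqP; rewrite -addr_eq0 addrC -big_split /=.
by under eq_bigr do rewrite PV eqxx scale1r; rewrite Vsum.
Qed.
End TangentAlgebra.

(** The second hypothesis linearizes Q Q = Q. Multiplied by Q on both sides it yields Q M Q = 0, so
    the double bracket M Q - 2 Q M Q + Q M is M. It serves to lift tangent vectors of CP(2) to the
    flags. *)
Lemma comm_comm_projector (Q M : 'M[C]_3) : Q *m Q = Q -> M *m Q + Q *m M = M ->
  comm (comm M Q) Q = M.
Proof.
move=> QQ MQ.
have QMQ : Q *m M *m Q = 0.
  have : Q *m (M *m Q + Q *m M) *m Q = Q *m M *m Q by rewrite MQ.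
  rewrite mulmxDr mulmxDl !mulmxA QQ -(mulmxA _ Q Q) QQ => /eqP.
  by rewrite -subr_eq0 addrK => /eqP.
rewrite !commE mulmxBl mulmxBr !mulmxA QMQ -(mulmxA _ Q Q) !QQ subr0 sub0r opprK.
exact: MQ.
Qed.

Lemma adj_comm_skew X A : X^t* = - X -> A^t* = A -> (comm X A)^t* = comm X A.
Proof. by move=> Xs As; rewrite adj_comm Xs As commNr commC opprK. Qed.

Lemma adj_sub_comm X Y D : X^t* = - X -> Y^t* = - Y -> D^t* = - D ->
  (D - comm X Y)^t* = - (D - comm X Y).
Proof.
by move=> Xs Ys Ds; rewrite adjB Ds adj_comm Xs Ys commNr commNl opprK commC opprD.
Qed.

Lemma adj_comm_skew2 X Y : X^t* = - X -> Y^t* = - Y -> (comm X Y)^t* = - comm X Y.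
Proof. by move=> Xs Ys; rewrite adj_comm Xs Ys commNr commNl opprK commC. Qed.
End Algebra.

(** * Unitary frames *)

Section Frames.
Context {C : numClosedFieldType}.

Lemma adj_mul_self n (w : 'cV[C]_n) :
  (w^t* *m w) 0 0 = \sum_i `|w i 0| ^+ 2.
Proof. by rewrite mxE; apply: eq_bigr => i _; rewrite !mxE mulrC normCK. Qed.

Lemma adj_mul_self_eq0 n (w : 'cV[C]_n) : (w^t* *m w) 0 0 = 0 -> w = 0.
Proof.
rewrite adj_mul_self => /eqP; rewrite psumr_eq0 => [/allP w0|i _]; last exact: exprn_ge0.
apply/matrixP => i j; rewrite ord1 mxE; apply/eqP.
by have := w0 i (mem_index_enum _); rewrite sqrf_eq0 normr_eq0.
Qed.

Lemma projector_unit_vector n (Q : 'M[C]_n) : Q *m Q = Q -> Q != 0 ->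
  exists2 e : 'cV[C]_n, e^t* *m e = 1%:M & Q *m e = e.
Proof.
move=> QQ Q0.
have [j wj] : exists j, col j Q != 0.
  apply/existsP; apply: contraNT Q0 => /existsPn H; apply/eqP/matrixP => i j.
  by have /negPn/eqP/matrixP/(_ i 0) := H j; rewrite !mxE.
(* A column of Q lies in its image, so Q fixes it; this nonzero one is normalized below. *)
set w := col j Q in wj.
have Qw : Q *m w = w by rewrite /w colE mulmxA QQ.
set n2 := (w^t* *m w) 0 0.
have n2_gt0 : 0 < n2.
  rewrite lt_def /n2 adj_mul_self sumr_ge0 ?andbT => [|i _]; last exact: exprn_ge0.
  by rewrite -adj_mul_self; apply: contraNneq wj => /adj_mul_self_eq0 ->.
have s_gt0 : 0 < sqrtC n2 by rewrite sqrtC_gt0.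
exists ((sqrtC n2)^-1 *: w); last by rewrite -scalemxAr Qw.
rewrite adjZ -scalemxAl -scalemxAr scalerA.
rewrite (CrealP _); last by rewrite realV realE ltW.
rewrite [w^t* *m w]mx11_scalar -/n2 scale_scalar_mx -invfM -expr2 sqrtCK.
by rewrite mulVf ?gt_eqF.
Qed.

(** Unit vectors e_i in the images of the Q_i are orthonormal because the Q_i annihilate each other,
    and there are n of them, so they form a unitary u; then Q_i u = u E_ii is checked column by
    column. *)
Lemma projectors_frame n (Q : 'I_n -> 'M[C]_n) :
  (forall i, (Q i)^t* = Q i) -> (forall i, Q i *m Q i = Q i) ->
  (forall i j, i != j -> Q i *m Q j = 0) -> (forall i, Q i != 0) ->
  exists2 u : 'M[C]_n, u \is unitarymx &
    forall i, Q i = u *m delta_mx i i *m u^t*.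
Proof.
move=> Qadj Qid Qorth Q0.
have /choice [e /all_and2[e1 eQ]] i : exists e : 'cV[C]_n,
    e^t* *m e = 1%:M /\ Q i *m e = e.
  by have [e] := projector_unit_vector (Qid i) (Q0 i); exists e.
have Qe i j : i != j -> Q i *m e j = 0.
  by move=> ij; rewrite -(eQ j) mulmxA Qorth // mul0mx.
pose u := \matrix_(i, j) e j i 0.
have colu j : col j u = e j by apply/matrixP => i k; rewrite !mxE ord1.
have ue i j : (u^t* *m u) i j = ((e i)^t* *m e j) 0 0.
  by rewrite !mxE; apply: eq_bigr => k _; rewrite !mxE.
have uu : u^t* *m u = 1%:M.
  apply/matrixP => i j; rewrite ue [RHS]mxE; have [<-|ij] := eqVneq i j.
    by rewrite e1 mxE.
  by rewrite -(eQ i) adjM Qadj -mulmxA Qe // mulmx0 mxE.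
have uP : u \is unitarymx by apply/unitarymxP; apply: mulmx1C.
exists u => // i.
suff -> : u *m delta_mx i i = Q i *m u.
  by rewrite -mulmxA (unitarymxP uP) mulmx1.
apply/matrixP => a b.
have -> : (Q i *m u) a b = (Q i *m e b) a 0.
  by rewrite !mxE; apply: eq_bigr => k _; rewrite !mxE.
rewrite mxE (bigD1 i) //= big1 ?addr0 => [|k ki].
  rewrite [u a i]mxE [delta_mx _ _ _ _]mxE eqxx /=.
  have [->|bi] := eqVneq b i; first by rewrite eQ mulr1.
  by rewrite Qe 1?eq_sym // mxE mulr0.
by rewrite [delta_mx _ _ _ _]mxE (negbTE ki) mulr0.
Qed.

(** The line is completed to an orthogonal splitting: T = 1 - Q has rank at least 2, a unit vector
    of its image gives E of rank at most 1, so the rest F = T - E is still nonzero. The index i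
    prescribes the place that Q takes. *)
Lemma rank1_projector_frame (Q : 'M[C]_3) (i : 'I_3) :
  Q^t* = Q -> Q *m Q = Q -> \rank Q = 1%N ->
  exists2 u : 'M[C]_3, u \is unitarymx & Q = u *m delta_mx i i *m u^t*.
Proof.
move=> Qa Qid Qrk.
pose T := 1%:M - Q.
have Ta : T^t* = T by rewrite adjB adj1 Qa.
have QT : Q *m T = 0 by rewrite mulmxBr mulmx1 Qid subrr.
have TQ : T *m Q = 0 by rewrite mulmxBl mul1mx Qid subrr.
have TT : T *m T = T by rewrite {1}/T mulmxBl mul1mx QT subr0.
have rkT : (2 <= \rank T)%N.
  have : (\rank (Q + T)%R <= \rank Q + \rank T)%N by exact: mxrank_add.
  by rewrite addrC subrK mxrank1 Qrk.
have T0 : T != 0 by apply: contraTneq rkT => ->; rewrite mxrank0.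
have [e e1 Te] := projector_unit_vector TT T0.
pose E := e *m e^t*.
have Ea : E^t* = E by rewrite /E adjM trmxCK.
have EE : E *m E = E by rewrite /E -mulmxA (mulmxA (e^t*)) e1 mul1mx.
have TE : T *m E = E by rewrite /E mulmxA Te.
have ET : E *m T = E by rewrite -[LHS]trmxCK adjM Ta Ea TE Ea.
have QE : Q *m E = 0 by rewrite -TE mulmxA QT mul0mx.
have EQ : E *m Q = 0 by rewrite -ET -mulmxA TQ mulmx0.
have E0 : E != 0.
  apply/eqP => E0; have e0 : e = 0 by rewrite -[e]mulmx1 -e1 mulmxA -/E E0 mul0mx.
  move: e1; rewrite e0 mulmx0 => /matrixP/(_ 0 0); rewrite !mxE eqxx => /esym/eqP.
  by rewrite oner_eq0.
have rkE : (\rank E <= 1)%N by apply: leq_trans (mxrankM_maxl _ _) (rank_leq_col _).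
pose F := T - E.
have F0 : F != 0.
  by rewrite subr_eq0; apply: contraTneq rkT => ->; rewrite -ltnNge.
have QF : Q *m F = 0 by rewrite mulmxBr QT QE subrr.
have FQ : F *m Q = 0 by rewrite mulmxBl TQ EQ subrr.
have EF : E *m F = 0 by rewrite mulmxBr ET EE subrr.
have FE : F *m E = 0 by rewrite mulmxBl TE EE subrr.
have FF : F *m F = F by rewrite {1}/F mulmxBl EF subr0 mulmxBr TT TE.
pose f k := if k == i then Q else if k == ordS i then E else F.
have [] := @projectors_frame 3 f.
- by move=> k; rewrite /f; do 2?case: eqP => // _; rewrite adjB Ta Ea.
- by move=> k; rewrite /f; do 2?case: eqP => // _.
- move=> j k; rewrite /f; move: i j k {f}.
  by apply: ord3P; apply: ord3P; apply: ord3P.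
- have Q0 : Q != 0 by apply: contra_eq_neq Qrk => ->; rewrite mxrank0.
  by move=> k; rewrite /f; case: ifP => // _; case: ifP.
by move=> u uu /(_ i); rewrite /f eqxx; exists u.
Qed.

Lemma mxrank_unitary_conj n (u A : 'M[C]_n) : u \is unitarymx ->
  \rank (u *m A *m u^t*) = \rank A.
Proof.
move=> uu; rewrite mxrankMfree; last first.
  by rewrite row_free_unit unitarymx_unit // trmxC_unitary.
rewrite -mxrank_tr trmx_mul mxrankMfree ?mxrank_tr//.
by rewrite row_free_unit unitmx_tr unitarymx_unit.
Qed.

Lemma rank_coord_plane :
  \rank (delta_mx 0 0 + delta_mx 1 1 : 'M[C]_3)%R = 2%N.
Proof.
suff -> : delta_mx 0 0 + delta_mx 1 1 = pid_mx 2 :> 'M[C]_3 by rewrite rank_pid_mx.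
apply/matrixP => -[[|[|[|//]]] Hi] [[|[|[|//]]] Hj]; rewrite !mxE /=;
  by rewrite ?addr0 ?add0r.
Qed.

Lemma entry_unitary_le1 n (u : 'M[C]_n) i j : u \is unitarymx -> `|u i j| <= 1.
Proof.
move=> /unitarymxP/matrixP/(_ i i); rewrite !mxE eqxx => E.
rewrite -(@expr_le1 _ 2) // -[leRHS]E (bigD1 j) //= !mxE -normCK lerDl.
by apply: sumr_ge0 => k _; rewrite !mxE -normCK exprn_ge0.
Qed.

(** A row w with w = w X satisfies w w^* = - w w^* since X is skew-Hermitian, hence w = 0: the
    number 1 is not an eigenvalue of X. *)
Lemma skew_cayley_unit n (X : 'M[C]_n) : X^t* = - X -> 1%:M - X \in unitmx.
Proof.
move=> Xs; rewrite -row_free_unit -kermx_eq0; apply/eqP.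
set K := kermx _; have /eqP : K *m (1%:M - X) == 0 by rewrite mulmx_ker.
rewrite mulmxBr mulmx1 => /subr0_eq KX.
apply/row_matrixP => i; rewrite row0.
set w := row i K; have wX : w = w *m X by rewrite /w -row_mul -KX.
suff : (w^t*)^t* *m w^t* = 0.
  by move=> /matrixP/(_ 0 0); rewrite [RHS]mxE => /adj_mul_self_eq0 H; rewrite -(trmxCK w) H trmx0 map_mx0.
rewrite trmxCK.
have E : w *m w^t* = - (w *m w^t*).
  by rewrite {1}wX -mulmxA -[X]opprK -Xs mulNmx mulmxN -adjM -wX.
have : w *m w^t* + w *m w^t* = 0 by rewrite {1}E addNr.
by rewrite -mulr2n => /eqP; rewrite -scaler_nat scaler_eq0 pnatr_eq0 => /eqP.
Qed.

(** Takes the place of the exponential: rational in X, unitary for skew-Hermitian X, and the curve t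
    |-> cayley (t X / 2) has velocity X at t = 0. *)
Definition cayley n (X : 'M[C]_n) := (1%:M + X) *m invmx (1%:M - X).

Lemma cayley_unitary n (X : 'M[C]_n) : X^t* = - X -> cayley X \is unitarymx.
Proof.
move=> Xs; have uX := skew_cayley_unit Xs.
have uX' : 1%:M + X \in unitmx by rewrite -[X]opprK skew_cayley_unit // adjN Xs.
apply/unitarymxP; rewrite /cayley adjM.
have -> : (invmx (1%:M - X))^t* = invmx (1%:M + X).
  by rewrite trmx_inv map_invmx adjB adj1 Xs opprK.
rewrite adjD adj1 Xs mulmxA.
have cXX : (1%:M + X) *m (1%:M - X) = (1%:M - X) *m (1%:M + X).
  rewrite !(mulmxBr, mulmxDr, mulmxBl, mulmxDl, mulmxN, mulNmx, mulmx1, mul1mx).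
  move: (X *m X) => Y; apply/matrixP => i j; rewrite !mxE; ring.
have -> : (1%:M + X) *m invmx (1%:M - X) = invmx (1%:M - X) *m (1%:M + X).
  apply: (can_inj (mulKmx uX)); apply: (can_inj (mulmxK uX)).
  by rewrite mulKVmx // mulmxA mulmxKV // cXX.
rewrite -(mulmxA (invmx _)) mulmxV // mulmx1 mulVmx //.
Qed.

Lemma cayley_sub1 n (X : 'M[C]_n) : X^t* = - X ->
  cayley X - 1%:M = X + X *m cayley X.
Proof.
move=> Xs; have uX := skew_cayley_unit Xs.
apply: (can_inj (mulmxK uX)).
have cK : cayley X *m (1%:M - X) = 1%:M + X by rewrite /cayley mulmxKV.
rewrite mulmxBl mulmxDl -(mulmxA X) cK mul1mx.
rewrite !(mulmxBr, mulmxDr, mulmx1).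
by move: (X *m X) => Y; apply/matrixP => i j; rewrite !mxE; ring.
Qed.
(** Inserting c = 1 + s X + s X c into itself once exhibits the second-order remainder, whose factor
    c is unitary and hence bounded. *)
Lemma cayley_expand n (X : 'M[C]_n) (s : C) : (s *: X)^t* = - (s *: X) ->
  cayley (s *: X) - 1%:M =
  (s + s) *: (X + (s / 2%:R) *: (X *m X *m (1%:M + cayley (s *: X)))).
Proof.
move=> Xs; have E := cayley_sub1 Xs; set c := cayley _ in E *.
have E' : c = 1%:M + (s *: X + s *: X *m c) by rewrite -E addrC subrK.
rewrite E {1}E' !mulmxDr !mulmx1 -!scalemxAl -!scalemxAr.
rewrite !mulmxA !scalerA; set Y := X *m X; set Z := Y *m c.
apply/matrixP => i j; rewrite !addmxE !scalemxE !addmxE !scalemxE.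
by rewrite !addmxE; field.
Qed.
End Frames.

(** For a != k these skew-Hermitian matrices, supported on the entries (a, k) and (k, a), form one
    of the irreducible isotropy summands. *)
HB.lock Definition root (C : numClosedFieldType) (a k : 'I_3) (z : C) : 'M[C]_3 :=
  z *: delta_mx a k - z^* *: delta_mx k a.

Section Roots.
Context {C : numClosedFieldType}.
Implicit Types (z w : C) (A M : 'M[C]_3).

Lemma rootU a k z : root a k z = z *: delta_mx a k - z^* *: delta_mx k a.
Proof. by rewrite root.unlock. Qed.

Lemma root_adj a k z : (root a k z)^t* = - root a k z.
Proof. by rewrite !rootU adjB !adjZ !adj_delta conjCK opprB. Qed.

Lemma rootE a k z i j :
  root a k z i j = z * ((i == a) && (j == k))%:R - z^* * ((i == k) && (j == a))%:R.
Proof. by rewrite !rootU addmxE oppmxE !scalemxE !mxE. Qed.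

Lemma rootD a k z w : root a k (z + w) = root a k z + root a k w.
Proof. by rewrite !rootU rmorphD /= !scalerDl opprD addrACA. Qed.

Lemma skew_entry (A : 'M[C]_3) i j : A^t* = - A -> A j i = - (A i j)^*.
Proof. by move=> As; rewrite -[A j i]opprK -oppmxE -As !mxE. Qed.

Lemma skew_roots A i j : A^t* = - A -> i != j ->
  (root 0 1 (A 0 1) + root 0 2%:R (A 0 2%:R) + root 1 2%:R (A 1 2%:R)) i j = A i j.
Proof.
move=> As; rewrite !addmxE !rootE.
move: i j; apply: ord3P; apply: ord3P => //= _;
  rewrite ?(mulr1, mulr0, subr0, addr0, add0r, sub0r, oppr0) //;
  by rewrite ?(skew_entry 0 1 As) ?(skew_entry 0 2%:R As) ?(skew_entry 1 2%:R As).
Qed.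

Definition diagf (d : 'I_3 -> C) : 'M[C]_3 := diag_mx (\row_i d i).

Lemma diagf_conj d A i j : (diagf d *m A *m (diagf d)^t*) i j = d i * A i j * (d j)^*.
Proof.
rewrite mxE (bigD1 j) //= big1 ?addr0 => [|k kj].
  by rewrite /diagf mul_diag_mx !mxE eqxx mulr1n.
by rewrite /diagf !mxE [j == k]eq_sym (negbTE kj) mulr0n rmorph0 mulr0.
Qed.

Lemma diagf_unitary d : (forall i, d i * (d i)^* = 1) -> diagf d \is unitarymx.
Proof.
move=> d1; apply/unitarymxP; rewrite -[diagf d]mulmx1; apply/matrixP => i j.
rewrite mulmx1 -{1}[diagf d]mulmx1 diagf_conj !mxE.
by case: eqP => [->|_]; rewrite ?mulr1 ?mulr0 ?mul0r.
Qed.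

Lemma diagf_base d k : (forall i, d i * (d i)^* = 1) ->
  diagf d *m delta_mx k k *m (diagf d)^t* = delta_mx k k.
Proof.
move=> d1; apply/matrixP => i j; rewrite diagf_conj !mxE.
by case: eqP => [->|_]; case: eqP => [->|_]; rewrite /= ?mulr0 ?mul0r ?mulr1.
Qed.

Lemma diagf_root d a k z :
  diagf d *m root a k z *m (diagf d)^t* = root a k (d a * z * (d k)^*).
Proof.
apply/matrixP => i j; rewrite diagf_conj !rootE !rmorphM /= conjCK.
have [->|ia] := eqVneq i a; have [->|jk] := eqVneq j k; rewrite /= ?mulr1 ?mulr0 ?sub0r ?subr0 ?andbT ?andbF //=.
- case: eqP => [ak|] /=; last by rewrite !mulr0 !subr0.
  by rewrite ak eqxx /= !mulr1; ring.
- case: eqP => [ak|] /=; last by rewrite !mulr0 oppr0 mulr0 mul0r.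
  case: eqP => [ja|] /=; last by rewrite !mulr0 oppr0 mulr0 mul0r.
  by rewrite ja ak !mulr1; ring.
- case: eqP => [ik|] /=; last by rewrite !mulr0 oppr0 mulr0 mul0r.
  case: eqP => [ja|] /=; last by rewrite !mulr0 oppr0 mulr0 mul0r.
  by rewrite ik ja !mulr1; ring.
- case: eqP => [ik|] /=; last by rewrite !mulr0 oppr0 mulr0 mul0r.
  case: eqP => [ja|] /=; last by rewrite !mulr0 oppr0 mulr0 mul0r.
  by rewrite ik ja !mulr1; ring.
Qed.
End Roots.

(** * Flags as triples of orthogonal projectors *)

(* The linear part of the affine map [flag_line i]; the [pr i x] are three
   orthogonal projectors of rank 1 summing to 1, and the [dpr i v] sum to 0. *)
Definition dline (R : realType) (i : 'I_3) (v : @flag_space R) : @cmx R :=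
  match val i with 0 => v.1 | 1 => v.2 - v.1 | _ => - v.2 end.

HB.lock Definition pr (R : realType) (i : 'I_3) (x : @flag_space R) :
    'M[complex R]_3 := to_mx (flag_line i x).

HB.lock Definition dpr (R : realType) (i : 'I_3) (v : @flag_space R) :
    'M[complex R]_3 := to_mx (dline i v).

Section ComplexMatrices.
Context {R : realType}.
Local Notation C := (complex R).
Local Notation cmx := (@cmx R).
Local Notation flag_space := (@flag_space R).

Lemma to_mxK : cancel (@to_mx R) (@of_mx R).
Proof. by move=> [A B]; congr pair; apply/matrixP => i j; rewrite !mxE. Qed.

Lemma of_mxK : cancel (@of_mx R) (@to_mx R).
Proof. by move=> A; apply/matrixP => i j; rewrite !mxE; case: (A i j). Qed.

Lemma to_mxD (A B : cmx) : to_mx (A + B) = to_mx A + to_mx B.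
Proof. by apply/matrixP => i j; rewrite !mxE. Qed.

Lemma to_mxN (A : cmx) : to_mx (- A) = - to_mx A.
Proof. by apply/matrixP => i j; rewrite !mxE. Qed.

Lemma to_mxB (A B : cmx) : to_mx (A - B) = to_mx A - to_mx B.
Proof. by rewrite to_mxD to_mxN. Qed.

Lemma to_mx0 : to_mx (0 : cmx) = 0.
Proof. by apply/matrixP => i j; rewrite !mxE. Qed.

Lemma to_mxZ (a : R) (A : cmx) : to_mx (a *: A) = a%:C%C *: to_mx A.
Proof.
by apply/matrixP => i j; rewrite !mxE; apply/eqP; rewrite eq_complex /= !mul0r subr0 addr0 !eqxx.
Qed.

Lemma to_mx_inj : injective (@to_mx R).
Proof. exact: can_inj to_mxK. Qed.

Definition cmul (A B : cmx) : cmx := of_mx (to_mx A *m to_mx B).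
Definition cadj (A : cmx) : cmx := of_mx ((to_mx A)^t*).
Definition cscale (z : C) (A : cmx) : cmx := of_mx (z *: to_mx A).

Lemma bilin_cmul : bilin cmul.
Proof.
split=> [B a A A'|A a B B']; apply: to_mx_inj;
  rewrite to_mxD to_mxZ !of_mxK to_mxD to_mxZ.
  by rewrite mulmxDl scalemxAl.
by rewrite mulmxDr scalemxAr.
Qed.

Lemma linear_cadj : linear cadj.
Proof.
move=> a A B; apply: to_mx_inj.
rewrite to_mxD to_mxZ !of_mxK to_mxD to_mxZ adjD adjZ; congr (_ *: _ + _).
by apply/eqP; rewrite eq_complex /= oppr0 !eqxx.
Qed.

Lemma linear_cscale z : linear (cscale z).
Proof.
move=> a A B; apply: to_mx_inj.
by rewrite to_mxD to_mxZ !of_mxK to_mxD to_mxZ scalerDr !scalerA mulrC.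
Qed.

Lemma findim_cmx : findim cmx.
Proof. exact: findim_prod (findim_mx _ _) (findim_mx _ _). Qed.

Lemma findim_flag_space : findim flag_space.
Proof. exact: findim_prod findim_cmx findim_cmx. Qed.

Lemma prU i (x : flag_space) : pr i x = to_mx (flag_line i x).
Proof. by rewrite pr.unlock. Qed.

Lemma dprU i (v : flag_space) : dpr i v = to_mx (dline i v).
Proof. by rewrite dpr.unlock. Qed.

Lemma linear_dline i : linear (@dline R i).
Proof.
move=> a v w; rewrite /dline.
by case: i => -[|[|[|//]]] Hi //=; rewrite ?scalerBr ?scalerN ?opprD //; rewrite addrACA.
Qed.

Lemma flag_lineE i (x : flag_space) : flag_line i x = flag_line i 0 + dline i x.
Proof.
rewrite /flag_line /dline.
by case: i => -[|[|[|//]]] Hi //=; rewrite ?subr0 ?add0r.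
Qed.

Lemma smooth_flag_line i : smooth (@flag_line R i).
Proof.
rewrite (_ : flag_line i = fun x => flag_line i 0 + dline i x).
  apply: smoothD; first exact: smooth_cst.
  exact: smooth_lin findim_flag_space (linear_dline i).
by apply/funext => x; rewrite flag_lineE.
Qed.

Lemma derive_flag_line i x v : 'D_v (@flag_line R i) x = dline i v.
Proof.
rewrite (_ : flag_line i = (fun=> flag_line i 0) + dline i).
  rewrite deriveD; last 2 first.
  - exact: derivable_cst.
  - exact/smooth_derivable/smooth_lin/linear_dline/findim_flag_space.
  by rewrite derive_cst add0r derive_lin //; [exact: findim_flag_space|exact: linear_dline].
by apply/funext => y; rewrite flag_lineE.
Qed.

Lemma flag_space_eq (v w : flag_space) : (forall i, dpr i v = dpr i w) -> v = w.
Proof.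
case: v w => [v1 v2] [w1 w2] E.
have := E 0; rewrite !dprU => /to_mx_inj E0; rewrite /dline /= in E0.
have := E 2%:R; rewrite !dprU => /to_mx_inj/oppr_inj E2; rewrite /= in E2.
by rewrite E0 E2.
Qed.

Lemma flag_line_inj (x y : flag_space) : (forall i, flag_line i x = flag_line i y) -> x = y.
Proof.
move=> E; apply: flag_space_eq => i; rewrite !dprU; apply: (congr1 (@to_mx R)).
by have := E i; rewrite (flag_lineE _ x) (flag_lineE _ y) => /addrI.
Qed.

Lemma sum_pr (x : flag_space) : \sum_i pr i x = 1%:M.
Proof.
rewrite !big_ord_recr big_ord0 /= add0r !prU /flag_line /= !to_mxB of_mxK.
by rewrite (addrC (to_mx x.1)) subrK addrC subrK.
Qed.

Lemma sum_dpr (x : flag_space) : \sum_i dpr i x = 0.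
Proof.
rewrite !big_ord_recr big_ord0 /= add0r !dprU /dline /= !to_mxB to_mxN.
by rewrite (addrC (to_mx x.1)) subrK subrr.
Qed.

Lemma dprD i (v w : flag_space) : dpr i (v + w) = dpr i v + dpr i w.
Proof. by rewrite !dprU -to_mxD -[v]scale1r linear_dline !scale1r. Qed.

Lemma dprZ i a (v : flag_space) : dpr i (a *: v) = a%:C%C *: dpr i v.
Proof.
rewrite !dprU -to_mxZ -[a *: v]addr0 linear_dline.
by rewrite (_ : dline i 0 = 0) ?addr0// /dline; case: i => -[|[|[|//]]] Hi /=; rewrite ?subr0 ?oppr0.
Qed.

Lemma dprN i (v : flag_space) : dpr i (- v) = - dpr i v.
Proof. by rewrite -scaleN1r dprZ rmorphN1 scaleN1r. Qed.

Lemma dprB i (v w : flag_space) : dpr i (v - w) = dpr i v - dpr i w.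
Proof. by rewrite dprD dprN. Qed.

End ComplexMatrices.

(* The velocity at [x] of the action of [exp (tau X)]. *)
HB.lock Definition fund (R : realType) (X : 'M[complex R]_3) (x : @flag_space R) :
    @flag_space R :=
  (of_mx (comm X (to_mx x.1)), of_mx (comm X (to_mx x.2))).

Section FundamentalFields.
Context {R : realType}.
Local Notation flag_space := (@flag_space R).

Lemma to_mx_fund X (x : flag_space) :
  (to_mx (fund X x).1 = comm X (to_mx x.1)) * (to_mx (fund X x).2 = comm X (to_mx x.2)).
Proof. by rewrite fund.unlock; split; rewrite of_mxK. Qed.

Lemma dprE i (v : flag_space) : dpr i v =
  match val i with
  | 0 => to_mx v.1
  | 1 => to_mx v.2 - to_mx v.1
  | _ => - to_mx v.2
  end.
Proof.
by rewrite !dprU /dline; case: (val i) => [|[|n]] /=; rewrite ?to_mxB ?to_mxN.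
Qed.

Lemma prE i (x : flag_space) : pr i x =
  match val i with
  | 0 => to_mx x.1
  | 1 => to_mx x.2 - to_mx x.1
  | _ => 1%:M - to_mx x.2
  end.
Proof.
by rewrite prU /flag_line; case: (val i) => [|[|n]] /=; rewrite ?to_mxB ?of_mxK.
Qed.

Lemma dpr_fund i X (x : flag_space) : dpr i (fund X x) = comm X (pr i x).
Proof.
have [E1 E2] := to_mx_fund X x; rewrite dprE prE E1 E2 {E1 E2}.
by case: (val i) => [|[|n]]; rewrite ?commBr ?comm1r ?sub0r.
Qed.

Lemma dpr_fundl i X (v : flag_space) : dpr i (fund X v) = comm X (dpr i v).
Proof.
have [E1 E2] := to_mx_fund X v; rewrite (dprE i v) (dprE i (fund X v)) E1 E2 {E1 E2}.
by case: (val i) => [|[|n]]; rewrite ?commBr ?commNr.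
Qed.

End FundamentalFields.

Section FlagGeometry.
Context {R : realType}.
Local Notation C := (complex R).
Local Notation flag_space := (@flag_space R).
Local Notation flags := (@flags R).
Implicit Types (x v w : flag_space) (u X : 'M[C]_3).

Lemma pr0E x : pr 0 x = to_mx x.1. Proof. exact: prE. Qed.
Lemma pr1E x : pr 1 x = to_mx x.2 - to_mx x.1. Proof. exact: prE. Qed.
Lemma pr2E x : pr 2%:R x = 1%:M - to_mx x.2. Proof. exact: prE. Qed.

(** The projectors l, p - l and 1 - p are mutually orthogonal, and they are nonzero because l, p and
    1 have the distinct ranks 1, 2 and 3. *)
Lemma flags_frame x : flags x ->
  exists2 u, u \is unitarymx & forall i, pr i x = u *m delta_mx i i *m u^t*.
Proof.
case; move: (to_mx x.1) (to_mx x.2) (pr0E x) (pr1E x) (pr2E x).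
move=> l p E0 E1 E2 [ladj lid lrk] [padj pid prk] pl.
(* This is the adjoint of p l = l. *)
have lp : l *m p = l by rewrite -ladj -{1}padj -adjM pl.
apply: projectors_frame.
- by apply: ord3P; rewrite ?E0 ?E1 ?E2 // adjB ?adj1 ?ladj ?padj.
- apply: ord3P; rewrite ?E0 ?E1 ?E2 //.
    by rewrite mulmxBl !mulmxBr pid lid pl lp subrr subr0 //.
  by rewrite mulmxBl !mulmxBr pid !mulmx1 mul1mx subrr subr0.
- apply: ord3P; apply: ord3P; rewrite ?eqxx // => _; rewrite ?E0 ?E1 ?E2
    ?(mulmxBl, mulmxBr, mulmx1, mul1mx) ?pl ?lp ?pid ?lid ?pl ?subrr //.
- apply: ord3P; rewrite ?E0 ?E1 ?E2.
  + by apply: contra_eq_neq lrk => ->; rewrite mxrank0.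
  + by rewrite subr_eq0; apply: contra_eq_neq prk => ->; rewrite lrk.
  + by rewrite subr_eq0; apply: contra_eq_neq prk => <-; rewrite mxrank1.
Qed.

Lemma to_mx_act u x :
  (to_mx (act u x).1 = u *m to_mx x.1 *m u^t*) *
  (to_mx (act u x).2 = u *m to_mx x.2 *m u^t*).
Proof. by split; rewrite of_mxK. Qed.

Lemma pr_act u x i : u \is unitarymx -> pr i (act u x) = u *m pr i x *m u^t*.
Proof.
move=> uu; rewrite !prE; case: (to_mx_act u x) => E1 E2.
case: (val i) => [|[|n]]; first exact: E1.
  by rewrite mulmxBr mulmxBl; congr (_ - _); [exact: E2|exact: E1].
rewrite mulmxBr mulmxBl mulmx1 (unitarymxP uu); congr (_ - _); exact: E2.
Qed.

Lemma dpr_act u v i : dpr i (act u v) = u *m dpr i v *m u^t*.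
Proof.
rewrite !dprE; case: (to_mx_act u v) => E1 E2.
case: (val i) => [|[|n]]; first exact: E1.
  by rewrite mulmxBr mulmxBl; congr (_ - _); [exact: E2|exact: E1].
by rewrite mulmxN mulNmx; congr (- _); exact: E2.
Qed.

Lemma pr_base i : pr i (@base_flag R) = delta_mx i i.
Proof.
move: i; apply: ord3P; rewrite ?pr0E ?pr1E ?pr2E /base_flag /= !of_mxK //.
  by rewrite addrC addKr.
apply/matrixP => -[[|[|[|//]]] Hi] [[|[|[|//]]] Hj]; rewrite !mxE /=;
  by rewrite ?addr0 ?add0r ?subrr ?subr0 ?oppr0.
Qed.

Lemma pr_inj x y : (forall i, pr i x = pr i y) -> x = y.
Proof. by move=> E; apply: flag_line_inj => i; apply: to_mx_inj; rewrite -!prU. Qed.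

Lemma orth_projector_conj u A k : u \is unitarymx ->
  orth_projector k A -> orth_projector k (u *m A *m u^t*).
Proof.
move=> uu [Aadj Aid <-]; split; last exact: mxrank_unitary_conj.
  by rewrite cj_adj Aadj.
by rewrite (cjM _ _ uu) Aid.
Qed.

Lemma orth_projector_line i : orth_projector 1 (delta_mx i i : 'M[C]_3).
Proof. by split; rewrite ?adj_delta ?mul_delta_mx ?mxrank_delta. Qed.

Lemma flags_of_frame u (y : flag_space) : u \is unitarymx ->
  to_mx y.1 = u *m delta_mx 0 0 *m u^t* ->
  to_mx y.2 = u *m (delta_mx 0 0 + delta_mx 1 1) *m u^t* -> flags y.
Proof.
move=> uu E1 E2.
have dd (i j : 'I_3) : i != j -> delta_mx i i *m delta_mx j j = 0 :> 'M[C]_3.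
  by move=> ij; rewrite mul_delta_mx_0.
have d01 := dd 0 1 isT; have d10 := dd 1 0 isT.
split; first by rewrite E1; apply/orth_projector_conj/orth_projector_line.
  rewrite E2; apply: (orth_projector_conj uu); split.
  - by rewrite adjD !adj_delta.
  - by rewrite mulmxDl !mulmxDr d01 d10 !mul_delta_mx addr0 add0r.
  - exact: rank_coord_plane.
rewrite E2 E1; apply: (cj_projector_mul uu).
by rewrite mulmxDl d10 addr0 mul_delta_mx.
Qed.

Lemma flags_act_base u : u \is unitarymx -> flags (act u base_flag).
Proof.
by move=> uu; have [E1 E2] := to_mx_act u base_flag;
  apply: (flags_of_frame uu); [rewrite E1|rewrite E2]; rewrite of_mxK.
Qed.

Lemma flagsP x : flags x <-> exists2 u, u \is unitarymx & act u base_flag = x.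
Proof.
split=> [/flags_frame [u uu E]|[u uu <-]]; last exact: flags_act_base.
by exists u; [exact: uu|apply: pr_inj => i; rewrite (pr_act _ _ uu) pr_base E].
Qed.

Lemma frameP x : flags x -> frame x \is unitarymx /\ act (frame x) base_flag = x.
Proof.
move=> /flagsP [u uu E]; rewrite /frame; case: xgetP => [w _ []//|/(_ u)[]].
by split.
Qed.

Lemma frame_unitary x : flags x -> frame x \is unitarymx.
Proof. by case/frameP. Qed.

Lemma pr_frame x i : flags x -> pr i x = frame x *m delta_mx i i *m (frame x)^t*.
Proof.
move=> /frameP [fu E]; have := pr_act base_flag i fu.
by rewrite E pr_base.
Qed.

Lemma actM u1 u2 x : act u1 (act u2 x) = act (u1 *m u2) x.
Proof.
apply: (@flag_space_eq R) => i; rewrite !dpr_act; exact: cj_cj.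
Qed.

Lemma act1 x : act 1%:M x = x.
Proof. by apply: (@flag_space_eq R) => i; rewrite dpr_act cj1. Qed.

Lemma flags_act u x : u \is unitarymx -> flags x -> flags (act u x).
Proof.
move=> uu /flagsP [w wu <-]; rewrite actM; apply: flags_act_base.
exact (mul_unitarymx uu wu).
Qed.

Lemma pr_adj x i : flags x -> (pr i x)^t* = pr i x.
Proof. by move=> Fx; rewrite (pr_frame i Fx) cj_proj_adj. Qed.

Lemma pr_mul x i j : flags x -> pr i x *m pr j x = (i == j)%:R *: pr i x.
Proof.
by move=> Fx; rewrite (pr_frame i Fx) (pr_frame j Fx) cj_proj_mul // frame_unitary.
Qed.

Lemma linear_act u : linear (@act R u).
Proof.
move=> a x y; apply: (@flag_space_eq R) => i.
rewrite (dpr_act u) !dprD !dprZ.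
by rewrite (dpr_act u x i) (dpr_act u y i) cj_is_linear.
Qed.

Lemma act_fund u X x : u \is unitarymx ->
  act u (fund X x) = fund (u *m X *m u^t*) (act u x).
Proof.
move=> uu; apply: (@flag_space_eq R) => i.
by rewrite dpr_act !dpr_fund (pr_act _ _ uu) cj_comm.
Qed.

Lemma base_tangentE X : base_tangent X = fund X base_flag.
Proof. by rewrite fund.unlock !commE. Qed.

Lemma fundD X Y x : fund (X + Y) x = fund X x + fund Y x.
Proof. by apply: (@flag_space_eq R) => i; rewrite dprD !dpr_fund commDl. Qed.

Lemma fundN X x : fund (- X) x = - fund X x.
Proof. by apply: (@flag_space_eq R) => i; rewrite dprN !dpr_fund commNl. Qed.

Lemma fundB X Y x : fund (X - Y) x = fund X x - fund Y x.
Proof. by rewrite fundD fundN. Qed.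

Lemma fundZ a X x : fund (a%:C%C *: X) x = a *: fund X x.
Proof.
apply: (@flag_space_eq R) => i; rewrite dprZ !dpr_fund.
exact: commZl.
Qed.

End FlagGeometry.

(* Inverts [fund] on tangent vectors: differentiating [P_i P_j = delta_ij P_i]
   gives [V_i = [\sum_k V_k P_k, P_i]]. *)
HB.lock Definition hat (R : realType) (x v : @flag_space R) : 'M[complex R]_3 :=
  \sum_i dpr i v *m pr i x.

Section FlagTangent.
Context {R : realType}.
Local Notation C := (complex R).
Local Notation cmx := (@cmx R).
Local Notation flag_space := (@flag_space R).
Local Notation flags := (@flags R).
Implicit Types (x v w : flag_space) (u X : 'M[C]_3).

Lemma hatE x v : hat x v = \sum_i dpr i v *m pr i x.
Proof. by rewrite hat.unlock. Qed.

Lemma to_mx_cmul (A B : cmx) : to_mx (cmul A B) = to_mx A *m to_mx B.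
Proof. exact: of_mxK. Qed.

Lemma to_mx_cadj (A : cmx) : to_mx (cadj A) = (to_mx A)^t*.
Proof. exact: of_mxK. Qed.

Lemma smooth_cmul (T : normedModType R) (f g : T -> cmx) :
  smooth f -> smooth g -> smooth (fun y => cmul (f y) (g y)).
Proof. exact (smooth_bilin findim_cmx findim_cmx bilin_cmul (T := T) (f := f) (g := g)). Qed.

Lemma derive_cmul (T : normedModType R) (f g : T -> cmx) (x v : T) :
  differentiable f x -> differentiable g x ->
  'D_v (fun y => cmul (f y) (g y)) x = cmul ('D_v f x) (g x) + cmul (f x) ('D_v g x).
Proof. exact: (derive_bilin findim_cmx findim_cmx bilin_cmul). Qed.

Lemma smooth_cadj (T : normedModType R) (f : T -> cmx) :
  smooth f -> smooth (fun y => cadj (f y)).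
Proof. exact (smooth_comp_lin findim_cmx linear_cadj). Qed.

Lemma derive_cadj (T : normedModType R) (f : T -> cmx) (x v : T) :
  differentiable f x -> 'D_v (fun y => cadj (f y)) x = cadj ('D_v f x).
Proof. exact (derive_comp_lin v findim_cmx linear_cadj). Qed.

(** P_i P_j = delta_ij P_i holds on the flags only, but both sides are smooth on the ambient space,
    so it can be differentiated in a tangent direction. *)
Lemma tangent_dpr_rel x v i j : tangent flags x v ->
  dpr i v *m pr j x + pr i x *m dpr j v = (i == j)%:R *: dpr i v.
Proof.
move=> tv; have sl k : smooth (@flag_line R k) := @smooth_flag_line R k.
have dl k : differentiable (@flag_line R k) x := smooth_differentiable x (sl k).
have key : 'D_v (fun y => cmul (flag_line i y) (flag_line j y)) x =
           'D_v (fun y => (i == j)%:R *: flag_line i y) x.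
  apply: derive_eq_on tv.
  - exact/smooth_differentiable/smooth_cmul.
  - exact: differentiableZ.
  - move=> y Fy; apply: to_mx_inj; rewrite to_mx_cmul to_mxZ -!prU (pr_mul _ _ Fy).
    by rewrite rmorph_nat.
move: key; rewrite derive_cmul // deriveZ; last exact: diff_derivable.
rewrite !derive_flag_line => /(congr1 (@to_mx R)).
by rewrite to_mxD !to_mx_cmul to_mxZ rmorph_nat -!prU -!dprU.
Qed.

Lemma tangent_dpr_adj x v i : tangent flags x v -> (dpr i v)^t* = dpr i v.
Proof.
move=> tv; have sl : smooth (@flag_line R i) := @smooth_flag_line R i.
have dl : differentiable (@flag_line R i) x := smooth_differentiable x sl.
have key : 'D_v (fun y => cadj (flag_line i y)) x = 'D_v (flag_line i) x.
  apply: derive_eq_on tv => //.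
  - exact/smooth_differentiable/smooth_cadj.
  - by move=> y Fy; apply: to_mx_inj; rewrite to_mx_cadj -prU; exact: pr_adj.
move: key; rewrite derive_cadj // !derive_flag_line => /(congr1 (@to_mx R)).
by rewrite to_mx_cadj -dprU.
Qed.

Lemma fund_hat x v : tangent flags x v -> fund (hat x v) x = v.
Proof.
move=> tv; apply: (@flag_space_eq R) => i; rewrite dpr_fund hatE.
apply: comm_hatm (fun i j => pr_mul i j (tangent_mem tv)) (sum_pr x)  _ i.
by move=> j k; apply: tangent_dpr_rel.
Qed.

Lemma hat_adj x v : tangent flags x v -> (hat x v)^t* = - hat x v.
Proof.
move=> tv; rewrite hatE; apply: adj_hatm.
- exact: sum_dpr.
- by move=> i j; apply: tangent_dpr_rel.
- by move=> i; apply: pr_adj; apply: tangent_mem tv.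
- by move=> i; apply: tangent_dpr_adj tv.
Qed.

Lemma unitary_norm_le1 u : u \is unitarymx -> `|of_mx u : cmx| <= 1.
Proof.
move=> uu.
have ule i j : Num.sqrt (complex.Re (u i j) ^+ 2 + complex.Im (u i j) ^+ 2) <= 1.
  by have := entry_unitary_le1 i j uu; rewrite normc_def lecR.
rewrite prod_normE /= ge_max; apply/andP; split;
  rewrite [leLHS]/Num.Def.normr/= mx_normrE bigmax_le // => -[i j] _ /=;
  rewrite mxE; apply: le_trans (ule i j);
  rewrite -sqrtr_sqr ler_sqrt ?addr_ge0 ?sqr_ge0 //.
- by rewrite lerDl sqr_ge0.
- by rewrite lerDr sqr_ge0.
Qed.

(** [cayley_expand] with s = t / 2 writes the difference quotient as X + (t / 4) X^2 (1 + c); the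
    remainder tends to 0 because unitary matrices have norm at most 1 in [cmx]. The factor 1/2 in
    the parameter makes the velocity X instead of 2 X. *)
Lemma derive_cayley X : X^t* = - X ->
  is_derive (0 : R) (1 : R) (fun t => of_mx (cayley ((t / 2)%:C%C *: X)) : cmx) (of_mx X).
Proof.
move=> Xs; pose U (t : R) : cmx := of_mx (cayley ((t / 2)%:C%C *: X)).
rewrite -/U.
have sXs (t : R) : ((t / 2)%:C%C *: X)^t* = - ((t / 2)%:C%C *: X).
  rewrite adjZ Xs scalerN; congr (- (_ *: _)).
  by apply/eqP; rewrite eq_complex /= oppr0 !eqxx.
pose L (W : cmx) := cmul (of_mx (X *m X)) W.
have [lL1 lL2] := bilin_cmul (R := R).
pose Ll : {linear cmx -> cmx} :=
  HB.pack L (GRing.isLinear.Build _ _ _ _ L (lL2 (of_mx (X *m X)))).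
have [k k0 Lk] : exists2 k, 0 < k & forall W, `|L W| <= k * `|W|.
  apply: (@linear_lipschitz _ _ _ Ll).
  exact: findim_linear_continuous findim_cmx (lL2 _).
have U0 : U 0 = of_mx 1%:M.
  by rewrite /U mul0r scale0r /cayley addr0 subr0 mul1mx invmx1.
have UE t : U t - U 0 = t *: (of_mx X + (t / 4) *: L (of_mx 1%:M + U t)).
  apply: to_mx_inj; rewrite U0 to_mxB to_mxZ to_mxD to_mxZ to_mx_cmul to_mxD !of_mxK.
  rewrite (cayley_expand (sXs t)); congr (_ *: (_ + _ *: _)).
    by rewrite -rmorphD -splitr.
  have two : 2%:R = (2%:R : R)%:C%C :> C by rewrite rmorph_nat.
  by rewrite two -fmorphV -rmorphM; congr (_%:C)%C; field.
have bU t : `|of_mx 1%:M + U t| <= 2.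
  rewrite (le_trans (ler_normD _ _)) // -[leRHS]/(1 + 1) lerD //.
    by apply: unitary_norm_le1; apply/unitarymxP; rewrite adj1 mulmx1.
  by apply: unitary_norm_le1; apply: cayley_unitary; apply: sXs.
have cvgU : h^-1 *: (U (h *: 1 + 0) - U 0) @[h --> 0^'] --> (of_mx X : cmx).
  apply/cvgrPdist_le => /= e e0; near=> h.
  have h0 : h != 0 by near: h; exact: nbhs_dnbhs_neq.
  rewrite addr0 [h *: 1]mulr1 UE scalerA mulVf // scale1r opprD addrA subrr add0r normrN.
  rewrite normrZ (le_trans (ler_wpM2l _ (Lk _))) // (le_trans (ler_wpM2l _ (ler_wpM2l (ltW k0) (bU h)))) //.
  have : `|h| <= e / k by near: h; apply: dnbhs0_le; rewrite divr_gt0.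
  rewrite ler_pdivlMr // => hk; apply: le_trans hk.
  rewrite normrM (ger0_norm (_ : 0 <= 4^-1)) //.
  rewrite -[leLHS]mulrA ler_wpM2l // mulrCA ger_pMr // ler_pdivrMl // mulr1 ler_nat //.
have dU : derivable U 0 1 by apply/cvg_ex; exists (of_mx X).
by apply: (@DeriveDef _ _ _ _ _ _ _ dU); apply/cvg_lim.
Unshelve. all: by end_near.
Qed.

Lemma differentiable_cmul (T : normedModType R) (f g : T -> cmx) (y : T) :
  differentiable f y -> differentiable g y ->
  differentiable (fun y => cmul (f y) (g y)) y.
Proof. exact: (differentiable_bilin_comp findim_cmx findim_cmx bilin_cmul). Qed.

Lemma differentiable_cadj (T : normedModType R) (f : T -> cmx) (y : T) :
  differentiable f y -> differentiable (fun y => cadj (f y)) y.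
Proof.
move=> df; apply: (@differentiable_comp _ _ _ _ f cadj) => //.
exact/smooth_differentiable/smooth_lin/linear_cadj/findim_cmx.
Qed.

Lemma derive_pair (T V W : normedModType R) (f : T -> V) (g : T -> W) (y v : T) :
  differentiable f y -> differentiable g y ->
  'D_v (fun y => (f y, g y)) y = ('D_v f y, 'D_v g y).
Proof.
by move=> df diagf; rewrite deriveE ?diff_pair -?deriveE//; exact: differentiable_pair.
Qed.

Lemma derive_conj (U : R -> cmx) (A : cmx) X : X^t* = - X ->
  U 0 = of_mx 1%:M -> is_derive (0 : R) (1 : R) U (of_mx X) ->
  differentiable (fun t => cmul (cmul (U t) A) (cadj (U t))) 0 /\
  'D_1 (fun t => cmul (cmul (U t) A) (cadj (U t))) 0 = of_mx (comm X (to_mx A)).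
Proof.
move=> Xs U0 dU; set f := fun t => _.
have dU' : differentiable U 0 by apply/derivable1_diffP.
have dA : differentiable (fun t => cmul (U t) A) 0.
  by apply: (@differentiable_cmul _ U (fun=> A)) => //; apply: differentiable_cst.
have df : differentiable f 0.
  by apply: differentiable_cmul => //; apply: differentiable_cadj.
split; first exact: df.
rewrite derive_cmul //; last exact: differentiable_cadj.
rewrite derive_cadj // (derive_cmul (1 : R) dU' (differentiable_cst A _)).
rewrite derive_cst (@derive_val _ _ _ _ _ _ _ dU) U0; apply: to_mx_inj.
rewrite to_mxD !to_mx_cmul to_mxD !to_mx_cmul !to_mx_cadj !of_mxK to_mx0.
by rewrite mulmx0 addr0 adj1 mulmx1 Xs mul1mx mulmxN commE.
Qed.

(** The orbit of x under the unitary matrices cayley (t X / 2) stays in the flags and has this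
    velocity. With [fund_hat] and [hat_adj] it identifies the tangent space at x with the vectors
    [fund X x], X skew-Hermitian. *)
Lemma fund_tangent x X : flags x -> X^t* = - X -> tangent flags x (fund X x).
Proof.
move=> Fx Xs.
pose U (t : R) : cmx := of_mx (cayley ((t / 2)%:C%C *: X)).
have Uu t : to_mx (U t) \is unitarymx.
  rewrite of_mxK; apply: cayley_unitary; rewrite adjZ Xs scalerN.
  by congr (- (_ *: _)); apply/eqP; rewrite eq_complex /= oppr0 !eqxx.
have U0 : U 0 = of_mx 1%:M.
  by rewrite /U mul0r scale0r /cayley addr0 subr0 mul1mx invmx1.
have dU := derive_cayley Xs.
have [d1 D1] := derive_conj x.1 Xs U0 dU.
have [d2 D2] := derive_conj x.2 Xs U0 dU.
pose c t : flag_space := (cmul (cmul (U t) x.1) (cadj (U t)),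
                          cmul (cmul (U t) x.2) (cadj (U t))).
have cE t : c t = act (to_mx (U t)) x.
  rewrite /c /act /cmul /cadj !of_mxK.
  by [].
exists c; split.
- by rewrite cE U0 of_mxK act1.
- by near=> t; rewrite cE; apply: flags_act.
- exact: (diff_derivable (differentiable_pair d1 d2)).
- by have E := derive_pair (1 : R) d1 d2; rewrite D1 D2 in E; rewrite fund.unlock.
Unshelve. all: by end_near.
Qed.

End FlagTangent.

(** * Derivatives of functions with values in complex matrices *)

HB.lock Definition mx_derive (R : realType) (F : @flag_space R -> 'M[complex R]_3)
    (x v : @flag_space R) : 'M[complex R]_3 :=
  to_mx ('D_v (fun y => of_mx (F y) : @cmx R) x).

Section MatrixFunctions.
Context {R : realType}.
Local Notation C := (complex R).
Local Notation cmx := (@cmx R).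
Local Notation flag_space := (@flag_space R).
Local Notation flags := (@flags R).
Local Notation prs x := (fun i : 'I_3 => pr i x).
Local Notation dprs v := (fun i : 'I_3 => dpr i v).
Implicit Types (x v w : flag_space) (u X : 'M[C]_3).
Implicit Types (F G : flag_space -> 'M[C]_3).

Definition smooth_mx F := smooth (fun y => of_mx (F y) : cmx).
Lemma mx_deriveE F x v : mx_derive F x v = to_mx ('D_v (fun y => of_mx (F y) : cmx) x).
Proof. by rewrite mx_derive.unlock. Qed.

Lemma smooth_mx_of (G : flag_space -> cmx) : smooth G -> smooth_mx (fun y => to_mx (G y)).
Proof. by rewrite /smooth_mx; under eq_fun do rewrite to_mxK. Qed.

Lemma mx_derive_of (G : flag_space -> cmx) x v : mx_derive (fun y => to_mx (G y)) x v = to_mx ('D_v G x).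
Proof. by rewrite !mx_deriveE; under eq_fun do rewrite to_mxK. Qed.

Lemma smooth_mx_mul F G : smooth_mx F -> smooth_mx G -> smooth_mx (fun y => F y *m G y).
Proof.
move=> sF sG; have := smooth_cmul sF sG.
by rewrite /cmul; under eq_fun do rewrite !of_mxK.
Qed.

Lemma mx_derive_mul F G x v : smooth_mx F -> smooth_mx G ->
  mx_derive (fun y => F y *m G y) x v = mx_derive F x v *m G x + F x *m mx_derive G x v.
Proof.
move=> sF sG; rewrite !mx_deriveE.
have -> : (fun y => of_mx (F y *m G y)) = fun y => cmul (of_mx (F y)) (of_mx (G y)).
  by apply/funext => y; rewrite /cmul !of_mxK.
rewrite derive_cmul; try exact: smooth_differentiable.
by rewrite to_mxD !to_mx_cmul !of_mxK.
Qed.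

Lemma of_mxD (A B : 'M[C]_3) : of_mx (A + B) = of_mx A + of_mx B.
Proof. by apply: to_mx_inj; rewrite to_mxD !of_mxK. Qed.

Lemma of_mx_scale z (A : 'M[C]_3) : of_mx (z *: A) = cscale z (of_mx A).
Proof. by rewrite /cscale of_mxK. Qed.

Lemma of_mx_sum (I : Type) (s : seq I) (F : I -> 'M[C]_3) :
  of_mx (\sum_(i <- s) F i) = \sum_(i <- s) of_mx (F i).
Proof.
apply: (big_morph (@of_mx R)); first exact: of_mxD.
by apply: to_mx_inj; rewrite of_mxK to_mx0.
Qed.

Lemma smooth_mxD F G : smooth_mx F -> smooth_mx G -> smooth_mx (fun y => F y + G y).
Proof.
move=> sF sG; have := smoothD sF sG.
by rewrite /smooth_mx; under [X in _ -> smooth X]eq_fun do rewrite of_mxD.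
Qed.

Lemma mx_deriveD F G x v : smooth_mx F -> smooth_mx G ->
  mx_derive (fun y => F y + G y) x v = mx_derive F x v + mx_derive G x v.
Proof.
move=> sF sG; rewrite !mx_deriveE -to_mxD -deriveD; try exact: smooth_derivable.
by congr (to_mx ('D_v _ x)); apply/funext => y; rewrite of_mxD.
Qed.

Lemma smooth_mx_scale z F : smooth_mx F -> smooth_mx (fun y => z *: F y).
Proof.
move=> sF; rewrite /smooth_mx; under eq_fun do rewrite of_mx_scale.
exact (smooth_comp_lin findim_cmx (linear_cscale z) sF).
Qed.

Lemma mx_derive_scale z F x v : smooth_mx F -> mx_derive (fun y => z *: F y) x v = z *: mx_derive F x v.
Proof.
move=> sF; rewrite !mx_deriveE; under eq_fun do rewrite of_mx_scale.
rewrite (derive_comp_lin _ findim_cmx (linear_cscale z)); last exact: smooth_differentiable.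
by rewrite [LHS]of_mxK.
Qed.

Lemma smooth_mx_cst A : smooth_mx (fun=> A).
Proof. exact: smooth_cst. Qed.

Lemma mx_derive_cst A x v : mx_derive (fun=> A) x v = 0.
Proof. by rewrite !mx_deriveE derive_cst to_mx0. Qed.

Lemma smooth_mx_sum (I : Type) (s : seq I) (F : I -> flag_space -> 'M[C]_3) :
  (forall i, smooth_mx (F i)) -> smooth_mx (fun y => \sum_(i <- s) F i y).
Proof.
move=> sF; rewrite /smooth_mx; under eq_fun do rewrite of_mx_sum.
by apply: smooth_sum => i; apply: sF.
Qed.

Lemma mx_derive_sum (I : Type) (s : seq I) (F : I -> flag_space -> 'M[C]_3) x v :
  (forall i, smooth_mx (F i)) ->
  mx_derive (fun y => \sum_(i <- s) F i y) x v = \sum_(i <- s) mx_derive (F i) x v.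
Proof.
move=> sF; elim: s => [|i s IH].
  rewrite big_nil -[RHS](mx_derive_cst 0 x v); congr (mx_derive _ x v).
  by apply/funext => y; rewrite big_nil.
rewrite big_cons -IH -mx_deriveD; [|exact: sF|exact: smooth_mx_sum].
by congr (mx_derive _ x v); apply/funext => y; rewrite big_cons.
Qed.

Lemma smooth_mxN F : smooth_mx F -> smooth_mx (fun y => - F y).
Proof.
by move=> sF; have := smooth_mx_scale (-1) sF; under eq_fun do rewrite scaleN1r.
Qed.

Lemma mx_deriveN F x v : smooth_mx F -> mx_derive (fun y => - F y) x v = - mx_derive F x v.
Proof.
move=> sF; have := mx_derive_scale (-1) x v sF; rewrite scaleN1r => <-.
by congr (mx_derive _ x v); apply/funext => y; rewrite scaleN1r.
Qed.

Lemma smooth_mx_comm F G : smooth_mx F -> smooth_mx G -> smooth_mx (fun y => comm (F y) (G y)).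
Proof.
move=> sF sG; rewrite /smooth_mx; under eq_fun do rewrite commE.
exact (smooth_mxD (smooth_mx_mul sF sG) (smooth_mxN (smooth_mx_mul sG sF))).
Qed.

Lemma mx_derive_comm F G x v : smooth_mx F -> smooth_mx G ->
  mx_derive (fun y => comm (F y) (G y)) x v = comm (mx_derive F x v) (G x) + comm (F x) (mx_derive G x v).
Proof.
move=> sF sG; have sFG := smooth_mx_mul sF sG; have sGF := smooth_mx_mul sG sF.
under eq_fun do rewrite commE.
rewrite (mx_deriveD _ _ sFG (smooth_mxN sGF)) (mx_deriveN _ _ sGF) !mx_derive_mul // !commE.
by rewrite opprD [- _ - _]addrC addrACA.
Qed.

Lemma smooth_mx_pr i : smooth_mx (pr i).
Proof.
rewrite /smooth_mx; under eq_fun do rewrite prU.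
exact: smooth_mx_of (@smooth_flag_line R i).
Qed.

Lemma mx_derive_pr i x v : mx_derive (pr i) x v = dpr i v.
Proof.
have -> : pr i = fun y : flag_space => to_mx (flag_line i y) by apply/funext => y; rewrite prU.
by rewrite mx_derive_of derive_flag_line dprU.
Qed.

Lemma smooth_mx_dpr i (Y : flag_space -> flag_space) : smooth Y -> smooth_mx (fun y => dpr i (Y y)).
Proof.
move=> sY; rewrite /smooth_mx; under eq_fun do rewrite dprU.
apply: smooth_mx_of.
exact (smooth_comp_lin findim_flag_space (linear_dline i) sY).
Qed.

Lemma mx_derive_dpr i (Y : flag_space -> flag_space) x v : smooth Y ->
  mx_derive (fun y => dpr i (Y y)) x v = dpr i ('D_v Y x).
Proof.
move=> sY; under eq_fun do rewrite dprU; rewrite dprU.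
rewrite mx_derive_of (derive_comp_lin _ findim_flag_space (linear_dline i)) //.
exact: smooth_differentiable.
Qed.

Lemma smooth_mx_blk e F : smooth_mx F -> smooth_mx (fun y => blk (prs y) e (F y)).
Proof.
move=> sF; rewrite /smooth_mx; under eq_fun do rewrite blkE.
apply: smooth_mx_sum => a; apply: smooth_mx_sum => b; apply: smooth_mx_scale.
by apply: smooth_mx_mul; [apply: smooth_mx_mul|]; try exact: smooth_mx_pr.
Qed.

(** D_v F - [X, F] is the canonical covariant derivative of F. As v = [fund X x] moves each P_a by
    [X, P_a], it commutes with every [blk] of constant coefficients. *)
Lemma mx_derive_blk e F x X : smooth_mx F -> let v := fund X x in
  mx_derive (fun y => blk (prs y) e (F y)) x v - comm X (blk (prs x) e (F x))
  = blk (prs x) e (mx_derive F x v - comm X (F x)).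
Proof.
move=> sF v; rewrite -blk_derivation; congr (_ - _).
under eq_fun do rewrite blkE.
rewrite mx_derive_sum => [|a]; last first.
  apply: smooth_mx_sum => b; apply: smooth_mx_scale.
  by apply: smooth_mx_mul; [apply: smooth_mx_mul|]; try exact: smooth_mx_pr.
apply: eq_bigr => a _; rewrite mx_derive_sum => [|b]; last first.
  apply: smooth_mx_scale; by apply: smooth_mx_mul; [apply: smooth_mx_mul|]; try exact: smooth_mx_pr.
apply: eq_bigr => b _.
have s1 : smooth_mx (fun y => pr a y *m F y) by apply: smooth_mx_mul => //; exact: smooth_mx_pr.
rewrite mx_derive_scale; last by apply: smooth_mx_mul => //; exact: smooth_mx_pr.
rewrite (mx_derive_mul _ _ s1 (smooth_mx_pr b)) (mx_derive_mul _ _ (smooth_mx_pr a) sF) !mx_derive_pr.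
by rewrite !dpr_fund mulmxDl.
Qed.

Lemma smooth_mx_hat (Y : flag_space -> flag_space) : smooth Y -> smooth_mx (fun y => hat y (Y y)).
Proof.
move=> sY; rewrite /smooth_mx; under eq_fun do rewrite hatE.
apply: smooth_mx_sum => i; apply: smooth_mx_mul; last exact: smooth_mx_pr.
exact: smooth_mx_dpr.
Qed.

Lemma smooth_mx_pih c (Y : flag_space -> flag_space) : smooth Y ->
  smooth_mx (fun y => proj_hat (prs y) c (dprs (Y y))).
Proof. by move=> sY; apply: smooth_mx_sum => i; apply/smooth_mx_blk/smooth_mx_dpr. Qed.

Lemma smooth_pair (T V W : normedModType R) (f : T -> V) (g : T -> W) :
  findim V -> findim W -> smooth f -> smooth g -> smooth (fun y => (f y, g y)).
Proof.
move=> fV fW sf sg.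
have l1 : linear (fun y : V => (y, 0 : W)).
  by move=> a y z; congr pair; rewrite /= scaler0 addr0.
have l2 : linear (fun y : W => (0 : V, y)).
  by move=> a y z; congr pair; rewrite /= scaler0 addr0.
have := smoothD (smooth_comp_lin fV l1 sf) (smooth_comp_lin fW l2 sg).
rewrite (_ : (fun y => _ + _) = fun y => (f y, g y)) //.
by apply/funext => y; congr pair; rewrite /= ?addr0 ?add0r.
Qed.

Lemma smooth_fund F (Y : flag_space -> flag_space) :
  smooth_mx F -> smooth Y -> smooth (fun y => fund (F y) (Y y)).
Proof.
move=> sF sY; have lfst : linear (fst : flag_space -> cmx) by [].
have lsnd : linear (snd : flag_space -> cmx) by [].
have s1 := smooth_mx_of (smooth_comp_lin findim_flag_space lfst sY).
have s2 := smooth_mx_of (smooth_comp_lin findim_flag_space lsnd sY).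
have := smooth_pair findim_cmx findim_cmx (smooth_mx_comm sF s1) (smooth_mx_comm sF s2).
by rewrite fund.unlock.
Qed.

(** The product rule gives [D_v F, P_i] + [F, [X, P_i]], and the Jacobi identity rewrites the last
    term as [X, [F, P_i]] - [[X, F], P_i]. This separates the canonical connection from the
    second-order term. *)
Lemma derive_fund F x X : smooth_mx F -> let v := fund X x in
  'D_v (fun y => fund (F y) y) x =
  fund (mx_derive F x v - comm X (F x)) x + fund X (fund (F x) x).
Proof.
move=> sF v; apply: (@flag_space_eq R) => i.
rewrite -mx_derive_dpr; last exact: smooth_fund sF (smooth_lin findim_flag_space (fun a y z => erefl)).
rewrite dprD dpr_fund dpr_fundl dpr_fund.
have -> : (fun y => dpr i (fund (F y) y)) = fun y => comm (F y) (pr i y).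
  by apply/funext => y; rewrite dpr_fund.
rewrite (mx_derive_comm _ _ sF (smooth_mx_pr i)) mx_derive_pr dpr_fund (jacobi X (F x)).
by rewrite (commBl (mx_derive F x v)) addrA subrK.
Qed.

Lemma mx_derive_eq_on F G x v : smooth_mx F -> smooth_mx G -> (forall y, flags y -> F y = G y) ->
  tangent flags x v -> mx_derive F x v = mx_derive G x v.
Proof.
move=> sF sG FG tv.
have FG' y : flags y -> of_mx (F y) = of_mx (G y) by move=> Fy; rewrite FG.
by rewrite !mx_deriveE (derive_eq_on (smooth_differentiable x sF) (smooth_differentiable x sG) FG' tv).
Qed.

Lemma smooth_mx_adj F : smooth_mx F -> smooth_mx (fun y => (F y)^t*).
Proof.
move=> sF; have := smooth_cadj sF.
by rewrite /cadj; under eq_fun do rewrite of_mxK.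
Qed.

Lemma mx_derive_adj F x v : smooth_mx F -> mx_derive (fun y => (F y)^t*) x v = (mx_derive F x v)^t*.
Proof.
move=> sF; rewrite !mx_deriveE -to_mx_cadj -derive_cadj; last exact: smooth_differentiable.
by congr (to_mx ('D_v _ x)); apply/funext => y; rewrite /cadj of_mxK.
Qed.

End MatrixFunctions.

(** * Levi-Civita connections of the invariant metrics *)

Definition coC (R : realType) (c : 'I_3 -> 'I_3 -> R) a b : complex R := (c a b)%:C%C.

(* Every invariant metric is the restriction of a constant, indefinite bilinear
   form on the ambient space. *)
HB.lock Definition form (R : realType) (c : 'I_3 -> 'I_3 -> R)
    (v w : @flag_space R) : R :=
  - (4^-1 * complex.Re (\sum_i \sum_j coC c i j * \tr (dpr i v *m dpr j w))).

Section Connection.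
Context {R : realType}.
Local Notation C := (complex R).
Local Notation flag_space := (@flag_space R).
Local Notation flags := (@flags R).
Local Notation prs x := (fun i : 'I_3 => pr i x).
Local Notation dprs v := (fun i : 'I_3 => dpr i v).
Implicit Types (x v w : flag_space) (u A : 'M[C]_3).

Definition endo (e : 'I_3 -> 'I_3 -> C) x v : flag_space :=
  fund (blk (prs x) e (hat x v)) x.

Definition proj c x v : flag_space := fund (proj_hat (prs x) (coC c) (dprs v)) x.

(* As the form is constant, its Levi-Civita connection is the orthogonal
   projection of the ambient derivative. *)
Definition conn c (X Y : flag_space -> flag_space) x : flag_space :=
  proj c x (diff_on flags Y x (X x)).

Lemma formE c v w :
  form c v w = - (4^-1 * complex.Re (\sum_i \sum_j coC c i j * \tr (dpr i v *m dpr j w))).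
Proof. by rewrite form.unlock. Qed.

Definition positive_coef (c : 'I_3 -> 'I_3 -> R) :=
  [/\ forall a, c a a = 0, forall a b, c a b = c b a &
      forall a b, a != b -> 0 < c a b].

Lemma admissible_coC c : positive_coef c -> admissible (coC c).
Proof.
move=> [c0 cC cP]; split.
- by move=> a; rewrite /coC c0.
- by move=> a b; rewrite /coC cC.
- by move=> a b ab; rewrite /coC fmorph_eq0 gt_eqF // cP.
Qed.

Lemma coC_real (c : 'I_3 -> 'I_3 -> R) a b : (coC c a b)^* = coC c a b.
Proof. by apply/eqP; rewrite eq_complex /= oppr0 !eqxx. Qed.

(** One matrix W, the canonical derivative of [hat y (Y y)], serves for Y and for all the fields
    [endo e y (Y y)] at once; hence its later cancellation in nabla J. *)
Lemma field_derivative Y F x v : smooth F -> vector_field flags Y ->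
  (forall y, flags y -> F y = Y y) -> tangent flags x v ->
  exists W, [/\ W^t* = - W,
    'D_v F x = fund W x + fund (hat x v) (Y x) &
    forall e, diff_on flags (fun y => endo e y (Y y)) x v =
      fund (blk (prs x) e W) x + fund (hat x v) (endo e x (Y x))].
Proof.
move=> sF [_ tY] FY tv; have Fx := tangent_mem tv.
set X := hat x v; have Xs : X^t* = - X := hat_adj tv.
have vE : v = fund X x by rewrite /X fund_hat.
pose H y := hat y (F y); have sH : smooth_mx H := smooth_mx_hat sF.
have Hs y : flags y -> (H y)^t* = - H y.
  by move=> Fy; rewrite /H (FY _ Fy); apply: hat_adj; apply: tY.
exists (mx_derive H x v - comm X (H x)); split.
(* H is known to be skew-Hermitian on the flags only, which is enough in a tangent direction. *)
- have DHs := mx_derive_eq_on (smooth_mx_adj sH) (smooth_mxN sH) Hs tv.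
  rewrite (mx_derive_adj _ _ sH) (mx_deriveN _ _ sH) in DHs.
  exact (adj_sub_comm Xs (Hs _ Fx) DHs).
- have Ffund y : flags y -> F y = fund (H y) y.
    by move=> Fy; rewrite /H (FY _ Fy) fund_hat //; apply: tY.
  have sfid : smooth (fun y : flag_space => y).
    exact (smooth_lin findim_flag_space (fun a y z => erefl)).
  rewrite (derive_eq_on (smooth_differentiable x sF)
    (smooth_differentiable x (smooth_fund sH sfid)) Ffund tv).
  by rewrite {1}vE (derive_fund _ _ sH) -vE -(Ffund _ Fx) (FY _ Fx).
- move=> e; have sB := smooth_mx_blk e sH.
  have sfid : smooth (fun y : flag_space => y).
    exact (smooth_lin findim_flag_space (fun a y z => erefl)).
  rewrite (diff_onE (smooth_fund sB sfid) _ tv); last first.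
    by move=> y Fy; rewrite /endo /H (FY _ Fy).
  rewrite {1}vE (derive_fund _ _ sB) -vE {1}vE (mx_derive_blk e x X sH) -vE.
  by rewrite /endo /H (FY _ Fx).
Qed.

Definition is_frame x u :=
  u \is unitarymx /\ forall i, pr i x = u *m delta_mx i i *m u^t*.

Lemma is_frame_frame x : flags x -> is_frame x (frame x).
Proof. by move=> Fx; split; [exact: frame_unitary|move=> i; apply: pr_frame]. Qed.

Lemma is_frame_base : is_frame base_flag 1%:M.
Proof.
split=> [|i]; last by rewrite pr_base cj1.
by apply/unitarymxP; rewrite adj1 mulmx1.
Qed.

Lemma is_frame_flags x u : is_frame x u -> flags x.
Proof.
move=> [uu E]; apply/flagsP; exists u; first exact: uu.
by apply: pr_inj => i; rewrite (pr_act _ _ uu) pr_base E.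
Qed.

Lemma prx_frame x u : is_frame x u -> prs x = fun i => u *m delta_mx i i *m u^t*.
Proof. by move=> [_ uE]; apply/funext => i; apply: uE. Qed.

Lemma co_comm_pr x u A i a b : is_frame x u ->
  co u (comm A (pr i x)) a b = co u A a b * ((b == i)%:R - (a == i)%:R).
Proof.
move=> Fx; have fu := proj1 Fx.
by rewrite (proj2 Fx i) co_comm_proj.
Qed.

Lemma co_blk_pr x u e A a b : is_frame x u ->
  co u (blk (prs x) e A) a b = e a b * co u A a b.
Proof.
move=> Fx; have fu := proj1 Fx.
by rewrite (prx_frame Fx) co_blk.
Qed.

Lemma eq_fund x u A B : is_frame x u ->
  fund A x = fund B x <-> (forall a b, a != b -> co u A a b = co u B a b).
Proof.
move=> Fx; have fu := proj1 Fx; split=> [E a b ab|E].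
  have := congr1 (fun v => co u (dpr b v) a b) E.
  rewrite !dpr_fund !(co_comm_pr _ _ _ _ Fx) eqxx (negbTE ab) subr0.
  by rewrite !mulr1.
apply: (@flag_space_eq R) => i; rewrite !dpr_fund; apply: (co_inj fu).
apply/matrixP => a b; rewrite !(co_comm_pr _ _ _ _ Fx).
by have [->|/E ->] := eqVneq a b; rewrite ?subrr ?mulr0.
Qed.

Lemma co_proj_hat_fund c x u A a b : admissible c -> is_frame x u ->
  co u (proj_hat (prs x) c (dprs (fund A x))) a b = co u A a b *+ (a != b).
Proof.
move=> hc Fx; rewrite (prx_frame Fx).
have -> : dprs (fund A x) =
    fun i => comm A (u *m delta_mx i i *m u^t*).
  by apply/funext => i; rewrite dpr_fund (proj2 Fx i).
exact: (co_proj_hat_comm (proj1 Fx) hc).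
Qed.

Lemma co_proj_hat_fund2 c x u A B a b : admissible c -> is_frame x u -> a != b ->
  co u (proj_hat (prs x) c (dprs (fund A (fund B x)))) a b =
  \sum_k (conn_coef c a b k * (co u A a k * co u B k b)
         - conn_coef c b a k * (co u B a k * co u A k b)).
Proof.
move=> hc Fx ab; rewrite (prx_frame Fx).
have -> : dprs (fund A (fund B x)) =
    fun i => comm A (comm B (u *m delta_mx i i *m u^t*)).
  by apply/funext => i; rewrite dpr_fundl dpr_fund (proj2 Fx i).
exact: (co_proj_hat_comm_comm (proj1 Fx) hc _ _ ab).
Qed.

Section Coef.
Variables (c : 'I_3 -> 'I_3 -> R) (cP : positive_coef c).
Let cA := admissible_coC cP.

Lemma projP x a v w : proj c x (a *: v + w) = a *: proj c x v + proj c x w.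
Proof.
rewrite /proj -fundZ -fundD -proj_hatZ -proj_hatD; congr (fund (proj_hat _ _ _) _).
by apply/funext => i; rewrite dprD dprZ.
Qed.

Lemma projD x v w : proj c x (v + w) = proj c x v + proj c x w.
Proof. by have := projP x 1 v w; rewrite !scale1r. Qed.

Lemma proj0 x : proj c x 0 = 0.
Proof. by apply: (addrI (proj c x 0)); rewrite -projD !addr0. Qed.

Lemma projZ x a v : proj c x (a *: v) = a *: proj c x v.
Proof. by have := projP x a v 0; rewrite proj0 !addr0. Qed.

Lemma projB x v w : proj c x (v - w) = proj c x v - proj c x w.
Proof. by rewrite projD -scaleN1r projZ scaleN1r. Qed.

Lemma proj_fund x A : flags x -> proj c x (fund A x) = fund A x.
Proof.
move=> /is_frame_frame Fx; apply/(eq_fund _ _ Fx) => a b ab.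
by rewrite (co_proj_hat_fund _ _ _ cA Fx) ab mulr1n.
Qed.

Lemma proj_tangent x v : tangent flags x v -> proj c x v = v.
Proof. by move=> tv; rewrite -(fund_hat tv) proj_fund //; apply: tangent_mem tv. Qed.

Lemma form_fund x u v B : is_frame x u ->
  form c v (fund B x) = - (2^-1 * complex.Re (\sum_a \sum_b
     coC c a b * co u (proj_hat (prs x) (coC c) (dprs v)) a b * co u B b a)).
Proof.
move=> Fx; have fu := proj1 Fx; rewrite formE.
have -> : \sum_i \sum_j coC c i j * \tr (dpr i v *m dpr j (fund B x)) =
  \sum_i \sum_j coC c i j * \tr (dpr i v *m comm B (pr j x)).
  by apply: eq_bigr => i _; apply: eq_bigr => j _; rewrite dpr_fund.
rewrite (prx_frame Fx).
have -> : \sum_i \sum_j coC c i j * \tr (dpr i v *m comm B (pr j x)) =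
 2%:R * \sum_a \sum_b coC c a b *
    co u (proj_hat (fun i : 'I_3 => u *m delta_mx i i *m u^t*) (coC c) (dprs v)) a b *
    co u B b a.
  transitivity (\sum_i \sum_j coC c i j * \tr (dpr i v *m comm B (u *m delta_mx j j *m u^t*))).
    by apply: eq_bigr => i _; apply: eq_bigr => j _; rewrite (proj2 Fx j).
  rewrite (trace_proj_hat fu cA) mulr_sumr; apply: eq_bigr => a _.
  by rewrite mulr_sumr; apply: eq_bigr => b _; rewrite !mulrA.
move: (\sum_a _) => z; congr (- _).
have -> : complex.Re (2%:R * z) = 2 * complex.Re z.
  by rewrite !mulr_natl !mulr2n; case: z.
by rewrite mulrA; congr (_ * _); field.
Qed.

(** By [form_fund] a vector enters the pairing with a tangent w through [proj_hat] only, and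
    [proj_hat] gives the same entries for v and [proj c x v]. *)
Lemma form_proj x v w : tangent flags x w -> form c (proj c x v) w = form c v w.
Proof.
move=> tw; have Fx := is_frame_frame (tangent_mem tw); have fu := proj1 Fx.
rewrite -(fund_hat tw) !(form_fund _ _ Fx).
congr (- (_ * complex.Re _)); apply: eq_bigr => a _; apply: eq_bigr => b _.
congr (_ * _ * _); rewrite (co_proj_hat_fund _ _ _ cA Fx).
have [->|ab] := eqVneq a b; last by rewrite mulr1n.
rewrite mulr0n (prx_frame Fx) (co_proj_hat fu) big1 // => i _.
by rewrite /proj_hat_coef subrr !mul0r.
Qed.

End Coef.
End Connection.

Section InvariantForm.
Context {R : realType}.
Local Notation C := (complex R).
Local Notation flag_space := (@flag_space R).
Local Notation flags := (@flags R).
Implicit Types (x v w : flag_space) (u A : 'M[C]_3).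

Lemma smooth_id : smooth (fun y : flag_space => y).
Proof. exact (smooth_lin findim_flag_space (fun a y z => erefl)). Qed.

Lemma tangent_act u x v : u \is unitarymx -> tangent flags x v ->
  tangent flags (act u x) (act u v).
Proof.
move=> uu tv; rewrite -(fund_hat tv) (act_fund _ _ uu); apply: fund_tangent.
  exact: flags_act uu (tangent_mem tv).
by rewrite cj_adj hat_adj // mulmxN mulNmx.
Qed.

Lemma smooth_act u : smooth (@act R u).
Proof. exact (smooth_lin findim_flag_space (linear_act u)). Qed.

Lemma diff_on_act u x v : tangent flags x v -> diff_on flags (@act R u) x v = act u v.
Proof.
move=> tv; rewrite (diff_onE (smooth_act u) (fun _ _ => erefl) tv).
exact (derive_lin x v findim_flag_space (linear_act u)).
Qed.

Section Form.
Variables (c : 'I_3 -> 'I_3 -> R) (cP : positive_coef c).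
Let cA := admissible_coC cP.

(** When A is skew-Hermitian as well, the ordered pairs (a, b) and (b, a) contribute conjugate
    terms. The factor 1/2 compensates for this, so that the coefficients of the metric are exactly
    the c_ab; positivity becomes visible in this form. *)
Lemma form_co x u A B : is_frame x u -> B^t* = - B ->
  form c (fund A x) (fund B x) =
  2^-1 * complex.Re (\sum_a \sum_b coC c a b * (co u A a b * (co u B a b)^*)).
Proof.
move=> uf Bs; rewrite (form_fund cP _ _ uf) -mulrN; congr (_ * _).
have ReN (z : C) : complex.Re (- z) = - complex.Re z by case: z.
rewrite -ReN; congr (complex.Re _); rewrite -sumrN; apply: eq_bigr => a _.
rewrite -sumrN; apply: eq_bigr => b _.
rewrite (co_proj_hat_fund _ _ _ cA uf).
have -> : co u B b a = - (co u B a b)^*.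
  have := congr1 (fun M => co u M b a) Bs; rewrite co_adj coN oppmxE !mxE.
  by move=> ->; rewrite opprK.
have [->|ab] := eqVneq a b; last by rewrite mulr1n mulrN opprK mulrA.
by have [c0 _ _] := cA; rewrite c0 !mul0r oppr0.
Qed.

Lemma form_linear a v w z : form c (a *: v + w) z = a * form c v z + form c w z.
Proof.
pose S y := \sum_i \sum_j coC c i j * \tr (dpr i y *m dpr j z).
have SE y : form c y z = - (4^-1 * complex.Re (S y)) by rewrite formE.
have -> : form c (a *: v + w) z = - (4^-1 * complex.Re (a%:C%C * S v + S w)).
  rewrite SE; congr (- (_ * complex.Re _)).
  rewrite /S mulr_sumr -big_split; apply: eq_bigr => i _.
  rewrite mulr_sumr -big_split; apply: eq_bigr => j _.
  rewrite dprD dprZ mulmxDl -scalemxAl mxtraceD mxtraceZ mulrDr.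
  by congr (_ + _); rewrite mulrCA.
rewrite !SE; case: (S v) (S w) => p q [p' q'] /=.
by rewrite mul0r subr0; ring.
Qed.

Lemma form_sym v w : form c v w = form c w v.
Proof.
rewrite !formE exchange_big /=; congr (- (_ * complex.Re _)).
apply: eq_bigr => i _; apply: eq_bigr => j _.
by have [_ cC _] := cA; rewrite (cC j i) mxtrace_mulC.
Qed.

Lemma bilin_form : bilin (form c : flag_space -> flag_space -> R).
Proof.
split=> [w a x y|w a x y]; first exact: form_linear.
by rewrite form_sym form_linear !(form_sym w).
Qed.

Lemma form_pos x v : tangent flags x v -> v != 0 -> 0 < form c v v.
Proof.
move=> tv v0; have Fx := is_frame_frame (tangent_mem tv).
have [c0 cC cp] := cP.
set A := hat x v; have vE : v = fund A x by rewrite /A fund_hat.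
set u := frame x in Fx.
(* If all off-diagonal entries vanished, v would be [fund 0 x], that is 0. *)
have [a [b [ab Aab]]] : exists a b, a != b /\ co u A a b != 0.
  apply: contrapT => H; move/eqP: v0; apply; rewrite vE.
  have -> : 0 = fund 0 x.
    by apply: (@flag_space_eq R) => i; rewrite dpr_fund -(subrr v) dprB subrr /= commE mul0mx mulmx0 subrr.
  apply/(eq_fund _ _ Fx) => i j ij; apply: contrapT => K; apply: H.
  exists i, j; split=> //; apply/eqP => E; apply: K; rewrite E.
  by rewrite coE mulmx0 mul0mx mxE.
have -> : form c v v = form c (fund A x) (fund A x) by rewrite -vE.
rewrite (form_co _ Fx (hat_adj tv)); rewrite mulr_gt0 // ?invr_gt0 //.
have E i j : coC c i j * (co u A i j * (co u A i j)^*) =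
    (c i j * (complex.Re (co u A i j) ^+ 2 + complex.Im (co u A i j) ^+ 2))%:C%C.
  by rewrite -normCK -add_Re2_Im2 -rmorphM.
under eq_bigr do under eq_bigr do rewrite E.
under eq_bigr do rewrite -rmorph_sum.
rewrite -rmorph_sum /=.
have ge0 i j : 0 <= c i j * (complex.Re (co u A i j) ^+ 2 + complex.Im (co u A i j) ^+ 2).
  rewrite mulr_ge0 ?addr_ge0 ?sqr_ge0 //.
  by have [->|/cp/ltW] := eqVneq i j; rewrite ?c0.
rewrite (bigD1 a) //= (bigD1 b) //= -addrA ltr_pwDl //.
  rewrite mulr_gt0 ?cp // lt_def addr_ge0 ?sqr_ge0 // andbT.
  apply: contraNneq Aab => /eqP.
  rewrite paddr_eq0 ?sqr_ge0 // !sqrf_eq0 => /andP[/eqP Re0 /eqP Im0].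
  by apply/eqP/eqP; rewrite eq_complex Re0 Im0 !eqxx.
by rewrite addr_ge0 ?sumr_ge0 // => i _; rewrite sumr_ge0.
Qed.

Lemma smooth_form (F G : flag_space -> flag_space) : smooth F -> smooth G ->
  smooth (fun y => form c (F y) (G y)).
Proof.
exact (smooth_bilin findim_flag_space findim_flag_space bilin_form (f := F) (g := G)).
Qed.

Lemma form_metric : riemannian_metric flags (fun _ => form c).
Proof.
split.
- by move=> *; apply: form_linear.
- by move=> *; apply: form_sym.
- by move=> x v Fx; apply: form_pos.
- move=> X Y [[F sF FX] _] [[G sG GY] _].
  exists (fun y => form c (F y) (G y)); first exact: smooth_form.
  by move=> y Fy; rewrite (FX _ Fy) (GY _ Fy).
Qed.

Lemma form_act u v w : u \is unitarymx -> form c (act u v) (act u w) = form c v w.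
Proof.
move=> uu; rewrite !formE; congr (- (_ * complex.Re _)).
apply: eq_bigr => i _; apply: eq_bigr => j _; rewrite !dpr_act (cjM _ _ uu).
by rewrite (cj_tr _ uu).
Qed.

Lemma form_homogeneous : homogeneous_metric (fun _ => form c).
Proof.
split; first exact: form_metric.
by move=> u uu x v w Fx tv tw; rewrite (diff_on_act _ tv) (diff_on_act _ tw) (form_act _ _ uu).
Qed.

End Form.
End InvariantForm.

Section LeviCivitaConnection.
Context {R : realType}.
Local Notation C := (complex R).
Local Notation flag_space := (@flag_space R).
Local Notation flags := (@flags R).
Implicit Types (x v w : flag_space) (u A : 'M[C]_3).

(** The second-order terms of the two derivatives combine to [A, [B, P_i]] - [B, [A, P_i]] =
    [[A, B], P_i], so the bracket is [fund] of a skew-Hermitian matrix. *)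
Lemma lie_bracket_tangent X Y x : vector_field flags X -> vector_field flags Y ->
  flags x -> tangent flags x (lie_bracket flags X Y x).
Proof.
move=> vX vY Fx.
have [[F sF FX] tX] := vX; have [[G sG GY] tY] := vY.
have [W1 [W1s E1 _]] := field_derivative sF vX FX (tY _ Fx).
have [W2 [W2s E2 _]] := field_derivative sG vY GY (tX _ Fx).
rewrite /lie_bracket (diff_onE sF FX (tY _ Fx)) (diff_onE sG GY (tX _ Fx)) E1 E2.
set A := hat x (X x); set B := hat x (Y x).
have As : A^t* = - A := hat_adj (tX _ Fx).
have Bs : B^t* = - B := hat_adj (tY _ Fx).
have -> : fund W2 x + fund A (Y x) - (fund W1 x + fund B (X x)) =
          fund (W2 - W1 + comm A B) x.
  rewrite -{1}(fund_hat (tX _ Fx)) -{1}(fund_hat (tY _ Fx)) -/A -/B.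
  apply: (@flag_space_eq R) => i.
  rewrite dprB !dprD (dpr_fundl i A (fund B x)) (dpr_fundl i B (fund A x)) !dpr_fund commDl commBl (jacobi A B).
  by rewrite opprD addrACA addrK.
apply: fund_tangent => //.
by rewrite adjD adjB W1s W2s (adj_comm_skew2 As Bs) -!opprD.
Qed.

Section Coef.
Variables (c : 'I_3 -> 'I_3 -> R) (cP : positive_coef c).
Let cA := admissible_coC cP.

Lemma proj_tangent_field Y x v : vector_field flags Y -> tangent flags x v ->
  tangent flags x (proj c x (diff_on flags Y x v)).
Proof.
move=> vY tv; have Fx := tangent_mem tv; have fx := is_frame_frame Fx.
have [[F sF FY] tY] := vY.
have [W [Ws E _]] := field_derivative sF vY FY tv.
apply: fund_tangent => //; rewrite (prx_frame fx).
apply: (proj_hat_adj (proj1 fx) cA); first by move=> a b; exact: coC_real.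
move=> i; rewrite (diff_onE sF FY tv) E dprD dpr_fund dpr_fundl.
have -> : dpr i (Y x) = comm (hat x (Y x)) (pr i x).
  by rewrite -dpr_fund fund_hat //; apply: tY.
have Ps := pr_adj i Fx; have As := hat_adj tv; have Bs := hat_adj (tY _ Fx).
by rewrite adjD (adj_comm_skew Ws Ps) (adj_comm_skew As (adj_comm_skew Bs Ps)).
Qed.

Lemma conn_affine : affine_connection flags (conn c).
Proof.
split.
- move=> X Y vX vY; have [[F sF FX] tX] := vX; have [[G sG GY] tY] := vY.
  split; last by move=> x Fx; apply: proj_tangent_field; last exact: tX.
  have sD := smooth_dderive findim_flag_space findim_flag_space sF sG.
  (* [conn] is defined through [diff_on], which is meaningful on the flags; this expression in the
     ambient extensions F and G is a smooth extension of it. *)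
  exists (fun y => proj c y ('D_(F y) G y)).
    exact: smooth_fund (smooth_mx_pih (coC c) sD) smooth_id.
  by move=> y Fy; rewrite /conn (diff_onE sG GY (tX _ Fy)) (FX _ Fy).
- move=> X X' Y Y' vX vX' vY vY' XX YY x Fx.
  by rewrite /conn -(XX _ Fx) (diff_on_ext YY (proj1 vY) (proj2 vX _ Fx)).
- move=> f X X' Y [f' sf' ff'] [_ tX] [_ tX'] vY x Fx.
  have [[G sG GY] tY] := vY.
  have tt : tangent flags x (f x *: X x + X' x).
    have [As Bs] := (hat_adj (tX _ Fx), hat_adj (tX' _ Fx)).
    rewrite -{1}(fund_hat (tX _ Fx)) -{1}(fund_hat (tX' _ Fx)) -fundZ -fundD.
    apply: (fund_tangent Fx).
    by rewrite adjD adjZ As Bs scalerN -opprD (coC_real (fun _ _ => f x) 0 0).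
  rewrite /conn (diff_onE sG GY tt) (diff_onE sG GY (tX _ Fx)) (diff_onE sG GY (tX' _ Fx)).
  by rewrite !smooth_deriveE // linearP projP.
- move=> X Y Y' [_ tX] [[G sG GY] _] [[G' sG' GY'] _] x Fx.
  rewrite /conn (diff_onE (smoothD sG sG') _ (tX _ Fx)); last first.
    by move=> y Fy; rewrite (GY _ Fy) (GY' _ Fy).
  rewrite (diff_onE sG GY (tX _ Fx)) (diff_onE sG' GY' (tX _ Fx)) -projD.
  by rewrite deriveD //; apply: smooth_derivable.
- move=> f X Y [f' sf' ff'] [_ tX] [[G sG GY] tY] x Fx.
  rewrite /conn (diff_onE (smooth_scale findim_flag_space sf' sG) _ (tX _ Fx)); last first.
    by move=> y Fy; rewrite (ff' _ Fy) (GY _ Fy).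
  rewrite (derive_scale (X x) findim_flag_space (smooth_differentiable x sf')
    (smooth_differentiable x sG)).
  rewrite (diff_onE sf' ff' (tX _ Fx)) (diff_onE sG GY (tX _ Fx)).
  by rewrite projP projZ (ff' _ Fx) (GY _ Fx) (proj_tangent cP (tY _ Fx)).
Qed.

(** The form is constant, so the product rule gives metric compatibility once [form_proj] removes
    the projections. The torsion is right because the Lie bracket, the antisymmetrized ambient
    derivative, is already tangent. *)
Lemma conn_levi_civita : levi_civita flags (fun _ => form c) (conn c).
Proof.
split; first exact: conn_affine.
- move=> X Y Z vX vY vZ x Fx.
  have [[_ _ _] tX] := vX; have [[G sG GY] tY] := vY; have [[H sH HZ] tZ] := vZ.
  rewrite /conn (form_proj cP _ (tZ _ Fx)) form_sym // (form_sym cP (Y x)).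
  rewrite (form_proj cP _ (tY _ Fx)).
  rewrite (diff_onE (smooth_form cP sG sH) _ (tX _ Fx)); last first.
    by move=> y Fy; rewrite (GY _ Fy) (HZ _ Fy).
  rewrite (derive_bilin findim_flag_space findim_flag_space (bilin_form cP)); last 2 first.
  + exact: smooth_differentiable.
  + exact: smooth_differentiable.
  rewrite (GY _ Fx) (HZ _ Fx) (diff_onE sG GY (tX _ Fx)) (diff_onE sH HZ (tX _ Fx)).
  by congr (_ + _); exact (form_sym cP _ _).
- move=> X Y vX vY x Fx; rewrite /conn -projB.
  by rewrite proj_tangent //; apply: lie_bracket_tangent.
Qed.
End Coef.
End LeviCivitaConnection.

(** * Invariant almost complex structures *)

Section ComplexStructures.
Context {R : realType}.
Local Notation C := (complex R).
Local Notation flag_space := (@flag_space R).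
Local Notation flags := (@flags R).
Local Notation prs x := (fun i : 'I_3 => pr i x).
Local Notation dprs v := (fun i : 'I_3 => dpr i v).
Implicit Types (x v w : flag_space) (u A : 'M[C]_3).

Lemma hat_act u x v : u \is unitarymx -> hat (act u x) (act u v) = u *m hat x v *m u^t*.
Proof.
move=> uu; rewrite !hatE mulmx_sumr mulmx_suml; apply: eq_bigr => i _.
by rewrite dpr_act (pr_act _ _ uu) (cjM _ _ uu).
Qed.

(** Each (V_i)_aa vanishes, being a diagonal entry of a bracket with P_i. So [hat] picks the
    representative of v in the off-diagonal complement of the isotropy algebra. *)
Lemma hat_diag x u v a : is_frame x u -> tangent flags x v -> co u (hat x v) a a = 0.
Proof.
move=> fx tv; have [uu uE] := fx.
have dV i : co u (dpr i v) a a = 0.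
  rewrite -(fund_hat tv) dpr_fund (co_comm_pr _ _ _ _ fx).
  by rewrite subrr mulr0.
rewrite hatE co_sum summxE big1 // => i _.
rewrite (coM uu) uE (co_proj uu) mul_mx_deltaE.
by rewrite dV mul0rn.
Qed.

(** The last two clauses make each e_ab purely imaginary and let [blk] preserve skew-Hermitian
    matrices; with square -1 off the diagonal this leaves i or -i. The diagonal value 0 is a
    convention. *)
Definition acs_coef (e : 'I_3 -> 'I_3 -> C) :=
  [/\ forall a, e a a = 0, forall a b, a != b -> e a b * e a b = -1,
      forall a b, e b a = - e a b & forall a b, (e b a)^* = e a b].

Section Endo.
Variables (e : 'I_3 -> 'I_3 -> C) (he : acs_coef e).

Lemma blk_adj x A : flags x -> A^t* = - A -> (blk (prs x) e A)^t* = - blk (prs x) e A.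
Proof.
move=> Fx As; have [_ _ _ eC] := he.
by apply: adj_blk => // i; exact: pr_adj.
Qed.

Lemma endo_fund x A : flags x -> A^t* = - A -> endo e x (fund A x) = fund (blk (prs x) e A) x.
Proof.
move=> Fx As; have fx := is_frame_frame Fx; have tA := fund_tangent Fx As.
have [e0 _ _ _] := he.
have /(eq_fund _ _ fx) E := fund_hat tA.
apply/(eq_fund _ _ fx) => a b ab; rewrite !(co_blk_pr _ _ _ _ fx).
by rewrite E.
Qed.

Lemma endo_tangent x v : tangent flags x v -> tangent flags x (endo e x v).
Proof.
move=> tv; have Fx := tangent_mem tv.
by apply: fund_tangent => //; apply: blk_adj => //; apply: hat_adj.
Qed.

Lemma endo_linear x a v w : endo e x (a *: v + w) = a *: endo e x v + endo e x w.
Proof.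
rewrite /endo -fundZ -fundD -blkZ -blkD; congr (fund (blk _ _ _) _).
rewrite !hatE scaler_sumr -big_split; apply: eq_bigr => i _.
by rewrite dprD dprZ mulmxDl scalemxAl.
Qed.

Lemma endo_square x v : tangent flags x v -> endo e x (endo e x v) = - v.
Proof.
move=> tv; have Fx := tangent_mem tv; have fx := is_frame_frame Fx.
have As := hat_adj tv; have [e0 e1 _ _] := he.
rewrite {2}/endo (endo_fund Fx (blk_adj Fx As)) -{2}(fund_hat tv) -fundN.
apply/(eq_fund _ _ fx) => a b ab; rewrite !(co_blk_pr _ _ _ _ fx) coN oppmxE mulrA.
by rewrite e1 // mulN1r.
Qed.

Lemma endo_acs : almost_complex flags (endo e).
Proof.
split.
- by move=> x v _; apply: endo_tangent.
- by move=> *; apply: endo_linear.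
- by move=> x v _; apply: endo_square.
- move=> X [[F sF FX] tX]; split; last by move=> x Fx; apply: endo_tangent; apply: tX.
  exists (fun y => endo e y (F y)).
    exact: smooth_fund (smooth_mx_blk e (smooth_mx_hat sF)) smooth_id.
  by move=> y Fy; rewrite (FX _ Fy).
Qed.

Lemma endo_act u x v : u \is unitarymx -> endo e (act u x) (act u v) = act u (endo e x v).
Proof.
move=> uu; rewrite /endo (act_fund _ _ uu) hat_act //; congr (fund _ _).
rewrite !blkE mulmx_sumr mulmx_suml; apply: eq_bigr => a _.
rewrite mulmx_sumr mulmx_suml; apply: eq_bigr => b _.
by rewrite !(pr_act _ _ uu) !(cjM _ _ uu) -scalemxAr -scalemxAl.
Qed.

Lemma endo_invariant : invariant_acs (endo e).
Proof.
move=> u uu x v Fx tv.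
rewrite (diff_on_act _ tv) (diff_on_act _ (endo_tangent tv)).
exact: endo_act.
Qed.

Lemma endo_compatible c : positive_coef c -> compatible flags (fun _ => form c) (endo e).
Proof.
move=> cP x v w Fx tv tw; have fx := is_frame_frame Fx; have [e0 e1 eN eC] := he.
rewrite -{2}(fund_hat tv) -{2}(fund_hat tw).
rewrite (form_co cP _ fx (hat_adj tw)) (form_co cP _ fx (blk_adj Fx (hat_adj tw))).
congr (_ * complex.Re _); apply: eq_bigr => a _; apply: eq_bigr => b _.
rewrite !(co_blk_pr _ _ _ _ fx); have [->|ab] := eqVneq a b.
  by have [c0 _ _] := admissible_coC cP; rewrite c0 !mul0r.
by congr (_ * _); rewrite rmorphM /= (eC b a) (eN a b) mulrACA mulrN e1 // opprK mul1r.
Qed.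

Section NablaJ.
Variables (c : 'I_3 -> 'I_3 -> R) (cP : positive_coef c).
Let cA := admissible_coC cP.

(** All derivatives of Y sit in W, and W enters both terms of nabla J as e W, so it cancels. What is
    left is the projected second-order term of e B minus e applied to that of B, and
    [co_proj_hat_fund2] computes both. *)
Lemma nablaJ_fund X Y x u : vector_field flags X -> vector_field flags Y ->
  is_frame x u ->
  exists2 N, nablaJ (conn c) (endo e) X Y x = fund N x &
  forall a b, a != b -> co u N a b = \sum_k
    (conn_coef (coC c) a b k * (e k b - e a b) * (co u (hat x (X x)) a k * co u (hat x (Y x)) k b)
   - conn_coef (coC c) b a k * (e a k - e a b) * (co u (hat x (Y x)) a k * co u (hat x (X x)) k b)).
Proof.
move=> [_ tX] vY fx; have [[G sG GY] tY] := vY; have Fx := is_frame_flags fx.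
have [W [Ws E1 E2]] := field_derivative sG vY GY (tX _ Fx).
have As := hat_adj (tX _ Fx); have Bs := hat_adj (tY _ Fx).
rewrite /nablaJ /conn E2 (diff_onE sG GY (tX _ Fx)) E1.
set A := hat x (X x) in As *; set B := hat x (Y x) in Bs *.
rewrite !projD // !(proj_fund cP) //.
have -> : endo e x (Y x) = fund (blk (prs x) e B) x by [].
have -> : Y x = fund B x by rewrite fund_hat //; apply: tY.
set L := proj_hat (prs x) (coC c) (dprs (fund A (fund B x))).
set K := proj_hat (prs x) (coC c) (dprs (fund A (fund (blk (prs x) e B) x))).
have Ls : L^t* = - L.
  rewrite /L (prx_frame fx); apply: (proj_hat_adj (proj1 fx) cA).
    by move=> i j; exact: coC_real.
  move=> i; rewrite dpr_fundl dpr_fund.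
  by rewrite (adj_comm_skew As (adj_comm_skew Bs (pr_adj i Fx))).
exists (K - blk (prs x) e L).
  have -> : fund W x + proj c x (fund A (fund B x)) = fund (W + L) x by rewrite fundD.
  rewrite (endo_fund Fx); last by rewrite adjD Ws Ls opprD.
  rewrite /proj -/K.
  by rewrite blkD !fundD fundN opprD addrACA subrr add0r.
move=> a b ab; rewrite coB addmxE oppmxE (co_blk_pr _ _ _ _ fx) /K /L.
rewrite (co_proj_hat_fund2 _ _ cA fx ab) (co_proj_hat_fund2 _ _ cA fx ab).
rewrite mulr_sumr -sumrB; apply: eq_bigr => k _.
rewrite !(co_blk_pr _ _ _ _ fx).
by ring.
Qed.

End NablaJ.
End Endo.
End ComplexStructures.

(** * Parallelism as conditions on the metric and structure coefficients *)

Section Parallel.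
Context {R : realType}.
Local Notation C := (complex R).
Local Notation flag_space := (@flag_space R).
Local Notation flags := (@flags R).
Implicit Types (x v w : flag_space) (u A : 'M[C]_3).

Section Conditions.
Variables (c : 'I_3 -> 'I_3 -> R) (cP : positive_coef c).
Variables (e : 'I_3 -> 'I_3 -> C) (he : acs_coef e).
Let cA := admissible_coC cP.
Local Notation lam := (conn_coef (coC c)).

Definition skew_unit (a k : 'I_3) : 'M[C]_3 := delta_mx a k - delta_mx k a.

Lemma skew_unit_adj a k : (skew_unit a k)^t* = - skew_unit a k.
Proof. by rewrite /skew_unit adjB !adj_delta opprB. Qed.

Lemma skew_unitE a k i j :
  skew_unit a k i j = ((i == a) && (j == k))%:R - ((i == k) && (j == a))%:R.
Proof. by rewrite /skew_unit addmxE oppmxE !mxE. Qed.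

Lemma fund_field A : A^t* = - A -> vector_field flags (fund A).
Proof.
move=> As; split; last by move=> x Fx; apply: fund_tangent.
by exists (fund A) => //; exact: smooth_fund (smooth_mx_cst A) smooth_id.
Qed.

Lemma fund0 x : fund 0 x = 0.
Proof.
by apply: (addrI (fund 0 x)); rewrite -fundD !addr0.
Qed.

Lemma hat_skew_unit a k i j : a != k ->
  hat base_flag (fund (skew_unit a k) base_flag) i j = skew_unit a k i j.
Proof.
move=> ak; have fb := @is_frame_base R; have Fb := is_frame_flags fb.
have ta := fund_tangent Fb (skew_unit_adj a k).
have E A : co 1%:M A = A by rewrite coE adj1 mul1mx mulmx1.
have [->|ij] := eqVneq i j.
  have := hat_diag j fb ta; rewrite E => ->; rewrite skew_unitE.
  by rewrite andbC subrr.
have /(eq_fund _ _ fb)/(_ i j ij) := fund_hat ta.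
by rewrite !E.
Qed.

(** The test fields have the entries (a, k) and (k, b) equal to 1 at the base flag, so in the entry
    (a, b) the first product with this k is the only term of [nablaJ_fund] that survives. Exchanging
    the fields, in the next lemma, isolates the second product. *)
Lemma nablaJ_skew_units a b k : a != b -> a != k -> b != k ->
  exists2 N, nablaJ (conn c) (endo e) (fund (skew_unit a k)) (fund (skew_unit k b)) base_flag
     = fund N base_flag & N a b = lam a b k * (e k b - e a b).
Proof.
move=> ab ak bk; have kb : k != b by rewrite eq_sym.
have fb := @is_frame_base R.
have E A : co 1%:M A = A by rewrite coE adj1 mul1mx mulmx1.
have [N NE N_ab] := nablaJ_fund he cP (fund_field (skew_unit_adj a k))
  (fund_field (skew_unit_adj k b)) fb.
exists N => //; have := N_ab _ _ ab; rewrite !E => ->.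
under eq_bigr do rewrite !hat_skew_unit // !skew_unitE.
rewrite (bigD1 k) //= big1 => [|k' k'k].
  by rewrite !eqxx (negbTE ab) (negbTE ak) [k == a]eq_sym (negbTE ak) (negbTE kb) /=; ring.
by rewrite (negbTE k'k) !eqxx (negbTE ab) (negbTE ak) /=; ring.
Qed.

Lemma nablaJ_skew_units' a b k : a != b -> a != k -> b != k ->
  exists2 N, nablaJ (conn c) (endo e) (fund (skew_unit k b)) (fund (skew_unit a k)) base_flag
     = fund N base_flag & N a b = - (lam b a k * (e a k - e a b)).
Proof.
move=> ab ak bk; have kb : k != b by rewrite eq_sym.
have fb := @is_frame_base R.
have E A : co 1%:M A = A by rewrite coE adj1 mul1mx mulmx1.
have [N NE N_ab] := nablaJ_fund he cP (fund_field (skew_unit_adj k b))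
  (fund_field (skew_unit_adj a k)) fb.
exists N => //; have := N_ab _ _ ab; rewrite !E => ->.
under eq_bigr do rewrite !hat_skew_unit // !skew_unitE.
rewrite (bigD1 k) //= big1 => [|k' k'k].
  by rewrite !eqxx (negbTE ab) (negbTE ak) [k == a]eq_sym (negbTE ak) (negbTE kb) /=; ring.
by rewrite (negbTE k'k) !eqxx (negbTE ab) (negbTE ak) /=; ring.
Qed.

Lemma fund_base_eq0 N a b : a != b -> fund N (@base_flag R) = 0 -> N a b = 0.
Proof.
move=> ab; rewrite -(fund0 base_flag) => /(eq_fund _ _ (@is_frame_base R))/(_ a b ab).
by rewrite !coE adj1 !mul1mx !mulmx1 mxE.
Qed.

Definition parallel_cond := forall a b k, a != b -> a != k -> b != k ->
  lam a b k * (e k b - e a b) = 0.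

Definition nearly_cond := forall a b k, a != b -> a != k -> b != k ->
  lam a b k * (e k b - e a b) = lam b a k * (e a k - e a b).

Lemma parallelP : parallel flags (conn c) (endo e) <-> parallel_cond.
Proof.
split=> [H a b k ab ak bk|H X Y vX vY x Fx].
  have [N NE <-] := nablaJ_skew_units ab ak bk.
  apply: (fund_base_eq0 ab); rewrite -NE; apply: H; try exact: fund_field (skew_unit_adj _ _).
  exact: is_frame_flags (@is_frame_base R).
have fx := is_frame_frame Fx; have [e0 e1 eN eC] := he.
have [N -> NE] := nablaJ_fund he cP vX vY fx.
rewrite -(fund0 x); apply/(eq_fund _ _ fx) => a b ab; rewrite (NE _ _ ab).
have -> : co (frame x) 0 = 0 by rewrite coE mulmx0 mul0mx.
rewrite mxE big1 // => k _.
(* For k = a or k = b one difference of values of e vanishes, and the other product contains a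
   diagonal entry of a [hat], which is 0. *)
have [->|ak] := eqVneq k a.
  by rewrite subrr mulr0 mul0r (hat_diag _ fx (proj2 vY _ Fx)) mul0r mulr0 subrr.
have [->|bk] := eqVneq k b.
  by rewrite subrr mulr0 mul0r (hat_diag _ fx (proj2 vY _ Fx)) mulr0 mulr0 subrr.
rewrite H // 1?eq_sym // mul0r sub0r.
(* Antisymmetry of e turns the second product into the condition for (b, a, k). *)
have -> : lam b a k * (e a k - e a b) = - (lam b a k * (e k a - e b a)).
  by rewrite (eN a b) (eN a k); ring.
by rewrite H // 1?eq_sym // oppr0 mul0r oppr0.
Qed.

Lemma nearly_parallelP : nearly_parallel flags (conn c) (endo e) <-> nearly_cond.
Proof.
split=> [H a b k ab ak bk|H X Y vX vY x Fx].
  have [N NE <-] := nablaJ_skew_units ab ak bk.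
  have [N' N'E E'] := nablaJ_skew_units' ab ak bk.
  rewrite -[RHS]opprK -E'; apply/eqP; rewrite -subr_eq0 opprK -addmxE; apply/eqP.
  apply: (fund_base_eq0 ab); rewrite fundD -NE -N'E.
  rewrite H ?addNr //; try exact: fund_field (skew_unit_adj _ _).
  exact: is_frame_flags (@is_frame_base R).
have fx := is_frame_frame Fx.
have [N1 -> N1E] := nablaJ_fund he cP vX vY fx.
have [N2 -> N2E] := nablaJ_fund he cP vY vX fx.
rewrite -fundN; apply/(eq_fund _ _ fx) => a b ab; rewrite coN oppmxE.
rewrite (N1E _ _ ab) (N2E _ _ ab) -sumrN; apply: eq_bigr => k _.
have [->|ak] := eqVneq k a.
  rewrite !subrr !mulr0 !mul0r (hat_diag _ fx (proj2 vY _ Fx)) (hat_diag _ fx (proj2 vX _ Fx)).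
  by rewrite !mul0r !mulr0 subrr oppr0.
have [->|bk] := eqVneq k b.
  rewrite !subrr !mulr0 !mul0r (hat_diag _ fx (proj2 vY _ Fx)) (hat_diag _ fx (proj2 vX _ Fx)).
  by rewrite !mulr0 subrr oppr0.
by rewrite H // 1?eq_sym // opprB.
Qed.

End Conditions.
End Parallel.

(** * Solving the coefficient conditions *)

Section Coefficients.
Context {R : realType}.
Local Notation C := (complex R).
Local Notation flag_space := (@flag_space R).
Implicit Types (x v w : flag_space) (u A : 'M[C]_3).

(** The places (0, 1), (0, 2), (1, 2) of r, s, t are those of the three arguments of [kmx]. *)
Definition coef3 (r s t : R) (a b : 'I_3) : R :=
  nth 0 (nth [::] [:: [:: 0; r; s]; [:: r; 0; t]; [:: s; t; 0]] a) b.

Definition skew3 (z1 z2 z3 : C) (a b : 'I_3) : C :=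
  nth 0 (nth [::] [:: [:: 0; z1; z2]; [:: - z1; 0; z3]; [:: - z2; - z3; 0]] a) b.

Lemma coef3_positive r s t : 0 < r -> 0 < s -> 0 < t -> positive_coef (coef3 r s t).
Proof.
move=> r0 s0 t0; split.
- by apply: ord3P.
- by apply: ord3P; apply: ord3P.
- by apply: ord3P; apply: ord3P.
Qed.

Lemma coef3E c : positive_coef c -> c = coef3 (c 0 1) (c 0 2%:R) (c 1 2%:R).
Proof.
move=> [c0 cC _]; apply/funext => a; apply/funext => b.
by move: a b; apply: ord3P; apply: ord3P; rewrite ?c0 // cC.
Qed.

Lemma skew3_acs z1 z2 z3 :
  (forall z, z \in [:: z1; z2; z3] -> z * z = -1 /\ z^* = - z) ->
  acs_coef (skew3 z1 z2 z3).
Proof.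
move=> H.
have [s1 c1] : z1 * z1 = -1 /\ z1^* = - z1 by apply: H; rewrite !inE eqxx.
have [s2 c2] : z2 * z2 = -1 /\ z2^* = - z2 by apply: H; rewrite !inE eqxx orbT.
have [s3 c3] : z3 * z3 = -1 /\ z3^* = - z3 by apply: H; rewrite !inE eqxx !orbT.
split.
- by apply: ord3P.
- by apply: ord3P; apply: ord3P => //= _; rewrite /skew3 /= ?mulrNN.
- by apply: ord3P; apply: ord3P; rewrite /skew3 /= ?opprK ?oppr0.
- by apply: ord3P; apply: ord3P; rewrite /skew3 /= ?rmorphN /= ?c1 ?c2 ?c3 ?opprK ?rmorph0 //; exact: conjC0.
Qed.

Section Classify.
Variables (c : 'I_3 -> 'I_3 -> R) (cP : positive_coef c).
Variables (e : 'I_3 -> 'I_3 -> C) (he : acs_coef e).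
Let cA := admissible_coC cP.

Lemma conn_coefE a b k :
  conn_coef (coC c) a b k = ((c a b + c b k - c a k) / (2%:R * c a b))%:C%C.
Proof. by rewrite /conn_coef /coC -rmorphD -rmorphB fmorph_div rmorphM /= rmorph_nat. Qed.

Lemma conn_coef_eq0 a b k : a != b -> (conn_coef (coC c) a b k == 0) = (c a b + c b k == c a k).
Proof.
move=> ab; have [_ _ cp] := cP; rewrite conn_coefE fmorph_eq0 mulf_eq0 subr_eq0 invr_eq0.
by rewrite mulf_eq0 pnatr_eq0 /= (gt_eqF (cp _ _ ab)) orbF.
Qed.

Lemma lam_mul_eq0 a b k z : a != b ->
  conn_coef (coC c) a b k * z = 0 <-> (z = 0 \/ c a b + c b k = c a k).
Proof.
move=> ab; split=> [/eqP|].
  by rewrite mulf_eq0 conn_coef_eq0 // => /orP[/eqP ->|/eqP ->]; [right|left].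
by move=> [->|/eqP]; [rewrite mulr0|rewrite -conn_coef_eq0 // => /eqP ->; rewrite mul0r].
Qed.

(** Exchanging a and k fixes c_ab + c_bk - c_ak and changes the sign of e_kb - e_ab, so the six
    conditions depend on b only; b = 1, 2, 0 give the three clauses in this order. *)
Lemma parallel_cond3 : parallel_cond c e <->
  [/\ e 0 1 + e 1 2%:R = 0 \/ c 0 1 + c 1 2%:R = c 0 2%:R,
      e 1 2%:R = e 0 2%:R \/ c 0 2%:R + c 1 2%:R = c 0 1 &
      e 0 1 = e 0 2%:R \/ c 0 1 + c 0 2%:R = c 1 2%:R].
Proof.
have [_ cC _] := cP; have [_ _ eN _] := he.
split=> [H|[H1 H2 H3]].
  split.
  - have /lam_mul_eq0 := H 0 1 2%:R isT isT isT; move=> /(_ isT).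
    rewrite (eN 1 2%:R) => -[/eqP|]; last by right.
    by rewrite -opprD oppr_eq0 addrC => /eqP; left.
  - have /lam_mul_eq0 := H 0 2%:R 1 isT isT isT; move=> /(_ isT).
    rewrite (cC 2%:R 1) => -[/eqP|]; last by right.
    by rewrite subr_eq0 => /eqP; left.
  - have /lam_mul_eq0 := H 1 0 2%:R isT isT isT; move=> /(_ isT).
    rewrite (cC 1 0) (eN 0 1) (eN 0 2%:R) => -[/eqP|]; last by right.
    by rewrite opprK addrC subr_eq0 => /eqP; left.
apply: ord3P; apply: ord3P; apply: ord3P => // _ _ _; apply/lam_mul_eq0 => //.
- move: H1 => [H1|]; last by right.
  by left; rewrite (eN 1 2%:R) -opprD addrC H1 oppr0.
- move: H2 => [->|]; first by left; rewrite subrr.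
  by rewrite (cC 2%:R 1); right.
- move: H3 => [H3|]; first by left; rewrite (eN 0 2%:R) (eN 0 1) H3 subrr.
  by rewrite (cC 1 0); right.
- move: H2 => [->|]; first by left; rewrite subrr.
  by rewrite (cC 2%:R 0) (cC 1 0) addrC; right.
- move: H3 => [H3|]; first by left; rewrite (eN 0 2%:R) (eN 0 1) H3 subrr.
  by rewrite (cC 2%:R 0) (cC 2%:R 1) addrC; right.
- move: H1 => [H1|H1]; first by left; rewrite (eN 1 2%:R) opprK H1.
  by right; rewrite (cC 2%:R 1) (cC 1 0) (cC 2%:R 0) addrC.
Qed.

Lemma acs_signs a b a' b' : a != b -> a' != b' -> e a b = e a' b' \/ e a b = - e a' b'.
Proof.
move=> ab ab'; have [_ e1 _ _] := he.
have /eqP : e a b ^+ 2 = e a' b' ^+ 2 by rewrite !expr2 !e1.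
by rewrite eqf_sqr => /orP[/eqP|/eqP]; [left|right].
Qed.

Lemma acs_neq0 a b : a != b -> e a b != 0.
Proof.
move=> ab; have [_ e1 _ _] := he; apply/eqP => E.
have := e1 _ _ ab; rewrite E mul0r => /esym/eqP; rewrite oppr_eq0.
by rewrite oner_eq0.
Qed.

Lemma acs_neqN a b : a != b -> e a b <> - e a b.
Proof.
move=> ab /eqP; rewrite -addr_eq0 -mulr2n mulrn_eq0 /=.
by rewrite (negbTE (acs_neq0 ab)).
Qed.

(** The three left alternatives are incompatible, as they would give e_01 = e_02 = e_12 = - e_01; so
    some right alternative holds. *)
Lemma kahler_coef : parallel_cond c e ->
  [\/ c 0 1 = c 0 2%:R + c 1 2%:R, c 0 2%:R = c 0 1 + c 1 2%:R | c 1 2%:R = c 0 1 + c 0 2%:R].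
Proof.
move=> /parallel_cond3 [H1 H2 H3].
have n01 := acs_neqN (isT : (0 : 'I_3) != 1).
have [E12|E12] := acs_signs (isT : (1 : 'I_3) != 2%:R) (isT : (0 : 'I_3) != 1).
  move: H1 => [|<-]; last by constructor 2.
  by rewrite E12 => /eqP; rewrite addr_eq0 => /eqP.
have [E02|E02] := acs_signs (isT : (0 : 'I_3) != 2%:R) (isT : (0 : 'I_3) != 1).
  move: H2 => [|<-]; last by constructor 1.
  by rewrite E12 E02 => /esym.
move: H3 => [|<-]; last by constructor 3.
by rewrite E02.
Qed.

(** Every e_ab is e_01 up to sign, so the differences are real multiples of e_01; dividing by it
    leaves a real linear relation between the metric coefficients. *)
Lemma nearly_cond_real a b k (p q : R) : a != b -> a != k -> b != k -> nearly_cond c e ->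
  e k b - e a b = p%:C%C * e 0 1 -> e a k - e a b = q%:C%C * e 0 1 ->
  (c a b + c b k - c a k) * p = (c a b + c a k - c b k) * q.
Proof.
move=> ab ak bk /(_ a b k ab ak bk) H E1 E2; have [_ cC cp] := cP.
move: H; rewrite E1 E2 !conn_coefE !mulrA => /(mulIf (acs_neq0 (isT : (0 : 'I_3) != 1))).
rewrite -!rmorphM => /complexI; rewrite (cC b a) => H.
have cab : c a b != 0 by rewrite gt_eqF // cp.
apply: (mulIf (x := (2%:R * c a b)^-1)).
  by rewrite invr_eq0 mulf_eq0 pnatr_eq0.
by rewrite mulrAC H mulrAC.
Qed.

Lemma nearly_kahler_coef : nearly_cond c e -> ~ parallel_cond c e ->
  c 0 1 = c 0 2%:R /\ c 0 1 = c 1 2%:R.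
Proof.
move=> H nP; have [_ cC _] := cP; have [_ _ eN _] := he.
have h1 p q := @nearly_cond_real 0 1 2%:R p q isT isT isT H.
have h2 p q := @nearly_cond_real 0 2%:R 1 p q isT isT isT H.
have [E12|E12] := acs_signs (isT : (1 : 'I_3) != 2%:R) (isT : (0 : 'I_3) != 1);
have [E02|E02] := acs_signs (isT : (0 : 'I_3) != 2%:R) (isT : (0 : 'I_3) != 1).
(* Here, as in the third and fourth cases, the signs give two clauses of [parallel_cond3], and near
   parallelism gives the remaining one as a relation among the c, contradicting [nP]. *)
- exfalso; apply: nP; apply/parallel_cond3; rewrite E12 E02; split; try by left.
  right; have := h1 (- 2) 0.
  rewrite (eN 1 2%:R) E12 E02 subrr rmorph0 mul0r rmorphN rmorph_nat.
  have -> : - e 0 1 - e 0 1 = - 2%:R * e 0 1 by ring.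
  by move=> /(_ erefl erefl); lra.
(* The case e_01 = e_12 = e_20: the two relations read c_02 = c_12 and c_01 = c_12. *)
- have := h1 (- 2) (- 2).
  rewrite (eN 1 2%:R) E12 E02 rmorphN rmorph_nat.
  have -> : - e 0 1 - e 0 1 = - 2%:R * e 0 1 by ring.
  move=> /(_ erefl erefl) K1; have := h2 2 2.
  rewrite E12 E02 opprK rmorph_nat (cC 2%:R 1).
  have -> : e 0 1 + e 0 1 = 2%:R * e 0 1 by ring.
  by move=> /(_ erefl erefl) K2; lra.
- exfalso; apply: nP; apply/parallel_cond3; rewrite E12 E02; split; try by left; rewrite ?addrN.
  right; have := h2 (- 2) 0.
  rewrite E12 E02 subrr rmorph0 mul0r rmorphN rmorph_nat (cC 2%:R 1).
  have -> : - e 0 1 - e 0 1 = - 2%:R * e 0 1 by ring.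
  by move=> /(_ erefl erefl); lra.
- exfalso; apply: nP; apply/parallel_cond3; rewrite E12 E02; split; try by left; rewrite ?addrN.
  right; have := h1 0 (- 2).
  rewrite (eN 1 2%:R) E12 E02 opprK subrr rmorph0 mul0r rmorphN rmorph_nat.
  have -> : - e 0 1 - e 0 1 = - 2%:R * e 0 1 by ring.
  by move=> /(_ erefl erefl); lra.
Qed.

End Classify.
End Coefficients.

(** * Transfer to arbitrary representatives and connections *)

Section Transfer.
Context {R : realType}.
Local Notation C := (complex R).
Local Notation flag_space := (@flag_space R).
Local Notation flags := (@flags R).
Implicit Types (x v w : flag_space) (u A : 'M[C]_3).

(** Curves in the flags cannot be added, but the skew-Hermitian matrices [hat x v] and [hat x w]
    can. *)
Lemma tangent_linear x a v w : tangent flags x v -> tangent flags x w ->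
  tangent flags x (a *: v + w).
Proof.
move=> tv tw; have [As Bs] := (hat_adj tv, hat_adj tw).
rewrite -(fund_hat tv) -(fund_hat tw) -fundZ -fundD.
apply: (fund_tangent (tangent_mem tv)).
by rewrite adjD adjZ As Bs scalerN -opprD (coC_real (fun _ _ => a) 0 0).
Qed.

Lemma tangentB x v w : tangent flags x v -> tangent flags x w -> tangent flags x (v - w).
Proof. by move=> tv tw; rewrite addrC -scaleN1r; apply: tangent_linear. Qed.

Lemma field_sub X Y : vector_field flags X -> vector_field flags Y ->
  vector_field flags (fun y => X y - Y y).
Proof.
move=> [[F sF FX] tX] [[G sG GY] tY]; split=> [|x Fx]; last first.
  by apply: tangentB; [exact: tX|exact: tY].
have s1 : smooth (fun y => (-1) *: G y).
  exact (smooth_scale findim_flag_space (@smooth_cst _ _ _ (-1 : R)) sG).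
exists (fun y => F y + (-1) *: G y); first exact: smoothD sF s1.
by move=> y Fy; rewrite (FX _ Fy) (GY _ Fy) scaleN1r.
Qed.

Section Ext.
Variables (g h : flag_tensor R) (gh : eq_tensor2 flags g h).

Lemma riemannian_metric_ext : riemannian_metric flags g -> riemannian_metric flags h.
Proof.
move=> [gl gs gp gsm]; split.
- move=> x a u v w Fx tu tv tw; rewrite -!gh //; last exact: tangent_linear.
  exact: gl.
- by move=> x v w Fx tv tw; rewrite -!gh //; apply: gs.
- by move=> x v Fx tv v0; rewrite -gh //; apply: gp.
- move=> X Y vX vY; apply: smooth_on_ext (gsm X Y vX vY) => y Fy.
  by apply: gh => //; [exact: (proj2 vX)|exact: (proj2 vY)].
Qed.

Lemma homogeneous_metric_ext : homogeneous_metric g -> homogeneous_metric h.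
Proof.
move=> [gm gi]; split; first exact: riemannian_metric_ext.
move=> u uu x v w Fx tv tw; have := gi u uu x v w Fx tv tw.
rewrite (diff_on_act _ tv) (diff_on_act _ tw) -(gh Fx tv tw) => <-.
by rewrite (gh (flags_act uu Fx)) //; apply: tangent_act.
Qed.

Lemma levi_civita_ext D : riemannian_metric flags g ->
  levi_civita flags g D -> levi_civita flags h D.
Proof.
move=> gm [Da mx_derive Dt]; split=> // X Y Z vX vY vZ x Fx.
have tXx := proj2 vX _ Fx; have tYx := proj2 vY _ Fx; have tZx := proj2 vZ _ Fx.
have tDY := proj2 (conn_field Da vX vY) _ Fx; have tDZ := proj2 (conn_field Da vX vZ) _ Fx.
rewrite -(gh Fx tDY tZx) -(gh Fx tYx tDZ) -(mx_derive X Y Z vX vY vZ _ Fx).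
apply/esym; apply: diff_on_ext => //.
  by move=> y Fy; apply: gh => //; [exact: (proj2 vY)|exact: (proj2 vZ)].
exact: metric_smooth gm _ _ vY vZ.
Qed.

Lemma compatible_ext J : almost_complex flags J -> compatible flags g J -> compatible flags h J.
Proof.
move=> [Jt _ _ _] gJ x v w Fx tv tw; rewrite -(gh Fx tv tw) -gJ //.
by apply/esym; apply: gh => //; apply: Jt.
Qed.

Lemma homogeneous_kahler_ext : homogeneous_kahler g -> homogeneous_kahler h.
Proof.
move=> [gm [J [D [Ja Ji gJ gD P]]]]; split; first exact: homogeneous_metric_ext.
exists J, D; split=> //; first exact: compatible_ext.
exact: levi_civita_ext (proj1 gm) gD.
Qed.

Lemma homogeneous_strict_nearly_kahler_ext :
  homogeneous_strict_nearly_kahler g -> homogeneous_strict_nearly_kahler h.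
Proof.
move=> [gm [J [D [Ja Ji gJ gD P]]]]; split; first exact: homogeneous_metric_ext.
exists J, D; split=> //; first exact: compatible_ext.
exact: levi_civita_ext (proj1 gm) gD.
Qed.

End Ext.

(** The difference S of the connections is symmetric in its arguments, both being torsion-free, and
    g (S X Y) Z is skew in Y and Z by metric compatibility; going around the three arguments, these
    two symmetries force it to vanish. *)
Lemma levi_civita_unique (g : flag_tensor R) D D' : riemannian_metric flags g ->
  levi_civita flags g D -> levi_civita flags g D' ->
  forall X Y, vector_field flags X -> vector_field flags Y ->
  forall x, flags x -> D X Y x = D' X Y x.
Proof.
move=> [gl gs gp _] [Da mx_derive Dt] [Da' Dm' Dt'] X0 Y0 vX0 vY0 x Fx.
have gB (u v w : flag_space) : tangent flags x u -> tangent flags x v -> tangent flags x w ->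
    g x (u - v) w = g x u w - g x v w.
  move=> tu tv tw; rewrite addrC -scaleN1r gl // mulN1r addrC //.
pose S X Y y := D X Y y - D' X Y y.
have vS X Y : vector_field flags X -> vector_field flags Y -> vector_field flags (S X Y).
  by move=> vX vY; exact (field_sub (conn_field Da vX vY) (conn_field Da' vX vY)).
have sym X Y : vector_field flags X -> vector_field flags Y -> S X Y x = S Y X x.
  move=> vX vY; rewrite /S; have := Dt X Y vX vY x Fx; rewrite -(Dt' X Y vX vY x Fx).
  move=> /eqP; rewrite subr_eq => /eqP ->.
  by rewrite addrAC [D' X Y x - _]addrC addrK addrC.
have skew X Y Z : vector_field flags X -> vector_field flags Y -> vector_field flags Z ->
    g x (S X Y x) (Z x) = - g x (S X Z x) (Y x).
  move=> vX vY vZ; have := mx_derive X Y Z vX vY vZ x Fx; rewrite (Dm' X Y Z vX vY vZ x Fx).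
  have tY := proj2 vY _ Fx; have tZ := proj2 vZ _ Fx.
  have tDY := proj2 (conn_field Da vX vY) _ Fx; have tDZ := proj2 (conn_field Da vX vZ) _ Fx.
  have tDY' := proj2 (conn_field Da' vX vY) _ Fx; have tDZ' := proj2 (conn_field Da' vX vZ) _ Fx.
  rewrite (gs _ _ _ Fx tY tDZ) (gs _ _ _ Fx tY tDZ').
  rewrite /S (gB _ _ _ tDY tDY' tZ) (gB _ _ _ tDZ tDZ' tY); lra.
have T0 X Y Z : vector_field flags X -> vector_field flags Y -> vector_field flags Z ->
    g x (S X Y x) (Z x) = 0.
  move=> vX vY vZ.
  have E1 := skew X Y Z vX vY vZ; rewrite (sym X Z) // in E1.
  have E2 := skew Z X Y vZ vX vY; rewrite (sym Z Y) // in E2.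
  have E3 := skew Y Z X vY vZ vX; rewrite (sym Y X) // in E3.
  lra.
(* Positivity is applied with S X0 Y0 as third field, which is possible since S takes fields to
   fields. *)
apply: subr0_eq; apply: contrapT => /eqP S0.
have tS := proj2 (vS X0 Y0 vX0 vY0) _ Fx.
by have := gp x _ Fx tS S0; rewrite (T0 _ _ _ vX0 vY0 (vS _ _ vX0 vY0)) ltxx.
Qed.

Lemma nablaJ_ext (g : flag_tensor R) D D' J J' : riemannian_metric flags g ->
  levi_civita flags g D -> levi_civita flags g D' ->
  almost_complex flags J -> almost_complex flags J' ->
  (forall x v, tangent flags x v -> J x v = J' x v) ->
  forall X Y, vector_field flags X -> vector_field flags Y ->
  forall x, flags x -> nablaJ D J X Y x = nablaJ D' J' X Y x.
Proof.
move=> gm gD gD' Ja Ja' JJ X Y vX vY x Fx.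
have Da := lc_connection gD; have Da' := lc_connection gD'.
rewrite /nablaJ; congr (_ - _).
  rewrite (levi_civita_unique gm gD gD' vX (acs_smooth Ja vY) Fx).
  apply: (conn_ext Da') => //; [exact: acs_smooth|exact: acs_smooth|].
  by move=> y Fy; apply: JJ; apply: (proj2 vY).
rewrite -(levi_civita_unique gm gD gD' vX vY Fx); apply: JJ.
exact: (proj2 (conn_field Da vX vY)).
Qed.

Section FromCoef.
Variables (c : 'I_3 -> 'I_3 -> R) (cP : positive_coef c).
Variables (e : 'I_3 -> 'I_3 -> C) (he : acs_coef e).

Lemma kahler_of_coef : parallel_cond c e -> homogeneous_kahler (fun _ => form c).
Proof.
move=> H; split; first exact: form_homogeneous.
exists (endo e), (conn c); split.
- exact: endo_acs.
- exact: endo_invariant.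
- exact: endo_compatible.
- exact: conn_levi_civita.
- exact/parallelP.
Qed.

Lemma nearly_kahler_of_coef : nearly_cond c e -> ~ parallel_cond c e ->
  homogeneous_strict_nearly_kahler (fun _ => form c).
Proof.
move=> H H'; split; first exact: form_homogeneous.
exists (endo e), (conn c); split.
- exact: endo_acs.
- exact: endo_invariant.
- exact: endo_compatible.
- exact: conn_levi_civita.
- by split; [exact/nearly_parallelP|move/(parallelP cP he)].
Qed.

Section ToCoef.
Variables (g : flag_tensor R) (J : flag_space -> flag_space -> flag_space).
Variable D : (flag_space -> flag_space) -> (flag_space -> flag_space) -> flag_space -> flag_space.
Hypotheses (gm : riemannian_metric flags g) (gc : eq_tensor2 flags g (fun _ => form c)).
Hypotheses (gD : levi_civita flags g D) (Ja : almost_complex flags J).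
Hypothesis JE : forall x v, tangent flags x v -> J x v = endo e x v.

Let nablaE X Y x : vector_field flags X -> vector_field flags Y -> flags x ->
  nablaJ D J X Y x = nablaJ (conn c) (endo e) X Y x.
Proof.
move=> vX vY Fx.
exact (@nablaJ_ext (fun _ => form c) D (conn c) J (endo e) (form_metric cP)
  (levi_civita_ext gc gm gD) (conn_levi_civita cP) Ja (endo_acs he) JE X Y vX vY x Fx).
Qed.

Lemma parallel_coef : parallel flags D J <-> parallel_cond c e.
Proof.
apply: iff_trans (parallelP cP he); split=> H X Y vX vY x Fx.
  by rewrite -nablaE //; apply: H.
by rewrite nablaE //; apply: H.
Qed.

Lemma nearly_parallel_coef : nearly_parallel flags D J <-> nearly_cond c e.
Proof.
apply: iff_trans (nearly_parallelP cP he); split=> H X Y vX vY x Fx.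
  by rewrite -!nablaE //; apply: H.
by rewrite !nablaE //; apply: H.
Qed.
End ToCoef.
End FromCoef.
End Transfer.

(** * Invariant tensors are determined by the isotropy representation *)

Section Invariant.
Context {R : realType}.
Local Notation C := (complex R).
Local Notation flag_space := (@flag_space R).
Local Notation flags := (@flags R).
Implicit Types (x v : flag_space) (u A : 'M[C]_3).
Implicit Types (z w : C).
Local Notation b := (@base_flag R).

Lemma rootZ a k (r : R) z : root a k (r%:C%C * z) = r%:C%C *: root a k z.
Proof.
by rewrite !rootU rmorphM /= (coC_real (fun _ _ => r) 0 0) scalerBr !scalerA.
Qed.

Lemma co1 (A : 'M[C]_3) : co 1%:M A = A.
Proof. by rewrite coE adj1 mul1mx mulmx1. Qed.

Lemma flags_base : flags b.
Proof. exact: is_frame_flags (@is_frame_base R). Qed.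

Lemma eq_fund_base A B : fund A b = fund B b <-> (forall i j, i != j -> A i j = B i j).
Proof.
apply: (iff_trans (eq_fund _ _ (@is_frame_base R))).
by split=> E i j ij; have := E i j ij; rewrite !co1.
Qed.

Lemma fund_roots A : A^t* = - A ->
  fund A b = fund (root 0 1 (A 0 1)) b + fund (root 0 2%:R (A 0 2%:R)) b
           + fund (root 1 2%:R (A 1 2%:R)) b.
Proof.
move=> As; rewrite -!fundD; apply/eq_fund_base => i j ij.
by rewrite skew_roots.
Qed.

Lemma act_diagf_base d : (forall i, d i * (d i)^* = 1) -> act (diagf d) b = b.
Proof.
move=> d1; apply: pr_inj => k; rewrite (pr_act _ _ (diagf_unitary d1)) pr_base.
exact: diagf_base.
Qed.

Lemma act_diagf_root d a k z : (forall i, d i * (d i)^* = 1) ->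
  act (diagf d) (fund (root a k z) b) = fund (root a k (d a * z * (d k)^*)) b.
Proof.
move=> d1; rewrite (act_fund _ _ (diagf_unitary d1)) (act_diagf_base d1).
by rewrite diagf_root.
Qed.

Lemma tangent_root a k z : tangent flags b (fund (root a k z) b).
Proof. exact: fund_tangent flags_base (root_adj a k z). Qed.

(** Diagonal of a torus element that negates the isotropy summands involving p and fixes the other
    one. The [phase] below, taken with w = i, rotates a summand by a right angle. *)
Definition flip (p i : 'I_3) : C := if i == p then -1 else 1.

Lemma flip1 p i : flip p i * (flip p i)^* = 1.
Proof. by rewrite /flip; case: eqP; rewrite ?rmorphN rmorph1 ?mulrNN mulr1. Qed.

Definition phase (p : 'I_3) (w : C) (i : 'I_3) : C := if i == p then w else 1.

Lemma phase1 p w i : w * w^* = 1 -> phase p w i * (phase p w i)^* = 1.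
Proof. by move=> w1; rewrite /phase; case: eqP; rewrite ?w1 // rmorph1 mulr1. Qed.

Lemma complex_ReIm (z : C) : z = (complex.Re z)%:C%C * 1 + (complex.Im z)%:C%C * 'i.
Proof.
by rewrite mulr1 -complexiE; case: z => x y; apply/eqP; rewrite eq_complex /= !(mul0r, mulr0, mulr1, addr0, add0r, subr0) !eqxx.
Qed.

Lemma root_ReIm a k z : fund (root a k z) b =
  complex.Re z *: fund (root a k 1) b + complex.Im z *: fund (root a k 'i) b.
Proof. by rewrite {1}(complex_ReIm z) rootD !rootZ fundD !fundZ. Qed.

Lemma form_coef3 r s t x u A B : 0 < r -> 0 < s -> 0 < t -> is_frame x u ->
  A^t* = - A -> B^t* = - B ->
  form (coef3 r s t) (fund A x) (fund B x) =
    r * complex.Re (co u A 0 1 * (co u B 0 1)^*)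
  + s * complex.Re (co u A 0 2%:R * (co u B 0 2%:R)^*)
  + t * complex.Re (co u A 1 2%:R * (co u B 1 2%:R)^*).
Proof.
move=> r0 s0 t0 fx As Bs; rewrite (form_co (coef3_positive r0 s0 t0) _ fx Bs).
have As' : (co u A)^t* = - co u A by rewrite -co_adj As coN.
have Bs' : (co u B)^t* = - co u B by rewrite -co_adj Bs coN.
rewrite !big_ord_recr !big_ord0 /= /coC /coef3 /=.
have i0 (H : (0 < 3)%N) : widen_ord (leqnSn 2) (widen_ord (leqnSn 1) (ord_max : 'I_1)) = 0 :> 'I_3 by apply: val_inj.
have i1 : widen_ord (leqnSn 2) (ord_max : 'I_2) = 1 :> 'I_3 by apply: val_inj.
have i2 : (ord_max : 'I_3) = 2%:R by apply: val_inj.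
rewrite i0 // i1 i2 /=.
rewrite (skew_entry 0 1 As') (skew_entry 0 2%:R As') (skew_entry 1 2%:R As').
rewrite (skew_entry 0 1 Bs') (skew_entry 0 2%:R Bs') (skew_entry 1 2%:R Bs').
have ReD z w : complex.Re (z + w) = complex.Re z + complex.Re w by case: z; case: w.
have ReZ (a : R) z : complex.Re (a%:C%C * z) = a * complex.Re z.
  by case: z => p q /=; rewrite mul0r subr0.
have ReJ z w : complex.Re (- z^* * (- w^*)^*) = complex.Re (z * w^*).
  by case: z => p q; case: w => p' q' /=; ring.
by rewrite !ReD !ReZ !ReJ /= !mul0r; field.
Qed.

Section Metric.
Variables (g : flag_tensor R) (gH : homogeneous_metric g).
Let gm := proj1 gH.

Let h A B := g b (fund A b) (fund B b).

Let gDl (u v w : flag_space) : tangent flags b u -> tangent flags b v -> tangent flags b w ->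
  g b (u + v) w = g b u w + g b v w.
Proof.
move=> tu tv tw; have := metric_linear gm 1 flags_base tu tv tw.
by rewrite scale1r mul1r.
Qed.

Let gDr (u v w : flag_space) : tangent flags b u -> tangent flags b v -> tangent flags b w ->
  g b w (u + v) = g b w u + g b w v.
Proof.
move=> tu tv tw; have tuv : tangent flags b (u + v).
  by have := tangent_linear 1 tu tv; rewrite scale1r.
rewrite (metric_sym gm flags_base tw tuv) gDl //.
by rewrite (metric_sym gm flags_base tu tw) (metric_sym gm flags_base tv tw).
Qed.

Let tangent0 : tangent flags b 0.
Proof. by rewrite -(fund0 b); apply: fund_tangent flags_base _; rewrite linear0 map_mx0 oppr0. Qed.

Let gZl (r : R) (u w : flag_space) : tangent flags b u -> tangent flags b w ->
  g b (r *: u) w = r * g b u w.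
Proof.
move=> tu tw; have := metric_linear gm r flags_base tu tangent0 tw.
have -> : g b 0 w = 0.
  by have := gDl tangent0 tangent0 tw; rewrite addr0; lra.
by rewrite !addr0.
Qed.

Let gZr (r : R) (u w : flag_space) : tangent flags b u -> tangent flags b w ->
  g b w (r *: u) = r * g b w u.
Proof.
move=> tu tw; have tru : tangent flags b (r *: u).
  by have := tangent_linear r tu tangent0; rewrite addr0.
by rewrite (metric_sym gm flags_base tw tru) gZl // (metric_sym gm flags_base tu tw).
Qed.

Let g_act u (v w : flag_space) : u \is unitarymx -> act u b = b -> tangent flags b v -> tangent flags b w ->
  g b (act u v) (act u w) = g b v w.
Proof.
move=> uu ub tv tw; have := proj2 gH u uu b v w flags_base tv tw.
by rewrite (diff_on_act _ tv) (diff_on_act _ tw) ub.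
Qed.

Let h_dg d a k z a' k' z' : (forall i, d i * (d i)^* = 1) ->
  h (root a k (d a * z * (d k)^*)) (root a' k' (d a' * z' * (d k')^*)) =
  h (root a k z) (root a' k' z').
Proof.
move=> d1; rewrite /h -!act_diagf_root //; apply: g_act; try exact: tangent_root.
  exact: diagf_unitary.
exact: act_diagf_base.
Qed.

Let rootN a k z : fund (root a k (- z)) b = - fund (root a k z) b.
Proof. by rewrite -fundN; congr fund; rewrite !rootU rmorphN /= !scaleNr opprD. Qed.

Let h_Nl a k z B : B^t* = - B -> h (root a k (- z)) B = - h (root a k z) B.
Proof.
move=> Bs; rewrite /h rootN -scaleN1r gZl ?mulN1r //; first exact: tangent_root.
exact: fund_tangent flags_base Bs.
Qed.

(** The torus element with -1 at place a negates the first vector and fixes the second, so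
    invariance makes the pairing its own opposite. *)
Let h_cross a k z a' k' z' : a != k -> a' != a -> k' != a -> h (root a k z) (root a' k' z') = 0.
Proof.
move=> ak a'a k'a; have := @h_dg (flip a) a k z a' k' z' (flip1 a).
rewrite /flip eqxx eq_sym (negbTE ak) (negbTE a'a) (negbTE k'a) rmorph1 !mulr1 mul1r mulN1r.
rewrite h_Nl ?root_adj //; lra.
Qed.

Let h_cross' a k z a' k' z' : a != k -> a' != k -> k' != k -> h (root a k z) (root a' k' z') = 0.
Proof.
move=> ak a'k k'k; have := @h_dg (flip k) a k z a' k' z' (flip1 k).
rewrite /flip eqxx (negbTE ak) (negbTE a'k) (negbTE k'k) rmorph1 !mulr1 !mul1r.
rewrite rmorphN rmorph1 mulrN1 h_Nl ?root_adj //; lra.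
Qed.

Let h_same a k z w : a != k -> h (root a k z) (root a k w) =
  h (root a k 1) (root a k 1) * complex.Re (z * w^*).
Proof.
move=> ak.
have tr y := @tangent_root a k y.
(* The torus element with i at place a makes multiplication by i an isometry of the summand; hence 1
   and i have equal length and are orthogonal. *)
have Hi y y' : h (root a k ('i * y)) (root a k ('i * y')) = h (root a k y) (root a k y').
  have i1 : 'i * ('i)^* = 1 :> C by rewrite conjCi mulrN -expr2 sqrCi opprK.
  have := @h_dg (phase a 'i) a k y a k y' (fun i => phase1 a i i1).
  by rewrite /phase eqxx eq_sym (negbTE ak) rmorph1 !mulr1.
have E1 := Hi 1 1; have E2 := Hi 1 'i.
rewrite mulr1 -expr2 sqrCi in E1 E2.
rewrite /h in E1 E2.
rewrite rootN -scaleN1r gZr // mulN1r in E2.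
rewrite {1}/h /h root_ReIm (root_ReIm _ _ w).
have tl (p q : R) y y' : tangent flags b (p *: fund (root a k y) b + q *: fund (root a k y') b).
  by apply: tangent_linear => //; have := tangent_linear q (tr y') tangent0; rewrite addr0.
have tz (q : R) y : tangent flags b (q *: fund (root a k y) b).
  by have := tangent_linear q (tr y) tangent0; rewrite addr0.
rewrite (gDl (tz _ _) (tz _ _) (tl _ _ _ _)).
rewrite (gDr (tz _ _) (tz _ _) (tz _ _)) (gDr (tz _ _) (tz _ _) (tz _ _)).
rewrite !(gZl _ (tr _) (tz _ _)) !(gZr _ (tr _) (tr _)).
have S := metric_sym gm flags_base (tr 'i) (tr 1).
have G0 : g b (fund (root a k 1) b) (fund (root a k 'i) b) = 0 by lra.
rewrite S G0 E1.
have -> : complex.Re (z * w^*) = complex.Re z * complex.Re w + complex.Im z * complex.Im w.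
  by case: z => p q; case: w => p' q' /=; ring.
by ring.
Qed.

Let h_pos a k : a != k -> 0 < h (root a k 1) (root a k 1).
Proof.
move=> ak; apply: (metric_pos gm flags_base (tangent_root a k 1)).
apply/eqP; rewrite -(fund0 b) => /eq_fund_base/(_ a k ak).
rewrite rootE !eqxx (negbTE ak) /= mulr1 mulr0 subr0 mxE => /eqP.
by rewrite oner_eq0.
Qed.

Lemma homogeneous_metric_coef : exists2 c, positive_coef c & eq_tensor2 flags g (fun _ => form c).
Proof.
pose r := h (root 0 1 1) (root 0 1 1).
pose s := h (root 0 2%:R 1) (root 0 2%:R 1).
pose t := h (root 1 2%:R 1) (root 1 2%:R 1).
have r0 : 0 < r by apply: h_pos.
have s0 : 0 < s by apply: h_pos.
have t0 : 0 < t by apply: h_pos.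
have cP := coef3_positive r0 s0 t0.
exists (coef3 r s t) => // x v w Fx tv tw.
have at_base A B : A^t* = - A -> B^t* = - B ->
    g b (fund A b) (fund B b) = form (coef3 r s t) (fund A b) (fund B b).
  move=> As Bs; rewrite (form_coef3 r0 s0 t0 (@is_frame_base R) As Bs) !co1.
  rewrite {1}(fund_roots As) {1}(fund_roots Bs).
  have tr a k z := @tangent_root a k z.
  have tD (p q : flag_space) : tangent flags b p -> tangent flags b q -> tangent flags b (p + q).
    by move=> tp tq; have := tangent_linear 1 tp tq; rewrite scale1r.
  have t3 z1 z2 z3 := tD _ _ (tD _ _ (tr 0 1 z1) (tr 0 2%:R z2)) (tr 1 2%:R z3).
  have t2 z1 z2 := tD _ _ (tr 0 1 z1) (tr 0 2%:R z2).
  rewrite (gDl (t2 _ _) (tr _ _ _) (t3 _ _ _)) (gDl (tr _ _ _) (tr _ _ _) (t3 _ _ _)).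
  rewrite !(gDr (t2 _ _) (tr _ _ _) (tr _ _ _)) !(gDr (tr _ _ _) (tr _ _ _) (tr _ _ _)).
  rewrite -!/(h _ _) (@h_same 0 1) // (@h_same 0 2%:R) // (@h_same 1 2%:R) //.
  rewrite (@h_cross' 0 1 _ 0 2%:R) // (@h_cross 0 1 _ 1 2%:R) //.
  rewrite (@h_cross' 0 2%:R _ 0 1) // (@h_cross 0 2%:R _ 1 2%:R) //.
  rewrite (@h_cross' 1 2%:R _ 0 1) // (@h_cross 1 2%:R _ 0 2%:R) //.
  by rewrite /r /s /t; ring.
(* Both tensors are invariant, so the comparison at x is carried back to the base flag by the
   inverse of [frame x]. *)
have [fu fE] := frameP Fx; set u := frame x in fu fE.
pose u' := u^t*; have u'u : u' \is unitarymx by rewrite trmxC_unitary.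
have uu' y : act u (act u' y) = y by rewrite actM (unitarymxP fu) act1.
have u'x : act u' x = b by rewrite -fE actM (unitarymxVP fu) act1.
have tv' : tangent flags b (act u' v) by rewrite -u'x; apply: tangent_act.
have tw' : tangent flags b (act u' w) by rewrite -u'x; apply: tangent_act.
have := proj2 gH u fu b _ _ flags_base tv' tw'.
rewrite (diff_on_act _ tv') (diff_on_act _ tw') fE !uu' => ->.
rewrite -(form_act _ v w u'u) -(fund_hat tv') -(fund_hat tw').
by apply: at_base; apply: hat_adj.
Qed.

End Metric.

End Invariant.

Section InvariantComplexStructure.
Context {R : realType}.
Local Notation C := (complex R).
Local Notation flag_space := (@flag_space R).
Local Notation flags := (@flags R).
Implicit Types (x v : flag_space) (u A : 'M[C]_3).
Implicit Types (z w : C).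
Local Notation b := (@base_flag R).

Lemma ord3_cover (a k p i : 'I_3) : a != k -> a != p -> k != p -> [\/ i = a, i = k | i = p].
Proof.
move: a k p i; apply: ord3P; apply: ord3P; apply: ord3P; apply: ord3P => // _ _ _;
  by [constructor 1|constructor 2|constructor 3].
Qed.

Lemma sqr_neg1_conj z : z * z = -1 -> z^* = - z.
Proof.
move=> zz; have : z ^+ 2 == 'i ^+ 2 by rewrite sqrCi expr2 zz.
rewrite eqf_sqr => /orP[/eqP ->|/eqP ->]; rewrite ?rmorphN /= conjCi //.
Qed.

Section ComplexStructure.
Variables (J : flag_space -> flag_space -> flag_space).
Hypotheses (Ja : almost_complex flags J) (Ji : invariant_acs J).

Let J_act u (v : flag_space) : u \is unitarymx -> act u b = b -> tangent flags b v ->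
  J b (act u v) = act u (J b v).
Proof.
move=> uu ub tv; have := Ji uu flags_base tv.
rewrite (diff_on_act _ tv) (diff_on_act _ (acs_tangent Ja flags_base tv)).
by rewrite ub.
Qed.

(** J commutes with the isotropy. Commuting with -1 at the third place p kills the entries in row
    and column p, so J preserves the summand; commuting with i at place a makes it complex linear
    there, hence multiplication by some w. *)
Let J_root a k p : a != k -> a != p -> k != p ->
  exists2 w, w * w = -1 & forall z, J b (fund (root a k z) b) = fund (root a k (w * z)) b.
Proof.
move=> ak ap kp; have tr z := @tangent_root R a k z.
have tJ := acs_tangent Ja flags_base (tr 1).
set K := hat b (J b (fund (root a k 1) b)).
have Ks : K^t* = - K := hat_adj tJ.
have JK : J b (fund (root a k 1) b) = fund K b by rewrite fund_hat.
set w := K a k.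
have d1 := @flip1 R p.
have Kflip : fund K b = fund (diagf (flip p) *m K *m (diagf (flip p))^t*) b.
  rewrite -{2}(act_diagf_base d1) -(act_fund _ _ (diagf_unitary d1)) -JK.
  rewrite -(J_act (diagf_unitary d1) (act_diagf_base d1) (tr 1)) (act_diagf_root _ _ _ d1).
  by rewrite /flip (negbTE ap) (negbTE kp) rmorph1 !mulr1.
have Kp i : i != p -> K i p = 0 /\ K p i = 0.
  move=> ip; have pi : p != i by rewrite eq_sym.
  have /eq_fund_base KE := Kflip.
  have := KE _ _ ip; rewrite diagf_conj /flip eqxx (negbTE ip) rmorphN rmorph1 mul1r mulrN1.
  have := KE _ _ pi; rewrite diagf_conj /flip eqxx (negbTE ip) rmorph1 mulr1 mulN1r.
  have neg (y : C) : y = - y -> y = 0.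
    by move=> /eqP; rewrite -addr_eq0 -mulr2n mulrn_eq0 /= => /eqP.
  by move=> /neg -> /neg ->.
have JKw : J b (fund (root a k 1) b) = fund (root a k w) b.
  rewrite JK; apply/eq_fund_base => i j; rewrite rootE.
  have [->|->|->] := ord3_cover i ak ap kp; have [->|->|->] := ord3_cover j ak ap kp;
    rewrite ?eqxx // => ij; rewrite ?(negbTE ij) ?(negbTE ak) ?(negbTE ap) ?(negbTE kp)
      ?[k == a]eq_sym ?[p == a]eq_sym ?[p == k]eq_sym ?(negbTE ak) ?(negbTE ap) ?(negbTE kp)
      /= ?mulr1 ?mulr0 ?subr0 ?sub0r ?oppr0 //.
  - by have [-> _] := Kp _ ap.
  - by rewrite (skew_entry _ _ Ks).
  - by have [-> _] := Kp _ kp.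
  - by have [_ ->] := Kp _ ap.
  - by have [_ ->] := Kp _ kp.
have JKi : J b (fund (root a k 'i) b) = fund (root a k (w * 'i)) b.
  have i1 : 'i * ('i)^* = 1 :> C by rewrite conjCi mulrN -expr2 sqrCi opprK.
  have d2 := fun i => phase1 a i i1.
  have dak z : act (diagf (phase a 'i)) (fund (root a k z) b) = fund (root a k ('i * z)) b.
    by rewrite (act_diagf_root _ _ _ d2) /phase eqxx [k == a]eq_sym (negbTE ak) rmorph1 mulr1.
  have := J_act (diagf_unitary d2) (act_diagf_base d2) (tr 1).
  by rewrite dak JKw dak mulr1 mulrC.
have Jz z : J b (fund (root a k z) b) = fund (root a k (w * z)) b.
  have t0 : tangent flags b 0.
    by rewrite -(fund0 b); apply: fund_tangent flags_base _; rewrite linear0 map_mx0 oppr0.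
  have J0 : J b 0 = 0.
    have := acs_linear Ja 1 flags_base t0 t0; rewrite !scale1r addr0 => /eqP.
    by rewrite -subr_eq subrr => /eqP.
  have JZ (r : R) (y : flag_space) : tangent flags b y -> J b (r *: y) = r *: J b y.
    by move=> ty; have := acs_linear Ja r flags_base ty t0; rewrite J0 !addr0.
  have tiz : tangent flags b (complex.Im z *: fund (root a k 'i) b).
    by have := tangent_linear (complex.Im z) (tr 'i) t0; rewrite addr0.
  rewrite (root_ReIm a k z) (acs_linear Ja _ flags_base (tr 1) tiz) (JZ _ _ (tr 'i)) JKw JKi.
  rewrite -!fundZ -fundD -!rootZ -rootD; congr (fund (root _ _ _) _).
  by rewrite {3}(complex_ReIm z); ring.
exists w => //.
have := acs_square Ja flags_base (tr 1).
rewrite !Jz mulr1 -fundN => /eq_fund_base/(_ a k ak).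
rewrite oppmxE !rootE !eqxx (negbTE ak) /= !mulr1 !mulr0 !subr0.
by [].
Qed.

Lemma invariant_acs_coef :
  exists2 e, acs_coef e & forall x v, tangent flags x v -> J x v = endo e x v.
Proof.
have [w1 s1 J1] := @J_root 0 1 2%:R isT isT isT.
have [w2 s2 J2] := @J_root 0 2%:R 1 isT isT isT.
have [w3 s3 J3] := @J_root 1 2%:R 0 isT isT isT.
have he : acs_coef (skew3 w1 w2 w3).
  apply: skew3_acs => z; rewrite !inE => /or3P[] /eqP -> ; split=> //; exact: sqr_neg1_conj.
exists (skew3 w1 w2 w3) => // x v tv.
have at_base A : A^t* = - A -> J b (fund A b) = endo (skew3 w1 w2 w3) b (fund A b).
  move=> As; rewrite (endo_fund he flags_base As).
  rewrite (fund_roots (blk_adj he flags_base As)) {1}(fund_roots As).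
  have tr a k z := @tangent_root R a k z.
  have tD (p q : flag_space) : tangent flags b p -> tangent flags b q -> tangent flags b (p + q).
    by move=> tp tq; have := tangent_linear 1 tp tq; rewrite scale1r.
  have JD (p q : flag_space) : tangent flags b p -> tangent flags b q -> J b (p + q) = J b p + J b q.
    by move=> tp tq; have := acs_linear Ja 1 flags_base tp tq; rewrite !scale1r.
  rewrite (JD _ _ (tD _ _ (tr _ _ _) (tr _ _ _)) (tr _ _ _)) (JD _ _ (tr _ _ _) (tr _ _ _)).
  rewrite J1 J2 J3.
  have E i j : blk (fun i : 'I_3 => pr i b) (skew3 w1 w2 w3) A i j = skew3 w1 w2 w3 i j * A i j.
    by have := co_blk_pr (skew3 w1 w2 w3) A i j (@is_frame_base R); rewrite !co1.
  by rewrite !E.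
have Fx := tangent_mem tv; have [fu fE] := frameP Fx; set u := frame x in fu fE.
pose u' := u^t*; have u'u : u' \is unitarymx by rewrite trmxC_unitary.
have uu' y : act u (act u' y) = y by rewrite actM (unitarymxP fu) act1.
have u'x : act u' x = b by rewrite -fE actM (unitarymxVP fu) act1.
have tv' : tangent flags b (act u' v) by rewrite -u'x; apply: tangent_act.
have := Ji fu flags_base tv'.
rewrite (diff_on_act _ tv') (diff_on_act _ (acs_tangent Ja flags_base tv')) fE uu' => ->.
have -> : J b (act u' v) = endo (skew3 w1 w2 w3) b (act u' v).
  by rewrite -(fund_hat tv'); apply: at_base; apply: hat_adj.
by rewrite -(endo_act _ _ _ fu) fE uu'.
Qed.
End ComplexStructure.

End InvariantComplexStructure.

(** * Kahler and nearly Kahler metrics *)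

Section Statements.
Context {R : realType}.
Local Notation C := (complex R).
Local Notation flag_space := (@flag_space R).
Local Notation flags := (@flags R).
Implicit Types (x v : flag_space) (u A : 'M[C]_3).
Implicit Types (z w : C).
Local Notation b := (@base_flag R).

Lemma kmx_adj (x y z : C) : (kmx x y z)^t* = - kmx x y z.
Proof.
apply/matrixP => i j; rewrite oppmxE !mxE; move: i j.
by apply: ord3P; apply: ord3P => /=; rewrite ?rmorphN /= ?conjCK ?opprK ?rmorph0 ?oppr0.
Qed.

Lemma kmxE (x y z : C) :
  [/\ kmx x y z 0 1 = x, kmx x y z 0 2%:R = y & kmx x y z 1 2%:R = z].
Proof. by split; rewrite mxE. Qed.

Lemma trace_form_kmx (x y z x' y' z' : C) :
  trace_form (kmx x y z) (kmx x' y' z') =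
  complex.Re (x * x'^*) + complex.Re (y * y'^*) + complex.Re (z * z'^*).
Proof.
rewrite /trace_form /mxtrace.
under eq_bigr do rewrite mxE.
under eq_bigr do under eq_bigr do rewrite !mxE.
rewrite !big_ord_recr !big_ord0 /=.
case: x y z x' y' z' => x1 x2 [y1 y2] [z1 z2] [u1 u2] [v1 v2] [w1 w2] /=.
by field.
Qed.

Lemma kinner_kmx r s t (x y z x' y' z' : C) :
  kinner r s t (kmx x y z) (kmx x' y' z') =
  r * complex.Re (x * x'^*) + s * complex.Re (y * y'^*) + t * complex.Re (z * z'^*).
Proof.
rewrite /kinner !trace_form_kmx.
have [-> -> ->] := kmxE x y z; have [-> -> ->] := kmxE x' y' z'.
by rewrite !rmorph0 !mulr0 /=; ring.
Qed.

(** The set behind [to_k] is inhabited: the off-diagonal entries of [hat x v] in the frame at x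
    define an element of [kspace] in it. So for tangent v the default value of [xget] does not
    occur. *)
Lemma to_kP x v : tangent flags x v ->
  exists p : C * C * C, to_k x v = kmx p.1.1 p.1.2 p.2 /\
    v = act (frame x) (fund (kmx p.1.1 p.1.2 p.2) b).
Proof.
move=> tv; have Fx := tangent_mem tv; have [fu fE] := frameP Fx.
have dE X : X^t* = - X -> diff_on flags (act (frame x)) b (base_tangent X) = act (frame x) (fund X b).
  by move=> Xs; rewrite base_tangentE diff_on_act //; apply: fund_tangent flags_base Xs.
rewrite /to_k; case: xgetP => [X _ [[a [b' [c ->]]] <-]|].
  by exists (a, b', c); rewrite dE //; apply: kmx_adj.
set A := co (frame x) (hat x v); have As : A^t* = - A by rewrite /A -co_adj hat_adj // coN.
move=> /(_ (kmx (A 0 1) (A 0 2%:R) (A 1 2%:R))); case; split; first by do 3!eexists.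
rewrite dE; last exact: kmx_adj.
have -> : fund (kmx (A 0 1) (A 0 2%:R) (A 1 2%:R)) b = fund A b.
  apply/eq_fund_base; apply: ord3P; apply: ord3P => // _; rewrite mxE //=;
    by rewrite ?(skew_entry 0 1 As) ?(skew_entry 0 2%:R As) ?(skew_entry 1 2%:R As).
by rewrite (act_fund _ _ fu) fE /A (coK fu) fund_hat.
Qed.

Lemma coeff_metricE r s t : 0 < r -> 0 < s -> 0 < t ->
  eq_tensor2 flags (coeff_metric r s t) (fun _ => form (coef3 r s t)).
Proof.
move=> r0 s0 t0 x v w Fx tv tw; have [fu fE] := frameP Fx; rewrite /coeff_metric.
have [p [-> ->]] := to_kP tv; have [q [-> ->]] := to_kP tw.
rewrite (form_act _ _ _ fu) kinner_kmx.
rewrite (form_coef3 r0 s0 t0 (@is_frame_base R) (kmx_adj _ _ _) (kmx_adj _ _ _)) !co1.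
have [-> -> ->] := kmxE p.1.1 p.1.2 p.2; have [-> -> ->] := kmxE q.1.1 q.1.2 q.2.
by [].
Qed.

Lemma eq_tensor2_sym (g h : flag_tensor R) : eq_tensor2 flags g h -> eq_tensor2 flags h g.
Proof. by move=> gh x v w Fx tv tw; rewrite gh. Qed.

Lemma eq_tensor2_trans (g h k : flag_tensor R) :
  eq_tensor2 flags g h -> eq_tensor2 flags h k -> eq_tensor2 flags g k.
Proof. by move=> gh hk x v w Fx tv tw; rewrite gh // hk. Qed.

Lemma i_acs : 'i * 'i = -1 :> C /\ ('i : C)^* = - 'i.
Proof. by rewrite -expr2 sqrCi conjCi. Qed.

Lemma Ni_acs : - 'i * - 'i = -1 :> C /\ (- 'i : C)^* = - - 'i.
Proof. by rewrite mulrNN -expr2 sqrCi rmorphN /= conjCi. Qed.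

(** For the converse, the relation among r, s, t settles one clause of [parallel_cond3], and the
    signs of e are chosen so that the other two hold. *)
Lemma homogeneous_kahlerP (g : flag_tensor R) : homogeneous_kahler g <->
  exists r s t : R, [/\ [/\ 0 < r, 0 < s & 0 < t], [\/ r = s + t, s = r + t | t = r + s] &
    eq_tensor2 flags g (fun _ => form (coef3 r s t))].
Proof.
split=> [[gH [J [D [Ja Ji gJ gD P]]]]|[r [s [t [[r0 s0 t0] rst gE]]]]].
  have [c cP gc] := homogeneous_metric_coef gH.
  have [e he JE] := invariant_acs_coef Ja Ji.
  have P' := (parallel_coef cP he (proj1 gH) gc gD Ja JE).1 P.
  have [_ _ cp] := cP.
  exists (c 0 1), (c 0 2%:R), (c 1 2%:R); split.
  - by split; apply: cp.
  - exact (kahler_coef cP he P').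
  - by rewrite -(coef3E cP).
have cP := coef3_positive r0 s0 t0; have [iI iC] := i_acs; have [nI nC] := Ni_acs.
apply: (homogeneous_kahler_ext (eq_tensor2_sym gE)).
case: rst => E.
- apply: (@kahler_of_coef R _ cP (skew3 'i 'i (- 'i))).
    by apply: skew3_acs => z; rewrite !inE => /or3P[] /eqP ->.
  apply/parallel_cond3 => //; first by apply: skew3_acs => z; rewrite !inE => /or3P[] /eqP ->.
  rewrite /skew3 /coef3 /=; split; [by left; rewrite subrr|by right|by left].
- apply: (@kahler_of_coef R _ cP (skew3 'i 'i 'i)).
    by apply: skew3_acs => z; rewrite !inE => /or3P[] /eqP ->.
  apply/parallel_cond3 => //; first by apply: skew3_acs => z; rewrite !inE => /or3P[] /eqP ->.
  rewrite /skew3 /coef3 /=; split; [by right|by left|by left].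
- apply: (@kahler_of_coef R _ cP (skew3 'i (- 'i) (- 'i))).
    by apply: skew3_acs => z; rewrite !inE => /or3P[] /eqP ->.
  apply/parallel_cond3 => //; first by apply: skew3_acs => z; rewrite !inE => /or3P[] /eqP ->.
  rewrite /skew3 /coef3 /=; split; [by left; rewrite subrr|by left|by right].
Qed.

Lemma homogeneous_strict_nearly_kahlerP (g : flag_tensor R) :
  homogeneous_strict_nearly_kahler g <->
  exists2 r : R, 0 < r & eq_tensor2 flags g (fun _ => form (coef3 r r r)).
Proof.
split=> [[gH [J [D [Ja Ji gJ gD [P nP]]]]]|[r r0 gE]].
  have [c cP gc] := homogeneous_metric_coef gH.
  have [e he JE] := invariant_acs_coef Ja Ji.
  have P' := (nearly_parallel_coef cP he (proj1 gH) gc gD Ja JE).1 P.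
  have nP' : ~ parallel_cond c e.
    by move=> Q; apply: nP; apply: (parallel_coef cP he (proj1 gH) gc gD Ja JE).2.
  have [E1 E2] := nearly_kahler_coef cP he P' nP'.
  have [_ _ cp] := cP; exists (c 0 1); first exact: cp.
  by have := coef3E cP; rewrite -E1 -E2 => <-.
have cP := coef3_positive r0 r0 r0; have [iI iC] := i_acs; have [nI nC] := Ni_acs.
(* With e_01 = e_12 = e_20 one has e_kb = e_ak for distinct indices; as all lam are equal here, this
   is near parallelism. *)
have he : acs_coef (skew3 'i (- 'i) 'i : _ -> _ -> C).
  by apply: skew3_acs => z; rewrite !inE => /or3P[] /eqP ->.
apply: (homogeneous_strict_nearly_kahler_ext (eq_tensor2_sym gE)).
apply: (nearly_kahler_of_coef cP he).
  have lamE a k p : a != k -> a != p -> k != p ->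
      conn_coef (coC (coef3 r r r)) a k p = (r / (2%:R * r))%:C%C.
    move=> ak ap kp; rewrite conn_coefE.
    have cE i j : i != j -> coef3 r r r i j = r by move: i j; apply: ord3P; apply: ord3P.
    by rewrite !cE // addrK.
  move=> a k p ak ap kp; rewrite !lamE // 1?eq_sym //; congr (_ * _).
  move: a k p ak ap kp; apply: ord3P; apply: ord3P; apply: ord3P => // _ _ _;
    by rewrite /skew3 /= ?opprK.
(* The first clause already fails: e_01 + e_12 = 2 i is nonzero, and r + r = r contradicts r > 0. *)
move/(parallel_cond3 cP he) => [+ _ _]; rewrite /skew3 /coef3 /= => -[/eqP|].
  rewrite -mulr2n mulrn_eq0 /= => /eqP i0; move: iI; rewrite i0 mul0r => /esym/eqP.
  by rewrite oppr_eq0 oner_eq0.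
lra.
Qed.
End Statements.

(** * Symmetries of order 3 and fibrations *)

Section Fibrations.
Context {R : realType}.
Local Notation C := (complex R).
Local Notation cmx := (@cmx R).
Local Notation flag_space := (@flag_space R).
Local Notation flags := (@flags R).
Implicit Types (x v : flag_space) (u A : 'M[C]_3).
Implicit Types (z w : C).
Local Notation b := (@base_flag R).

Lemma cj_unitary (K : numClosedFieldType) n (u A : 'M[K]_n) :
  u \is unitarymx -> A \is unitarymx -> u *m A *m u^t* \is unitarymx.
Proof. by move=> uu Au; rewrite !mul_unitarymx ?trmxC_unitary. Qed.

(** The primitive cube root of unity omega = exp (2 pi i / 3). *)
Definition cbrt1 : C := Complex (- 2^-1) (Num.sqrt 3 / 2).

Lemma cbrt1_norm : cbrt1 * cbrt1^* = 1.
Proof.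
have s3 : Num.sqrt 3 ^+ 2 = 3 :> R by rewrite sqr_sqrtr.
apply/eqP; rewrite eq_complex /=; apply/andP; split; apply/eqP; last by ring.
rewrite (_ : _ - _ = 4^-1 + Num.sqrt 3 ^+ 2 / 4); last by field.
by rewrite s3; field.
Qed.

Lemma cbrt1_cube : cbrt1 * cbrt1 * cbrt1 = 1.
Proof.
have s3 : Num.sqrt 3 ^+ 2 = 3 :> R by rewrite sqr_sqrtr.
have s33 : Num.sqrt 3 ^+ 3 = 3 * Num.sqrt 3 :> R by rewrite exprS s3 mulrC.
apply/eqP; rewrite eq_complex /=; apply/andP; split; apply/eqP.
  rewrite (_ : _ - _ = - 8^-1 + 3 * Num.sqrt 3 ^+ 2 / 8); last by field.
  by rewrite s3; field.
rewrite (_ : _ + _ = 3 * Num.sqrt 3 / 8 - Num.sqrt 3 ^+ 3 / 8); last by field.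
by rewrite s33; field.
Qed.

Lemma cbrt1_neq1 : cbrt1 <> 1.
Proof.
move=> /eqP; rewrite eq_complex /= => /andP[/eqP H _].
have : (- 2^-1 : R) < 0 by rewrite oppr_lt0 invr_gt0.
by rewrite H ltNge ler01.
Qed.

(** The values 1, omega, omega^2 are distinct, so only diagonal matrices commute with the diagonal
    matrix that they form; this is what isolates the fixed point. *)
Definition cbrt1_pow (i : 'I_3) : C := cbrt1 ^+ i.

Lemma cbrt1_pow_norm i : cbrt1_pow i * (cbrt1_pow i)^* = 1.
Proof. by rewrite /cbrt1_pow rmorphXn -exprMn cbrt1_norm expr1n. Qed.

Lemma cbrt1_pow_cube i : cbrt1_pow i * cbrt1_pow i * cbrt1_pow i = 1.
Proof. by rewrite /cbrt1_pow -!exprMn cbrt1_cube expr1n. Qed.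

Lemma cbrt1_pow_neq i j : i != j -> cbrt1_pow i * (cbrt1_pow j)^* <> 1.
Proof.
move=> ij E.
have : cbrt1_pow i = cbrt1_pow j.
  by rewrite -[cbrt1_pow i]mulr1 -(cbrt1_pow_norm j) [cbrt1_pow j * _]mulrC mulrA E mul1r.
have c0 : cbrt1 != 0.
  by apply/eqP => c0; have := cbrt1_norm; rewrite c0 mul0r => /esym/eqP; rewrite oner_eq0.
have c2 : cbrt1 ^+ 2 <> 1.
  by move=> H; apply: cbrt1_neq1; rewrite -cbrt1_cube -expr2 H mul1r.
move: i j ij {E}; apply: ord3P; apply: ord3P => // _; rewrite /cbrt1_pow /= ?expr0 ?expr1.
- by move=> /esym /cbrt1_neq1.
- by move=> /esym.
- by move=> /cbrt1_neq1.
- by move=> H; apply: cbrt1_neq1; apply: (mulfI c0); rewrite mulr1 -expr2 -H.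
- by move=> H; apply: cbrt1_neq1; apply: (mulfI c0); rewrite mulr1 -expr2; exact: H.
Qed.

Definition flag_symmetry (x : flag_space) : flag_space -> flag_space :=
  act (frame x *m diagf cbrt1_pow *m (frame x)^t*).

Lemma smooth_mx_co (u : 'M[C]_3) k : smooth_mx (fun y => co u (pr k y)).
Proof.
rewrite /smooth_mx; under eq_fun do rewrite coE.
by apply: smooth_mx_mul; [apply: smooth_mx_mul|]; first [exact: smooth_mx_cst|exact: smooth_mx_pr].
Qed.

Lemma continuous_co (u : 'M[C]_3) k i j :
  continuous (fun y : flag_space => complex.Re (co u (pr k y) i j) : R^o).
Proof.
have l : scalar (fun A : cmx => A.1 i j) by move=> a A B; rewrite !mxE.
have := smooth_comp_lin (@findim_cmx R) l (smooth_mx_co u k) => /(_ 0).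
rewrite /Ck; under eq_fun do rewrite mxE.
exact.
Qed.

Lemma diagf_cube : diagf cbrt1_pow *m diagf cbrt1_pow *m diagf cbrt1_pow = 1%:M.
Proof.
rewrite /diagf -[X in _ = X]diag_const_mx !mulmx_diag; congr diag_mx.
by apply/rowP => i; rewrite !mxE cbrt1_pow_cube.
Qed.

Lemma flag_symmetry_unitary x : flags x -> frame x *m diagf cbrt1_pow *m (frame x)^t* \is unitarymx.
Proof.
move=> Fx; exact (cj_unitary (frame_unitary Fx) (diagf_unitary cbrt1_pow_norm)).
Qed.

(** The symmetry at m acts by an element of U(3), hence by an isometry. A fixed flag has projectors
    commuting with diag (1, omega, omega^2) in the frame of m, so they are diagonal there; being
    idempotent, their diagonal entries are 0 or 1, and closeness to m determines them. *)
Lemma three_symmetric_homogeneous g : homogeneous_metric g -> three_symmetric flags g.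
Proof.
move=> [_ gi]; exists flag_symmetry => m Fm; have fu := frame_unitary Fm.
have tu := flag_symmetry_unitary Fm; have [_ fE] := frameP Fm.
have tuV : (frame m *m diagf cbrt1_pow *m (frame m)^t*)^t* \is unitarymx by rewrite trmxC_unitary.
split.
- split; last exact (gi _ tu).
  exists (act ((frame m *m diagf cbrt1_pow *m (frame m)^t*)^t*)); split.
  + by exists (flag_symmetry m) => //; exact: smooth_act.
  + by exists (act ((frame m *m diagf cbrt1_pow *m (frame m)^t*)^t*)) => //; exact: smooth_act.
  + by move=> x Fx; split; [exact (flags_act tu Fx)|exact (flags_act tuV Fx)].
  + by move=> x Fx; rewrite /flag_symmetry !actM (unitarymxVP tu) (unitarymxP tu) act1.
- move=> x Fx; rewrite /flag_symmetry !actM (cjM _ _ fu) (cjM _ _ fu) diagf_cube.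
  by rewrite mulmx1 (unitarymxP fu) act1.
- have ub : act ((frame m)^t*) m = b.
    by rewrite -{2}fE actM (unitarymxVP fu) act1.
  by rewrite /flag_symmetry -(actM _ _ m) ub -actM (act_diagf_base cbrt1_pow_norm) fE.
(* Radius 1 suffices: an entry equal to 0 or 1 that differs from the one at m is at distance exactly
   1. *)
pose P (k i : 'I_3) (x : flag_space) :=
  `|complex.Re (co (frame m) (pr k x) i i) - (i == k)%:R| < 1.
have near_diag : \forall x \near m, forall k i, P k i x.
  apply: (@filter_forall _ 'I_3 (fun k x => forall i, P k i x) (nbhs m)) => k.
  apply: (@filter_forall _ 'I_3 (P k) (nbhs m)) => i.
  have := @continuous_co (frame m) k i i m => /cvgrPdist_lt /(_ 1 ltr01).
  have -> : complex.Re (co (frame m) (pr k m) i i) = (i == k)%:R.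
    by rewrite (pr_frame k Fm) (co_proj fu) mxE andbb; case: (i == k).
  by apply: filterS => x; rewrite /P distrC.
apply: filterS near_diag => x xm Fx tx; apply: pr_inj => k; apply: (co_inj fu).
have comm_dg : diagf cbrt1_pow *m co (frame m) (pr k x) *m (diagf cbrt1_pow)^t* = co (frame m) (pr k x).
  have := pr_act x k tu; rewrite -/(flag_symmetry m) tx => /(congr1 (co (frame m))).
  by rewrite (coM fu) (coM fu) co_adj (coVK fu) => {2}->.
have off i j : i != j -> co (frame m) (pr k x) i j = 0.
  move=> ij; have := congr1 (fun A : 'M[C]_3 => A i j) comm_dg.
  rewrite /= diagf_conj mulrAC => /eqP; rewrite -subr_eq0 -[X in _ - X]mul1r -mulrBl mulf_eq0.
  by rewrite subr_eq0 => /orP[/eqP/(cbrt1_pow_neq ij)|/eqP].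
have diag i : co (frame m) (pr k x) i i * co (frame m) (pr k x) i i = co (frame m) (pr k x) i i.
  have := congr1 (fun A => co (frame m) A i i) (pr_mul k k Fx).
  rewrite eqxx scale1r (coM fu) mxE (bigD1 i) //= big1 ?addr0 // => j ji.
  by rewrite off ?mul0r // eq_sym.
apply/matrixP => i j; rewrite (pr_frame k Fm) (co_proj fu) mxE.
have [->|ij] := eqVneq i j; last first.
  by rewrite off //; case: eqP => // ik; rewrite -ik eq_sym (negbTE ij).
rewrite andbb; have := xm k j; rewrite /P; have /eqP := diag j.
rewrite -subr_eq0 -[X in _ - X]mulr1 -mulrBr mulf_eq0 subr_eq0.
case/orP => /eqP ->; case: eqP => // _; rewrite /= ?sub0r ?normrN ?subr0 ?normr1 ltxx //.
Qed.

(** Surjectivity completes a line to a flag having it at place i. For the submersion property, the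
    equations of a projector are differentiated along w; they make X = [w, P_i] skew-Hermitian with
    [X, P_i] = w. *)
Lemma fibration_flag_line i : fibration flags CP2 (@flag_line R i).
Proof.
split.
- by exists (@flag_line R i) => //; exact: smooth_flag_line.
- apply/seteqP; split=> [Q [x Fx <-]|Q [Qa Qid Qrk]].
    rewrite /CP2 /= -prU (pr_frame i Fx).
    exact: orth_projector_conj (frame_unitary Fx) (@orth_projector_line R i).
  have [u uu QE] := rank1_projector_frame i Qa Qid Qrk.
  exists (act u b); first exact: flags_act_base.
  by apply: to_mx_inj; rewrite -prU (pr_act _ _ uu) pr_base QE.
- move=> x w Fx tw; set q := flag_line i x in tw.
  have sid : smooth (fun y : cmx => y).
    exact (smooth_lin (@findim_cmx R) (fun a p q => erefl)).
  have did := smooth_differentiable q sid.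
  have dmul : differentiable (fun y : cmx => cmul y y) q by apply: differentiable_cmul.
  have dadj : differentiable (fun y : cmx => cadj y) q by apply: differentiable_cadj.
  have E1 : 'D_w (fun y : cmx => cmul y y) q = 'D_w (fun y : cmx => y) q.
    apply: derive_eq_on tw => // y [_ yy _]; apply: to_mx_inj.
    by rewrite to_mx_cmul.
  have E2 : 'D_w (fun y : cmx => cadj y) q = 'D_w (fun y : cmx => y) q.
    by apply: derive_eq_on tw => // y [ya _ _]; apply: to_mx_inj; rewrite to_mx_cadj.
  have Did : 'D_w (fun y : cmx => y) q = w by exact: derive_id.
  rewrite derive_cmul // Did in E1; rewrite derive_cadj // Did in E2.
  have qE : to_mx q = pr i x by rewrite prU.
  have {}E1 : to_mx w *m pr i x + pr i x *m to_mx w = to_mx w.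
    by rewrite -{3}E1 to_mxD !to_mx_cmul qE.
  have {}E2 : (to_mx w)^t* = to_mx w by rewrite -to_mx_cadj E2.
  have Pa := pr_adj i Fx; have Pid : pr i x *m pr i x = pr i x.
    by rewrite (pr_mul i i Fx) eqxx scale1r.
  set X := comm (to_mx w) (pr i x).
  have Xs : X^t* = - X by rewrite /X adj_comm E2 Pa commC.
  exists (fund X x); first exact: fund_tangent.
  rewrite (diff_onE (@smooth_flag_line R i) (fun _ _ => erefl) (fund_tangent Fx Xs)).
  rewrite derive_flag_line; apply: to_mx_inj; rewrite -dprU dpr_fund.
  exact: comm_comm_projector.
Qed.

Lemma flag_lines_distinct (i j : 'I_3) x : flags x -> flag_line i x = flag_line j x -> i = j.
Proof.
move=> Fx E; apply/eqP; apply: contraT => ij.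
have := pr_mul i j Fx; rewrite (negbTE ij) scale0r.
have -> : pr j x = pr i x by rewrite !prU E.
rewrite (pr_mul i i Fx) eqxx scale1r => P0.
have := congr1 (fun A => co (frame x) A i i) P0.
rewrite /= (pr_frame i Fx) (co_proj (frame_unitary Fx)) mxE !eqxx coE mulmx0 mul0mx mxE => /eqP.
by rewrite oner_eq0.
Qed.

End Fibrations.

(** * Twistor metrics *)

Section Twistor.
Context {R : realType}.
Local Notation C := (complex R).
Local Notation flag_space := (@flag_space R).
Local Notation flags := (@flags R).
Local Notation prs x := (fun i : 'I_3 => pr i x).
Implicit Types (x v : flag_space) (u A : 'M[C]_3).
Implicit Types (z w : C).

(** It is 1 when exactly one of a, c is i, which are the horizontal entries of the i-th fibration,
    and 0 otherwise: these are the coefficients of the pullback of the Fubini-Study metric.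
    [fibre_coef] marks the remaining off-diagonal, vertical entries. *)
Definition line_coef (i a c : 'I_3) : R := ((a == i)%:R - (c == i)%:R) ^+ 2.
Definition fibre_coef (i a c : 'I_3) : R := ((a != c) && (a != i) && (c != i))%:R.

Lemma eqr_bool (K : numDomainType) (p q : bool) : (p%:R == q%:R :> K) = (p == q).
Proof. by rewrite eqr_nat; case: p; case: q. Qed.

Lemma line_coef_eq0 i a c : (line_coef i a c == 0) = ((a == i) == (c == i)).
Proof. by rewrite /line_coef sqrf_eq0 subr_eq0 eqr_bool. Qed.

Lemma diff_on_flag_line i x v : tangent flags x v -> diff_on flags (@flag_line R i) x v = dline i v.
Proof.
move=> tv; rewrite (diff_onE (@smooth_flag_line R i) (fun _ _ => erefl) tv).
exact: derive_flag_line.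
Qed.

Lemma trace_dpr i x u A B : is_frame x u -> B^t* = - B ->
  \tr (dpr i (fund A x) *m dpr i (fund B x)) =
  \sum_a \sum_c (line_coef i a c)%:C%C * (co u A a c * (co u B a c)^*).
Proof.
move=> fx Bs; rewrite !dpr_fund {2}(proj2 fx i) (trace_comm_proj (proj1 fx)).
have Bs' : (co u B)^t* = - co u B by rewrite -co_adj Bs coN.
apply: eq_bigr => a _; apply: eq_bigr => c _.
rewrite (co_comm_pr _ _ _ _ fx) (skew_entry a c Bs').
rewrite /line_coef rmorphXn rmorphB /= !rmorph_nat; ring.
Qed.

Lemma fubini_study_dline i x u A B : is_frame x u -> B^t* = - B ->
  fubini_study (dline i (fund A x)) (dline i (fund B x)) =
  2^-1 * complex.Re (\sum_a \sum_c (line_coef i a c)%:C%C * (co u A a c * (co u B a c)^*)).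
Proof. by move=> fx Bs; rewrite /fubini_study -!dprU (trace_dpr i A fx Bs). Qed.

Lemma verticalP i x u (w : flag_space) : is_frame x u -> vertical i x w <->
  tangent flags x w /\ (forall a c, a != c -> line_coef i a c != 0 -> co u (hat x w) a c = 0).
Proof.
move=> fx; split=> [[tw]|[tw H]].
  rewrite (diff_on_flag_line i tw) => dw; split=> // a c ac.
  have : co u (dpr i w) a c = 0 by rewrite dprU dw to_mx0 coE mulmx0 mul0mx mxE.
  rewrite -{1}(fund_hat tw) dpr_fund (co_comm_pr _ _ _ _ fx) => /eqP.
  rewrite mulf_eq0 subr_eq0 eqr_bool line_coef_eq0 => /orP[/eqP //|ai].
  by rewrite eq_sym ai.
split=> //; rewrite (diff_on_flag_line i tw); apply: to_mx_inj; rewrite -dprU to_mx0.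
rewrite -(fund_hat tw) dpr_fund; apply: (co_inj (proj1 fx)).
have -> : co u 0 = 0 by rewrite coE mulmx0 mul0mx.
apply/matrixP => a c; rewrite (co_comm_pr _ _ _ _ fx) mxE.
have [->|ac] := eqVneq a c; first by rewrite subrr mulr0.
have [E|E] := eqVneq (line_coef i a c) 0; last by rewrite H // mul0r.
by move/eqP: E; rewrite line_coef_eq0 => /eqP ->; rewrite subrr mulr0.
Qed.

Lemma mul_conjc z : z * z^* = (complex.Re z ^+ 2 + complex.Im z ^+ 2)%:C%C.
Proof. by case: z => p q; apply/eqP; rewrite eq_complex /=; apply/andP; split; apply/eqP; ring. Qed.

(* Coefficients of the ambient inner product used to define [horizontal]. *)
Definition ambient_coef (a c : 'I_3) : R := line_coef 0 a c + line_coef 2%:R a c.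

Lemma ambient_pairing x u A B : is_frame x u -> B^t* = - B ->
  complex.Re (\tr (to_mx (fund A x).1 *m to_mx (fund B x).1)
            + \tr (to_mx (fund A x).2 *m to_mx (fund B x).2)) =
  complex.Re (\sum_a \sum_c (ambient_coef a c)%:C%C * (co u A a c * (co u B a c)^*)).
Proof.
move=> fx Bs.
have E1 y : to_mx (y : flag_space).1 = dpr 0 y by rewrite dprE.
have E2 y : to_mx (y : flag_space).2 = - dpr 2%:R y by rewrite dprE opprK.
rewrite !E1 !E2 mulNmx mulmxN opprK (trace_dpr 0 A fx Bs) (trace_dpr 2%:R A fx Bs).
congr complex.Re; rewrite -big_split; apply: eq_bigr => a _.
by rewrite -big_split; apply: eq_bigr => c _; rewrite /ambient_coef rmorphD /= mulrDl.
Qed.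

Definition vertical_blk i x (A : 'M[C]_3) := blk (prs x) (fun a c => (fibre_coef i a c)%:C%C) A.

Lemma fibre_coef_sym i a c : fibre_coef i c a = fibre_coef i a c.
Proof. by rewrite /fibre_coef eq_sym -!andbA [(c != i) && _]andbC. Qed.

Lemma vertical_blk_adj i x A : flags x -> A^t* = - A -> (vertical_blk i x A)^t* = - vertical_blk i x A.
Proof.
move=> Fx As; apply: adj_blk => //; first by move=> k; exact: pr_adj.
by move=> a c; rewrite (coC_real (fun a c => fibre_coef i a c)) fibre_coef_sym.
Qed.

Lemma co_vertical_blk i x u A a c : is_frame x u -> co u (vertical_blk i x A) a c = (fibre_coef i a c)%:C%C * co u A a c.
Proof. by move=> fx; rewrite /vertical_blk co_blk_pr. Qed.

Lemma hat_fund x u A a c : is_frame x u -> A^t* = - A -> a != c -> co u (hat x (fund A x)) a c = co u A a c.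
Proof.
move=> fx As ac; have tA := fund_tangent (is_frame_flags fx) As.
by have /(eq_fund _ _ fx)/(_ a c ac) := fund_hat tA.
Qed.

Lemma fibre_coefE i a c : a != c -> fibre_coef i a c = (line_coef i a c == 0)%:R.
Proof.
move=> ac; rewrite /fibre_coef /line_coef ac /=; move: ac; have [->|ai] := eqVneq a i.
  by rewrite eq_sym => /negbTE ->; rewrite subr0 expr1n oner_eq0.
have [->|ci] := eqVneq c i => _; last by rewrite subrr expr0n eqxx.
by rewrite sub0r sqrrN expr1n oner_eq0.
Qed.

(** The vector y is tested against its own vertical part: the pairing is a sum of nonnegative terms,
    [ambient_coef] times |A_ac|^2 over the vertical entries, so each of them vanishes. Conversely, y
    and a vertical vector have no common nonzero entry. *)
Lemma horizontalP i x u (y : flag_space) : is_frame x u -> horizontal i x y <->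
  tangent flags x y /\ (forall a c, a != c -> line_coef i a c = 0 -> co u (hat x y) a c = 0).
Proof.
move=> fx; have Fx := is_frame_flags fx; split=> [[ty H]|[ty H]]; split=> //.
  set A := hat x y; have As : A^t* = - A := hat_adj ty.
  have Ws := vertical_blk_adj i Fx As; set W := vertical_blk i x A in Ws.
  have vW : vertical i x (fund W x).
    apply/(verticalP _ _ fx); split=> [|a c ac iac]; first exact: fund_tangent.
    by rewrite (hat_fund fx Ws ac) (co_vertical_blk _ _ _ _ fx) fibre_coefE // (negbTE iac) rmorph0 mul0r.
  have := H _ vW; rewrite -{1 2}(fund_hat ty) -/A (ambient_pairing A fx Ws) => S0.
  have E a c : (ambient_coef a c)%:C%C * (co u A a c * (co u W a c)^*) =
     (ambient_coef a c * fibre_coef i a c * (complex.Re (co u A a c) ^+ 2 + complex.Im (co u A a c) ^+ 2))%:C%C.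
    rewrite (co_vertical_blk _ _ _ _ fx) rmorphM /= (coC_real (fun a c => fibre_coef i a c)).
    by rewrite [co u A a c * _]mulrCA mul_conjc mulrA -!rmorphM.
  move: S0; under eq_bigr do under eq_bigr do rewrite E.
  under eq_bigr do rewrite -rmorph_sum.
  rewrite -rmorph_sum /= => S0 a c ac iac.
  have h0 p q : 0 <= ambient_coef p q by rewrite addr_ge0 // sqr_ge0.
  have t0 p q : 0 <= ambient_coef p q * fibre_coef i p q * (complex.Re (co u A p q) ^+ 2 + complex.Im (co u A p q) ^+ 2).
    by rewrite mulr_ge0 ?addr_ge0 ?sqr_ge0 // mulr_ge0 // ler0n.
  have /(_ a isT) := psumr_eq0P (fun p _ => sumr_ge0 _ (fun q _ => t0 p q)) S0.
  move=> /(psumr_eq0P (fun q _ => t0 a q)) /(_ c isT) /eqP.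
  (* Off the diagonal [ambient_coef] takes the values 1 and 2, which excludes the first
     alternative. *)
  rewrite fibre_coefE // iac eqxx mulr1 mulf_eq0 => /orP[|].
    rewrite paddr_eq0 ?sqr_ge0 // !sqrf_eq0 !subr_eq0 !eqr_nat.
    move: a c ac {iac}; apply: ord3P; apply: ord3P => //.
  rewrite paddr_eq0 ?sqr_ge0 // !sqrf_eq0 => /andP[/eqP Re0 /eqP Im0].
  by apply/eqP; rewrite eq_complex Re0 Im0 !eqxx.
move=> w /(verticalP _ _ fx) [tw Hw].
rewrite -(fund_hat ty) -(fund_hat tw) (ambient_pairing _ fx (hat_adj tw)).
rewrite big1 // => a _; rewrite big1 // => c _.
have [->|ac] := eqVneq a c.
  by rewrite /ambient_coef /line_coef !subrr expr0n /= addr0 rmorph0 mul0r.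
have [E|E] := eqVneq (line_coef i a c) 0; first by rewrite H // mul0r mulr0.
by rewrite Hw // rmorph0 !mulr0.
Qed.

(** Splitting the entries into vertical and horizontal ones gives a decomposition of v, and the only
    one, so [xget] chooses it. *)
Lemma vertical_partE i x v : tangent flags x v ->
  vertical_part i x v = fund (vertical_blk i x (hat x v)) x.
Proof.
move=> tv; have Fx := tangent_mem tv; have fx := is_frame_frame Fx.
set A := hat x v; have As : A^t* = - A := hat_adj tv.
have Ws := vertical_blk_adj i Fx As; set W := vertical_blk i x A in Ws *; set u := frame x in fx.
have tW := fund_tangent Fx Ws.
have vE : v = fund A x by rewrite fund_hat.
rewrite /vertical_part; case: xgetP => [w _ [vw hw]|].
  have [tw Hw] := (verticalP i w fx).1 vw; have [tvw Hh] := (horizontalP i (v - w) fx).1 hw.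
  rewrite -(fund_hat tw); apply/(eq_fund _ _ fx) => a c ac; rewrite (co_vertical_blk _ _ _ _ fx) fibre_coefE //.
  have [E|E] := eqVneq (line_coef i a c) 0; last by rewrite Hw // rmorph0 mul0r.
  have := Hh a c ac E; have -> : hat x (v - w) = A - hat x w.
    by rewrite /A !hatE -sumrB; apply: eq_bigr => k _; rewrite dprB mulmxBl.
  by rewrite coB addmxE oppmxE rmorph1 mul1r => /subr0_eq.
move=> /(_ (fund W x)); case; split.
  apply/(verticalP _ _ fx); split=> // a c ac iac.
  by rewrite (hat_fund fx Ws ac) (co_vertical_blk _ _ _ _ fx) fibre_coefE // (negbTE iac) rmorph0 mul0r.
apply/(horizontalP _ _ fx); split=> [|a c ac iac]; first exact: tangentB.
have AWs : (A - W)^t* = - (A - W) by rewrite adjB As Ws opprD.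
rewrite {1}vE -fundB (hat_fund fx AWs ac) coB addmxE oppmxE (co_vertical_blk _ _ _ _ fx).
by rewrite fibre_coefE // iac eqxx rmorph1 mul1r subrr.
Qed.

Definition twistor_coef (i : 'I_3) (tau : R) (a c : 'I_3) : R := line_coef i a c + tau * fibre_coef i a c.

Lemma twistor_coef_positive i tau : 0 < tau -> positive_coef (twistor_coef i tau).
Proof.
move=> t0; split.
- by move=> a; rewrite /twistor_coef /line_coef /fibre_coef subrr expr0n eqxx /= mulr0 addr0.
- by move=> a c; rewrite /twistor_coef fibre_coef_sym /line_coef -sqrrN opprB.
- move=> a c ac; rewrite /twistor_coef fibre_coefE //; have [->|E] := eqVneq (line_coef i a c) 0.
    by rewrite add0r mulr1.
  by rewrite mulr0 addr0 lt_def E sqr_ge0.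
Qed.

Lemma twistor_metricE i tau : 0 < tau ->
  eq_tensor2 flags (twistor_metric i tau) (fun _ => form (twistor_coef i tau)).
Proof.
move=> t0 x v w Fx tv tw; have fx := is_frame_frame Fx.
have As := hat_adj tv; have Bs := hat_adj tw.
rewrite /twistor_metric /fibre_metric !vertical_partE //.
have VAs := vertical_blk_adj i Fx As; have VBs := vertical_blk_adj i Fx Bs.
rewrite (diff_on_flag_line _ tv) (diff_on_flag_line _ tw).
rewrite (diff_on_flag_line _ (fund_tangent Fx VAs)) (diff_on_flag_line _ (fund_tangent Fx VBs)).
rewrite -{1}(fund_hat tv) -{1}(fund_hat tw).
rewrite (fubini_study_dline _ _ fx Bs) (fubini_study_dline _ _ fx VBs).
have -> : form (twistor_coef i tau) v w =
    form (twistor_coef i tau) (fund (hat x v) x) (fund (hat x w) x) by rewrite !fund_hat.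
rewrite (form_co (twistor_coef_positive i t0) _ fx Bs).
set A := hat x v; set B := hat x w; set u := frame x.
rewrite mulrCA -mulrDr; congr (_ * _).
have ReZ (a : R) (y : C) : a * complex.Re y = complex.Re (a%:C%C * y).
  by case: y => p q /=; rewrite mul0r subr0.
have ReD (y y' : C) : complex.Re y + complex.Re y' = complex.Re (y + y') by case: y; case: y'.
rewrite ReZ ReD; congr complex.Re; rewrite mulr_sumr -big_split; apply: eq_bigr => a _.
rewrite mulr_sumr -big_split; apply: eq_bigr => c _.
(* A pair of distinct indices other than i contains [ordS i], so the line numbered [ordS i] sees the
   vertical entries with coefficient 1. *)
have E : line_coef (ordS i) a c * fibre_coef i a c * fibre_coef i a c = fibre_coef i a c.
  have O0 : ordS (0 : 'I_3) = 1 by apply: val_inj.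
  have O1 : ordS (1 : 'I_3) = 2%:R by apply: val_inj.
  have O2 : ordS (2%:R : 'I_3) = 0 by apply: val_inj.
  move: i a c {t0 As Bs VAs VBs A B}; apply: ord3P; rewrite ?O0 ?O1 ?O2;
    apply: ord3P; apply: ord3P; rewrite /line_coef /fibre_coef /= ?mulr0 ?mulr1 ?subr0 ?sub0r ?sqrrN ?expr1n //.
have -> : coC (twistor_coef i tau) a c = (line_coef i a c)%:C%C +
    tau%:C%C * ((line_coef (ordS i) a c)%:C%C * (fibre_coef i a c)%:C%C * (fibre_coef i a c)%:C%C).
  by rewrite -!rmorphM E /coC /twistor_coef rmorphD rmorphM.
have conjM (y y' : C) : (y * y')^* = y^* * y'^* by rewrite rmorphM.
rewrite !(co_vertical_blk _ _ _ _ fx) conjM (coC_real (fun a c => fibre_coef i a c)) /=; ring.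
Qed.

End Twistor.

(** * Comparison of the three families with the twistor metrics *)

Section MetricClassification.
Context {R : realType}.
Local Notation C := (complex R).
Local Notation flag_space := (@flag_space R).
Local Notation flags := (@flags R).
Implicit Types (x v : flag_space) (u A : 'M[C]_3).
Implicit Types (z w : C).
Local Notation b := (@base_flag R).

Lemma form_coef3Z k r s t (v w : flag_space) :
  form (coef3 (k * r) (k * s) (k * t)) v w = k * form (coef3 r s t) v w.
Proof.
rewrite !formE mulrN; congr (- _); rewrite mulrCA; congr (_ * _).
have ReZ (z : C) : k * complex.Re z = complex.Re (k%:C%C * z).
  by case: z => p q /=; rewrite mul0r subr0.
rewrite ReZ; congr complex.Re; rewrite mulr_sumr; apply: eq_bigr => i _.
rewrite mulr_sumr; apply: eq_bigr => j _; rewrite mulrA; congr (_ * _).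
rewrite /coC -rmorphM /=; congr (_%:C%C).
by move: i j; apply: ord3P; apply: ord3P; rewrite /coef3 /= ?mulr0.
Qed.

(** The vectors [kmx 1 0 0], [kmx 0 1 0] and [kmx 0 0 1] at the base flag read off the
    coefficients. *)
Lemma form_coef3_inj (r s t r' s' t' : R) : 0 < r -> 0 < s -> 0 < t -> 0 < r' -> 0 < s' -> 0 < t' ->
  eq_tensor2 flags (fun _ => form (coef3 r s t)) (fun _ => form (coef3 r' s' t')) ->
  [/\ r = r', s = s' & t = t'].
Proof.
move=> r0 s0 t0 r0' s0' t0' E.
have D (x y z : C) : r * complex.Re (x * x^*) + s * complex.Re (y * y^*) + t * complex.Re (z * z^*) =
    r' * complex.Re (x * x^*) + s' * complex.Re (y * y^*) + t' * complex.Re (z * z^*).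
  have As := kmx_adj x y z; have tA := fund_tangent flags_base As.
  have := E b _ _ flags_base tA tA.
  rewrite (form_coef3 r0 s0 t0 (@is_frame_base R) As As) (form_coef3 r0' s0' t0' (@is_frame_base R) As As) !co1.
  by have [-> -> ->] := kmxE x y z.
split; [have := D 1 0 0|have := D 0 1 0|have := D 0 0 1];
  by rewrite !(rmorph0, rmorph1, mulr0, mulr1) /= !(mulr0, mulr1, add0r, addr0).
Qed.

Lemma twistor_coefE (tau : R) : 0 < tau ->
  [/\ twistor_coef (2%:R : 'I_3) tau = coef3 tau 1 1, twistor_coef (1 : 'I_3) tau = coef3 1 tau 1
    & twistor_coef (0 : 'I_3) tau = coef3 1 1 tau].
Proof.
move=> t0; split; rewrite (coef3E (twistor_coef_positive _ t0)) /twistor_coef /line_coef /fibre_coef /=;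
  by rewrite ?subr0 ?sub0r ?sqrrN ?subrr ?expr1n ?expr0n /= ?mulr0 ?mulr1 ?addr0 ?add0r.
Qed.

(** Among the coefficients 1, 1, tau the relation 1 = 1 + tau is excluded by tau > 0, which leaves
    tau = 1 + 1. *)
Lemma natural_kahlerP i (tau : R) : natural_kahler i tau <-> tau = 2 :> R.
Proof.
have one : 0 < 1 :> R := ltr01.
split=> [[t0 /homogeneous_kahlerP [r [s [t [[r0 s0 t0'] rst]]]]]|->].
  move=> /(eq_tensor2_trans (eq_tensor2_sym (twistor_metricE i t0))).
  have [E2 E1 E0] := twistor_coefE t0; move: i; apply: ord3P; rewrite ?E0 ?E1 ?E2.
  - by move=> /(form_coef3_inj one one t0 r0 s0 t0') [rE sE tE]; move: rst; rewrite -rE -sE -tE => -[]; lra.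
  - by move=> /(form_coef3_inj one t0 one r0 s0 t0') [rE sE tE]; move: rst; rewrite -rE -sE -tE => -[]; lra.
  - by move=> /(form_coef3_inj t0 one one r0 s0 t0') [rE sE tE]; move: rst; rewrite -rE -sE -tE => -[]; lra.
have two : 0 < 2 :> R := ltr0Sn _ _; split; first exact: two.
have [E2 E1 E0] := twistor_coefE two; have := twistor_metricE i two.
have d2 : (2 : R) = 1 + 1 by [].
move: i; apply: ord3P; rewrite ?E0 ?E1 ?E2 => E; apply/homogeneous_kahlerP.
- by exists 1, 1, 2; split; [|exact: (Or33 _ _ d2)|].
- by exists 1, 2, 1; split; [|exact: (Or32 _ _ d2)|].
- by exists 2, 1, 1; split; [|exact: (Or31 _ _ d2)|].
Qed.

Lemma coeff_natural_kahler i (la r s t : R) : 0 < la ->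
  twistor_coef i 2 = coef3 r s t -> 0 < la * r -> 0 < la * s -> 0 < la * t ->
  is_natural_kahler_up_to_scaling i (coeff_metric (la * r) (la * s) (la * t)).
Proof.
(* The twistor parameter is 2, and la is the scale because the coefficients are la times those of
   the twistor metric. *)
move=> l0 cE r0 s0 t0; exists 2, la; split; last 1 first.
- apply: (eq_tensor2_trans (coeff_metricE r0 s0 t0)) => x v w Fx tv tw.
  rewrite /scale_metric form_coef3Z (twistor_metricE i _ Fx tv tw); last exact: ltr0Sn.
  by rewrite cE.
- by split=> [|tau /natural_kahlerP ->]; first exact/natural_kahlerP.
- exact: l0.
Qed.

End MetricClassification.

(* The fibrations onto p^perp, l^perp /\ p and l are numbered 2, 1 and 0. *)
Theorem proposition5p4 (R : realType) :
  (* exactly one homogeneous strictly nearly Kahler metric up to scaling *)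
  [/\ exists g : flag_tensor R,
        homogeneous_strict_nearly_kahler g,
      forall g h : flag_tensor R,
        homogeneous_strict_nearly_kahler g ->
        homogeneous_strict_nearly_kahler h ->
        exists2 c : R, 0 < c & eq_tensor2 flags h (scale_metric c g) &
      forall g : flag_tensor R,
        homogeneous_strict_nearly_kahler g -> three_symmetric flags g] /\
  (* the homogeneous Kahler metrics *)
  (forall g : flag_tensor R,
    homogeneous_kahler g <->
    exists la mu : R, [/\ 0 < la, 0 < mu &
      [\/ eq_tensor2 flags g (g1 la mu), eq_tensor2 flags g (g2 la mu) |
          eq_tensor2 flags g (g3 la mu)]]) /\
  (* the three fibrations over CP(2) *)
  [/\ forall i : 'I_3, fibration flags CP2 (@flag_line R i) &
      forall (i j : 'I_3) (x : @flag_space R), flags x ->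
        flag_line i x = flag_line j x -> i = j] /\
  (* lambda = mu *)
  (forall la : R, 0 < la ->
    [/\ is_natural_kahler_up_to_scaling (2%:R : 'I_3) (g1 la la),
        is_natural_kahler_up_to_scaling (1 : 'I_3) (g2 la la) &
        is_natural_kahler_up_to_scaling (0 : 'I_3) (g3 la la)]).
Proof.
split; [split|split; [|split; [split|]]].
- exists (fun _ => form (coef3 1 1 1)); apply/homogeneous_strict_nearly_kahlerP.
  by exists 1; [exact: ltr01|].
- move=> g h /homogeneous_strict_nearly_kahlerP [r r0 gE] /homogeneous_strict_nearly_kahlerP [s s0 hE].
  exists (s / r); first exact: divr_gt0.
  move=> x v w Fx tv tw; rewrite /scale_metric (gE _ _ _ Fx tv tw) (hE _ _ _ Fx tv tw).
  by rewrite -form_coef3Z divfK // gt_eqF.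
- by move=> g [gH _]; exact: three_symmetric_homogeneous.
- move=> g; apply: (iff_trans (homogeneous_kahlerP g)); split.
    move=> [r [s [t [[r0 s0 t0] rst gE]]]].
    have {}gE := eq_tensor2_trans gE (eq_tensor2_sym (coeff_metricE r0 s0 t0)).
    case: rst => E.
    + by exists s, t; split=> //; apply: Or31; rewrite /g1 -E.
    (* In [g2] the parameters la and mu are t and r, so the relation s = r + t is read in the order
       la + mu. *)
    + by exists t, r; split=> //; apply: Or32; rewrite /g2 addrC -E.
    + by exists r, s; split=> //; apply: Or33; rewrite /g3 -E.
  move=> [la [mu [l0 m0 gE]]]; have lm0 := addr_gt0 l0 m0.
  case: gE => gE.
  + exists (la + mu), la, mu; split=> //; first exact: Or31.
    exact: (eq_tensor2_trans gE (coeff_metricE lm0 l0 m0)).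
  + exists mu, (la + mu), la; split=> //; first by apply: Or32; rewrite addrC.
    exact: (eq_tensor2_trans gE (coeff_metricE m0 lm0 l0)).
  + exists la, mu, (la + mu); split=> //; first exact: Or33.
    exact: (eq_tensor2_trans gE (coeff_metricE l0 m0 lm0)).
- exact: fibration_flag_line.
- exact: flag_lines_distinct.
move=> la l0; have two : 0 < 2 :> R := ltr0Sn _ _; have [E2 E1 E0] := twistor_coefE two.
have l2 : 0 < la * 2 := mulr_gt0 l0 two.
have l1 : 0 < la * 1 by rewrite mulr1.
have d2 : la + la = la * 2 by rewrite mulrDr mulr1.
rewrite /g1 /g2 /g3 d2; split.
- by have := coeff_natural_kahler l0 E2 l2 l1 l1; rewrite mulr1.
- by have := coeff_natural_kahler l0 E1 l1 l2 l1; rewrite mulr1.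
- by have := coeff_natural_kahler l0 E0 l1 l1 l2; rewrite mulr1.
Qed.
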